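(* Let $d\ge 1$ be an integer and let $\lambda>0$. Then the Besov-type space $\mathcal{B}^{\lambda}_1(\mathbb{R}^d)$ is the trace space of the weighted Sobolev space $W^{1,1}(\mathbb{R}^{d+1}_+,\mu_0^{\lambda})$.
   Context: Notation. $\mathbb{R}^{d+1}_+=\{(x,t):x\in\mathbb{R}^d,\ t>0\}$; $m_n$ is $n$-dimensional Lebesgue measure; $\log^{\lambda}s=(\log s)^{\lambda}$; $\mathbb{N}=\{0,1,2,\dots\}$. $L^1(\mathbb{R}^d)$ is taken with respect to $m_d$. Trace space. A function space $\mathbb{X}(\mathbb{R}^d)$ is the trace space of a function space $\mathbb{Y}(\mathbb{R}^{d+1}_+)$ if every function in $\mathbb{Y}(\mathbb{R}^{d+1}_+)$ has a trace in $\mathbb{X}(\mathbb{R}^d)$ and every function in $\mathbb{X}(\mathbb{R}^d)$ is the trace of some function in $\mathbb{Y}(\mathbb{R}^{d+1}_+)$. The trace of a function $f$ is $\mathscr{T}f$ defined below. Weight and measure. The weight $\omega_0^\lambda:\mathbb{R}^{d+1}_+\to(0,\infty)$ is $\omega_0^\lambda(x_1,\dots,x_{d+1})=\log^{\lambda}\frac{4}{|x_{d+1}|}$ if $x_{d+1}\in(0,1]$ and $=\log^{\lambda}4$ if $x_{d+1}\in(1,\infty)$. The measure $\mu_0^\lambda$ on $\mathbb{R}^{d+1}_+$ is $\mu_0^\lambda(E)=\frac{1}{\log^{\lambda}4}\int_E\omega_0^\lambda\,dm_{d+1}$. Sobolev space. $W^{1,1}(\mathbb{R}^{d+1}_+,\mu_0^\lambda)$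 is the normed space of all measurable $f\in L^1_{\rm loc}(\mathbb{R}^{d+1}_+)$ whose first-order distributional derivatives, denoted $\nabla f$, belong to $L^1_{\rm loc}(\mathbb{R}^{d+1}_+)$ and such that $\|f\|_{L^1(\mathbb{R}^{d+1}_+,\mu_0^\lambda)}+\|\nabla f\|_{L^1(\mathbb{R}^{d+1}_+,\mu_0^\lambda)}<\infty$. Dyadic cubes. For $k\in\mathbb{Z}$, $\mathscr{Q}_{d,k}$ is the collection of cubes $Q=2^{-k}\big((0,1]^d+m\big)$, $m\in\mathbb{Z}^d$, with edge length $\ell(Q)=2^{-k}$. For $Q\in\mathscr{Q}_{d,k}$ put $\mathscr{W}(Q)=Q\times(2^{-k},2^{-k+1}]$ and $\mathscr{N}(Q)=\{y\in\mathbb{R}^{d+1}_+:\operatorname{dist}(y,\mathscr{W}(Q))<\frac14\ell(Q)\}$. Selected neighbors. Let $j\in\mathbb{N}$ and $Q\in\mathscr{Q}_{d,2^j}$ (so $\ell(Q)=2^{-2^j}$). A dyadic cube $Q'$ is a selected neighbor of $Q$, written $Q'\asymp Q$, if $Q'\in\mathscr{Q}_{d,2^j}\cup\mathscr{Q}_{d,2^{j-1}}$ and $\overline{Q}\cap\overline{Q'}\ne\emptyset$; by convention $\mathscr{Q}_{d,2^{-1}}:=\mathscr{Q}_{d,1}$. Besov-type space. For $\lambda>0$, $\mathcal{B}^{\lambda}_1(\mathbb{R}^d)$ is the normed space of all measurable $f\in L^1_{\rm loc}(\mathbb{R}^d)$ with $\|f\|_{\mathcal{B}^{\lambda}_1(\mathbb{R}^d)}:=\|f\|_{L^1(\mathbb{R}^d)}+\sum_{j=0}^{\infty}(2^j+2)^{\lambda}\sum_{Q\in\mathscr{Q}_{d,2^j}}m_d(Q)\sum_{Q'\asymp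 Q}|f_Q-f_{Q'}|<\infty$, where $f_Q=\frac{1}{m_d(Q)}\int_Qf\,dm_d$. Trace. For $f\in L^1_{\rm loc}(\mathbb{R}^{d+1}_+)$ and $k\in\mathbb{N}$ define $\mathscr{T}_kf:\mathbb{R}^d\to\mathbb{R}$ by $\mathscr{T}_kf=\sum_{Q\in\mathscr{Q}_{d,k}}\Big(\frac{1}{m_{d+1}(\mathscr{N}(Q))}\int_{\mathscr{N}(Q)}f\,dm_{d+1}\Big)\chi_Q$. The trace function is $\mathscr{T}f=\lim_{k\to\infty}\mathscr{T}_kf$, provided the (finite) limit exists $m_d$-a.e. in $\mathbb{R}^d$. *)

(* Defs.v *)
From HB Require Import structures.
From mathcomp Require Import all_boot all_order all_algebra.
From mathcomp Require Import all_classical all_reals all_analysis.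
From mathcomp Require Import measurable_realfun.

Set Implicit Arguments.
Unset Strict Implicit.
Unset Printing Implicit Defensive.

Import Order.TTheory GRing.Theory Num.Theory.
Import numFieldNormedType.Exports.

Local Open Scope classical_set_scope.
Local Open Scope ring_scope.

(* R^n is 'rV[R]_n.  Its canonical sigma-algebra, generated by the coordinate
   maps, is the Borel one; it only serves to build the Lebesgue measure, which
   lives on the completed sigma-algebra of [lebesgueType] below. *)
Section rV_borel.
Context {R : realType} {n : nat}.

Let coord (i : 'I_n) (x : 'rV[R]_n) : R := x ord0 i.

Let borel0 : g_sigma_preimage coord set0.
Proof. exact: sigma_algebra0. Qed.

Let borelC A : g_sigma_preimage coord A -> g_sigma_preimage coord (~` A).
Proof. exact: sigma_algebraC. Qed.

Let borel_bigcup (F : (set 'rV[R]_n)^nat) :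
  (forall i, g_sigma_preimage coord (F i)) ->
  g_sigma_preimage coord (\bigcup_i F i).
Proof. exact: sigma_algebra_bigcup. Qed.

HB.instance Definition _ := @isMeasurable.Build default_measure_display
  'rV[R]_n (g_sigma_preimage coord) borel0 borelC borel_bigcup.

Lemma measurable_coord (i : 'I_n) :
  measurable_fun [set: 'rV[R]_n] (fun x : 'rV[R]_n => x ord0 i).
Proof.
move=> _ Y mY; rewrite setTI; apply: sub_sigma_algebra => /=.
rewrite -bigcup_seq/=; exists i => /=; first by rewrite mem_index_enum.
by exists Y => //; rewrite setTI.
Qed.

Lemma measurable_fun_rV d (T : measurableType d) (f : T -> 'rV[R]_n) :
  (forall i, measurable_fun [set: T] (fun x => f x ord0 i)) ->
  measurable_fun [set: T] f.
Proof.
move=> mf _ A mA; rewrite setTI.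
have : preimage_set_system setT f (g_sigma_preimage coord) (f @^-1` A).
  by exists A => //; rewrite setTI.
rewrite -g_sigma_preimage_comp; apply: smallest_sub.
  exact: sigma_algebra_measurable.
elim/big_ind : _ => //[B C sB sC|i _].
  by rewrite subUset.
by move=> B [C mC <-]; exact: mf.
Qed.

End rV_borel.

Section lebesgue_rV.
Context {R : realType}.

(* (x, t) in R^n x R, seen as a point of R^(n+1) with last coordinate t *)
Definition rV_rcons n (p : 'rV[R]_n * R) : 'rV[R]_n.+1 :=
  \row_i if unlift ord_max i is Some j then p.1 ord0 j else p.2.

(* (x_1, ..., x_n, t) |-> (x_1, ..., x_n) *)
Definition rV_init n (y : 'rV[R]_n.+1) : 'rV[R]_n :=
  \row_i y ord0 (lift ord_max i).

Lemma measurable_rV_rcons n : measurable_fun setT (@rV_rcons n).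
Proof.
apply: measurable_fun_rV => i.
under eq_fun do rewrite mxE.
case: unliftP => [j _|_]; last exact: measurable_snd.
apply: (@measurableT_comp _ _ _ _ _ _ (fun x : 'rV[R]_n => x ord0 j)) => //.
exact: measurable_coord.
Qed.

Section step.
Variables (n : nat) (mu : {measure set 'rV[R]_n -> \bar R}).

Definition borel_lebesgue_step : set 'rV[R]_n.+1 -> \bar R :=
  pushforward (mu \x lebesgue_measure)%E (@rV_rcons n).

Let step0 : borel_lebesgue_step set0 = 0%E.
Proof. by rewrite /borel_lebesgue_step /pushforward preimage_set0 measure0. Qed.

Let step_ge0 A : (0 <= borel_lebesgue_step A)%E.
Proof. by apply: integral_ge0 => x _; exact: measure_ge0. Qed.

Let step_sigma_additive : semi_sigma_additive borel_lebesgue_step.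
Proof.
move=> F mF tF mUF; rewrite /borel_lebesgue_step /pushforward preimage_bigcup.
apply: measure_semi_sigma_additive.
- by move=> k; rewrite -[X in measurable X]setTI; exact: measurable_rV_rcons.
- apply/trivIsetP => /= i j _ _ ij; rewrite -preimage_setI.
  by move/trivIsetP : tF => /(_ _ _ _ _ ij) ->//; rewrite preimage_set0.
- rewrite -preimage_bigcup -[X in measurable X]setTI.
  exact: measurable_rV_rcons.
Qed.

HB.instance Definition _ := isMeasure.Build _ _ _
  borel_lebesgue_step step0 step_ge0 step_sigma_additive.

End step.

Fixpoint borel_lebesgue n : {measure set 'rV[R]_n -> \bar R} :=
  match n return {measure set 'rV[R]_n -> \bar R} with
  | 0 => dirac (0 : 'rV[R]_0)
  | n'.+1 => borel_lebesgue_step (borel_lebesgue n')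
  end.

(* R^n with the sigma-algebra of its Lebesgue measurable sets *)
Definition lebesgueType n := caratheodory_type ((borel_lebesgue n)^*)%mu.

HB.instance Definition _ n := Measurable.on (lebesgueType n).

Definition leb n : set (lebesgueType n) -> \bar R :=
  @completed_measure_extension _ _ _ (borel_lebesgue n).

HB.instance Definition _ n := Measure.on (@leb n).

End lebesgue_rV.
Arguments lebesgueType : clear implicits.

Section function_spaces.
Context {R : realType}.

Lemma borel_measurable_lebesgue n (A : set 'rV[R]_n) :
  measurable A -> measurable (A : set (lebesgueType R n)).
Proof. exact: caratheodory_measurable_mu_ext. Qed.

Definition average n (A : set (lebesgueType R n)) (f : 'rV[R]_n -> R) : R :=
  (fine (leb A))^-1 * \int[@leb R n]_(x in A) f x.

Definition enorm n (v : 'rV[R]_n) : R :=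
  Num.sqrt (\sum_i v ord0 i ^+ 2).

Definition edist n (y : 'rV[R]_n) (A : set 'rV[R]_n) : R :=
  inf [set enorm (y - z) | z in A].

(* f \in L^1_loc(U), for U open; only the values of f on U matter *)
Definition L1loc n (U : set 'rV[R]_n) (f : 'rV[R]_n -> R) : Prop :=
  measurable_fun (U : set (lebesgueType R n)) f /\
  forall K : set 'rV[R]_n, compact K -> K `<=` U ->
    (@leb R n).-integrable K (EFin \o f).

Definition partial n (i : 'I_n) (f : 'rV[R]_n -> R) : 'rV[R]_n -> R :=
  'D_(delta_mx ord0 i) f.

(* C^oo: (Frechet) differentiability of every iterated partial derivative gives
   the existence and continuity of those of the next order *)
Definition smooth n (f : 'rV[R]_n -> R) : Prop :=
  forall (s : seq 'I_n) x, differentiable (foldr (@partial n) f s) x.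

Definition test_function n (U : set 'rV[R]_n) (phi : 'rV[R]_n -> R) : Prop :=
  smooth phi /\
  exists K : set 'rV[R]_n,
    [/\ compact K, K `<=` U & forall x, ~ K x -> phi x = 0].

(* g is the i-th partial derivative of f on U in the sense of distributions *)
Definition weak_partial n (U : set 'rV[R]_n) (i : 'I_n)
    (f g : 'rV[R]_n -> R) : Prop :=
  forall phi, test_function U phi ->
    \int[@leb R n]_(y in U) (f y * partial i phi y) =
    - \int[@leb R n]_(y in U) (g y * phi y).

Section upper_half_space.
Variable d : nat.

(* the last coordinate of (x, t) in R^d x R *)
Definition height (y : 'rV[R]_d.+1) : R := y ord0 ord_max.

Definition halfspace : set 'rV[R]_d.+1 := [set y | 0 < height y].

Definition weight (lambda : R) (y : 'rV[R]_d.+1) : R :=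
  if height y <= 1 then ln (4 / `|height y|) `^ lambda else ln 4 `^ lambda.

(* mu_0^lambda, as a measure on R^(d+1) that vanishes outside the half-space *)
Definition wmeasure (lambda : R) (E : set (lebesgueType R d.+1)) : \bar R :=
  ((ln 4 `^ lambda)^-1%:E *
   \int[@leb R d.+1]_(y in E `&` halfspace) (weight lambda y)%:E)%E.

Section wmeasure_measure.
Variable lambda : R.

Lemma measurable_height :
  measurable_fun [set: lebesgueType R d.+1] height.
Proof.
move=> _ Y mY; rewrite setTI; apply: borel_measurable_lebesgue.
by rewrite -[X in measurable X]setTI; exact: measurable_coord.
Qed.

Lemma measurable_halfspace :
  measurable (halfspace : set (lebesgueType R d.+1)).
Proof.
have := measurable_height measurableT (measurable_itv `]0%R, +oo[%R).
rewrite setTI; congr measurable.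
by apply/seteqP; split => x; rewrite /halfspace/= in_itv/= andbT.
Qed.

Lemma measurable_weight :
  measurable_fun (halfspace : set (lebesgueType R d.+1)) (weight lambda).
Proof.
have mh := measurable_height.
pose w (y : lebesgueType R d.+1) :=
  if height y <= 1 then (ln 4 - ln (height y)) `^ lambda else ln 4 `^ lambda.
suff : measurable_fun (halfspace : set (lebesgueType R d.+1)) w.
  apply: eq_measurable_fun => y /[!inE] y0; rewrite /weight /w.
  by rewrite gtr0_norm// ln_div// posrE.
apply: (@measurable_funS _ _ _ _ setT) => //.
apply: measurable_fun_ifT => //; first exact: measurable_fun_ler.
apply: (measurableT_comp (measurable_powR lambda)).
by apply: measurable_funB => //; exact: measurableT_comp (@measurable_ln R) mh.
Qed.

Lemma weight_ge0 (y : 'rV[R]_d.+1) : 0 <= weight lambda y.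
Proof. by rewrite /weight; case: ifP => _; exact: powR_ge0. Qed.

Let wmeasure0 : wmeasure lambda set0 = 0%E.
Proof. by rewrite /wmeasure set0I integral_set0 mule0. Qed.

Let wmeasure_ge0 (A : set (lebesgueType R d.+1)) : (0 <= wmeasure lambda A)%E.
Proof.
apply: mule_ge0; first by rewrite lee_fin invr_ge0 powR_ge0.
by apply: integral_ge0 => y _; rewrite lee_fin weight_ge0.
Qed.

Let wmeasure_sigma_additive : semi_sigma_additive (wmeasure lambda).
Proof.
move=> F mF tF mUF; rewrite /wmeasure setI_bigcupl.
have mFH i : measurable (F i `&` (halfspace : set (lebesgueType R d.+1))).
  by apply: measurableI => //; exact: measurable_halfspace.
rewrite ge0_integral_bigcup//; last first.
- apply/trivIsetP => i j _ _ ij; rewrite setIACA.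
  by move/trivIsetP : tF => ->//; rewrite set0I.
- by move=> y _; rewrite lee_fin weight_ge0.
- apply: (measurable_funS measurable_halfspace).
    by move=> y [i _ []].
  by apply/measurable_EFinP; exact: measurable_weight.
rewrite -nneseriesZl; last first.
  by move=> i _; apply: integral_ge0 => y _; rewrite lee_fin weight_ge0.
by apply: is_cvg_nneseries => i _ _; exact: wmeasure_ge0.
Qed.

HB.instance Definition _ := isMeasure.Build _ _ _ (wmeasure lambda)
  wmeasure0 wmeasure_ge0 wmeasure_sigma_additive.
End wmeasure_measure.

Definition sobolev11 (lambda : R) : set ('rV[R]_d.+1 -> R) :=
  [set f | L1loc halfspace f /\
    exists g : 'rV[R]_d.+1 -> 'rV[R]_d.+1,
      (forall i, L1loc halfspace (fun y => g y ord0 i) /\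
         weak_partial halfspace i f (fun y => g y ord0 i)) /\
      (\int[wmeasure lambda]_(y in halfspace) `|f y|%:E +
       \int[wmeasure lambda]_(y in halfspace) (enorm (g y))%:E < +oo)%E].

Definition cube (k : int) (m : 'I_d -> int) : set 'rV[R]_d :=
  [set x | forall i, 2 ^ (- k) * (m i)%:~R < x ord0 i <=
                     2 ^ (- k) * (m i + 1)%:~R].

Definition dyadic (k : int) : set (set 'rV[R]_d) := range (cube k).

(* the edge length 2^-k of Q is not recomputed from Q: in [whitney k Q] and
   [whitney_nbhd k Q], Q is meant to be in [dyadic k] *)
Definition whitney (k : int) (Q : set 'rV[R]_d) : set 'rV[R]_d.+1 :=
  [set y | Q (rV_init y) /\ 2 ^ (- k) < height y <= 2 ^ (- k + 1)].

Definition whitney_nbhd (k : int) (Q : set 'rV[R]_d) : set 'rV[R]_d.+1 :=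
  [set y | halfspace y /\ edist y (whitney k Q) < 4^-1 * 2 ^ (- k)].

(* Q' is a selected neighbor of Q, for Q of edge length 2^-(2^j); truncated
   predecessor makes the second level 2^0 = 1 when j = 0 *)
Definition selected (j : nat) (Q : set 'rV[R]_d) : set (set 'rV[R]_d) :=
  [set Q' | (dyadic (2 ^ j)%N Q' \/ dyadic (2 ^ j.-1)%N Q') /\
            closure Q `&` closure Q' !=set0].

Definition besov_norm (lambda : R) (f : 'rV[R]_d -> R) : \bar R :=
  (\int[@leb R d]_x `|f x|%:E +
   \sum_(0 <= j <oo) (((2 ^+ j + 2) `^ lambda)%R%:E *
     \esum_(Q in dyadic (2 ^ j)%N) (@leb R d Q *
       \esum_(Q' in selected j Q) `|average Q f - average Q' f|%R%:E)))%E.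

Definition besov (lambda : R) : set ('rV[R]_d -> R) :=
  [set f | L1loc setT f /\ (besov_norm lambda f < +oo)%E].

Definition trace_approx (k : nat) (f : 'rV[R]_d.+1 -> R) (x : 'rV[R]_d) : R :=
  \sum_(Q \in dyadic k) (average (whitney_nbhd k Q) f * \1_Q x).

(* the trace is only defined almost everywhere: g is any representative *)
Definition is_trace (f : 'rV[R]_d.+1 -> R) (g : 'rV[R]_d -> R) : Prop :=
  {ae @leb R d, forall x, trace_approx k f x @[k --> \oo] --> g x}.

Definition is_trace_space (X : set ('rV[R]_d -> R))
    (Y : set ('rV[R]_d.+1 -> R)) : Prop :=
  (forall f, Y f -> exists2 g, X g & is_trace f g) /\
  (forall g, X g -> exists2 f, Y f & is_trace f g).

End upper_half_space.
End function_spaces.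
Arguments besov {R} d lambda.
Arguments sobolev11 {R} d lambda.

(* Main.v *)
From HB Require Import structures.
From mathcomp Require Import all_boot all_order all_algebra.
From mathcomp Require Import all_classical all_reals all_analysis.
From mathcomp Require Import measurable_realfun.
From mathcomp Require Import ring lra zify.
Require Import Defs.

(** The two inclusions rest on one picture: the half-space is cut into horizontal
    pieces whose thickness is comparable to their height, and functions are
    compared through their averages over cubes of the size of the piece.

    _Traces of Sobolev functions are in the Besov-type space._  On a box of the
    size of a Whitney cube, [poincare_box] bounds the difference of the averages
    of [f] over two open subsets by the integral of the gradient.  The boxes of
    one scale overlap boundedly often ([refbox_count]), so that
    [\int |T_(k+1) f - T_k f| <= C S_k], where [S_k] is the integral of
    [|grad f|] over the strip of heights about [2^-k] ([int_Tk_step]).  On that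
    strip the weight is at least a constant times [(k+1)^lambda], hence
    [\sum_k (k+1)^lambda S_k] is finite ([stripint_wsum_fin]).  The functions
    [T_k f] thus converge almost everywhere and in [L^1] to a function
    [btrace f], at distance at most [C \sum_(l >= k) S_l] from [T_k f].  The
    [j]-th term of the Besov norm of [btrace f] compares its averages over cubes
    of edges [2^-(2^j)] and [2^-(2^(j-1))], so it is at most
    [C \sum_(l >= 2^(j-1)) S_l].  After exchanging the sums over [j] and [l],
    the weights [(2^j+2)^lambda] with [2^(j-1) <= l] add up to a geometric sum
    of size [(l+1)^lambda], which closes the estimate ([besov_btrace]).

    _Every function of the Besov-type space is a trace._  Put
    [h_j = 2^-(2^j)], so that [h_(j+1) = h_j^2].  For [g] given, let [E_j g] be
    the smooth interpolation of the averages of [g] over the dyadic cubes of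
    edge [h_j], and let
    [f (x, t) = \sum_j psi_j t * E_j g x], where the [psi_j] form a smooth
    partition of unity of the small heights and [psi_j] lives on the layer
    [4 h_(j+1) < t < 8 h_j] ([ext]).  On that layer [grad f] is [1 / h_j] times
    differences of averages over selected neighbours, at generations [j] and
    [j - 1], up to a constant; the layer has thickness of order [h_j], and the
    logarithmic weight is there at most a constant times [(2^j+2)^lambda].  The
    integral of [|grad f|] over the layer is therefore controlled by the terms
    [j] and [j - 1] of the Besov norm, and by the [L^1] norm of [g] when [j = 0]
    ([int_layers], [sobolev_ext]).

    _The trace of the extension is the given function._  By the first part, [f]
    has a trace.  At heights comparable to [h_j] only the [j]-th term of [f] is
    present, so [T_(2^j) f] is close in [L^1] to the conditional expectation of
    [g] on the cubes of edge [h_j] ([int_Tk_coef]).  Conditional expectations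
    keep the integrals over the larger dyadic cubes, so the trace and [g] have
    the same integral over every dyadic cube and agree almost everywhere
    ([btrace_ext_ae]).

    Two tools replace mollification.  The Poincare inequality is proved by
    testing the weak derivatives against a lattice of smooth bumps: the
    difference of two neighbouring bumps is a multiple of a partial derivative of
    a test function ([hat_bump_step]).  Integration by parts for smooth functions, which
    identifies the weak gradient of the extension, follows from the translation
    invariance of Lebesgue measure ([int_partial_eq0]). *)

Set Implicit Arguments.
Unset Strict Implicit.
Unset Printing Implicit Defensive.

Import Order.TTheory GRing.Theory Num.Theory.
Import numFieldNormedType.Exports.

Local Open Scope classical_set_scope.
Local Open Scope ring_scope.


(** * Dyadic cubes and Lebesgue measure *)

Section boxes.
Context {R : realType}.

Definition rbox n (a b : 'rV[R]_n) : set 'rV[R]_n :=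
  [set x | forall i, a ord0 i < x ord0 i <= b ord0 i].

Lemma leb_borelE n (A : set 'rV[R]_n) : measurable A ->
  @leb R n A = borel_lebesgue n A.
Proof. by move=> mA; rewrite /leb /completed_measure_extension measurable_mu_extE. Qed.

Lemma rbox_rcons n (a b : 'rV[R]_n.+1) :
  @rV_rcons R n @^-1` rbox a b =
  rbox (rV_init a) (rV_init b) `*` `]a ord0 ord_max, b ord0 ord_max]%classic.
Proof.
apply/seteqP; split => [[x t] /= H|[x t] /= [H1 H2] i].
- split => /=; last by have := H ord_max; rewrite mxE unlift_none in_itv.
  by move=> i; have := H (lift ord_max i); rewrite !mxE liftK.
- rewrite mxE; case: unliftP => [j ->|->] /=.
    by have := H1 j; rewrite !mxE.
  by move: H2; rewrite /= in_itv.
Qed.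

Lemma measurable_rbox n (a b : 'rV[R]_n) : measurable (rbox a b).
Proof.
have -> : rbox a b = \bigcap_(i in [set: 'I_n])
    ((fun x : 'rV[R]_n => x ord0 i) @^-1` `]a ord0 i, b ord0 i]%classic).
  apply/seteqP; split => [x H i _ /=|x H i]; first by rewrite in_itv /= H.
  by have := H i I; rewrite /= in_itv.
apply: fin_bigcap_measurable => // i _.
by rewrite -[X in measurable X]setTI; apply: measurable_coord.
Qed.

Lemma borel_lebesgue_rbox n (a b : 'rV[R]_n) : (forall i, a ord0 i <= b ord0 i) ->
  borel_lebesgue n (rbox a b) = (\prod_i (b ord0 i - a ord0 i))%:E.
Proof.
elim: n a b => [|n IH] a b ab /=.
  rewrite big_ord0 diracE /= mem_set// => -[]//.
rewrite /borel_lebesgue_step /pushforward rbox_rcons product_measure1E//; last first.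
  exact: measurable_rbox.
rewrite IH; last by move=> i; rewrite !mxE.
rewrite big_ord_recr /= lebesgue_measure_itv /= lte_fin.
have -> : \prod_i (rV_init b ord0 i - rV_init a ord0 i) =
          \prod_(i < n) (b ord0 (widen_ord (leqnSn n) i) - a ord0 (widen_ord (leqnSn n) i)).
  by apply: eq_bigr => i _; rewrite !mxE; have -> : lift ord_max i = widen_ord (leqnSn n) i
    by apply/val_inj => /=; exact: lift_max.
rewrite EFinM; congr (_ * _)%E; case: ltP => // ba.
by have/eqP -> : b ord0 ord_max == a ord0 ord_max; rewrite ?subrr// eq_le ba ab.
Qed.

Lemma leb_rbox n (a b : 'rV[R]_n) : (forall i, a ord0 i <= b ord0 i) ->
  @leb R n (rbox a b) = (\prod_i (b ord0 i - a ord0 i))%:E.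
Proof. by move=> ab; rewrite leb_borelE ?borel_lebesgue_rbox//; exact: measurable_rbox. Qed.

Definition side k : R := 2 ^- k.

Lemma side_gt0 k : 0 < side k. Proof. by rewrite /side invr_gt0 exprn_gt0. Qed.

(** Indexing the cubes of one level by integer vectors, rather than by sets, makes
    sums over cubes sums over a countable type on which translations act. *)
Definition dcube n k (m : 'rV[int]_n) : set 'rV[R]_n :=
  cube (Posz k) (fun i => m ord0 i).

(** The index of the cube that contains [x]: since the cubes are open on the left
    and closed on the right, it is a ceiling minus one. *)
Definition idx n k (x : 'rV[R]_n) : 'rV[int]_n :=
  \row_i (Num.ceil (2 ^+ k * x ord0 i) - 1).

Lemma dcubeE n k (m : 'rV[int]_n) : dcube k m =
  rbox (\row_i (side k * (m ord0 i)%:~R)) (\row_i (side k * (m ord0 i + 1)%:~R)).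
Proof.
have E : 2 ^ (- Posz k) = side k :> R by rewrite -invr_expz.
by rewrite /dcube /cube /rbox E; apply/seteqP; split => x H i; have := H i; rewrite !mxE.
Qed.

Lemma dcubeP n k (m : 'rV[int]_n) x : dcube k m x <-> idx k x = m.
Proof.
have s0 := side_gt0 k.
have E : side k = (2 ^+ k)^-1 by [].
have H i : (side k * (m ord0 i)%:~R < x ord0 i <= side k * (m ord0 i + 1)%:~R) =
  (Num.ceil (2 ^+ k * x ord0 i) == m ord0 i + 1).
  rewrite ceil_eq addrK E ltr_pdivrMl ?exprn_gt0// ler_pdivlMl ?exprn_gt0//.
rewrite dcubeE; split => [xm|mE i].
  apply/rowP => i; have := xm i; rewrite !mxE H => /eqP ->; exact: addrK.
by rewrite mxE [X in _ <= X]mxE H -mE mxE subrK.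
Qed.

Lemma dcube_idx n k (x : 'rV[R]_n) : dcube k (idx k x) x.
Proof. exact/dcubeP. Qed.

Lemma measurable_dcube n k (m : 'rV[int]_n) : measurable (dcube k m).
Proof. by rewrite dcubeE; exact: measurable_rbox. Qed.

Lemma dcube_dyadic n k (m : 'rV[int]_n) : dyadic (Posz k) (dcube k m).
Proof. by eexists. Qed.

Lemma dyadicP n k (Q : set 'rV[R]_n) : dyadic (Posz k) Q -> exists m, Q = dcube k m.
Proof.
move=> [m _ <-]; exists (\row_i m i); rewrite /dcube; congr cube.
by apply/funext => i; rewrite mxE.
Qed.

Lemma leb_dcube n k (m : 'rV[int]_n) : @leb R n (dcube k m) = (side k ^+ n)%:E.
Proof.
rewrite dcubeE leb_rbox => [|i]; last first.
  by rewrite !mxE ler_pM2l ?side_gt0// ler_int lerDl.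
rewrite (eq_bigr (fun=> side k)) => [|i _].
  by rewrite prodr_const card_ord.
by rewrite !mxE -mulrBr -intrB addrAC subrr add0r mulr1.
Qed.

Lemma dcube_inj n k : injective (@dcube n k).
Proof.
move=> m m' E.
pose x : 'rV[R]_n := \row_i (side k * (m ord0 i + 1)%:~R).
have xm : dcube k m x.
  rewrite dcubeE => i; rewrite !mxE lexx andbT ltr_pM2l ?side_gt0//.
  by rewrite ltr_int ltrDl.
have := xm; rewrite E => /dcubeP <-; exact/esym/dcubeP.
Qed.

Lemma dcube_nest n j k (m m' : 'rV[int]_n) x : (j <= k)%N ->
  dcube j m x -> dcube k m' x -> dcube k m' `<=` dcube j m.
Proof.
move=> jk /dcubeP <- /dcubeP <- y /dcubeP E; apply/dcubeP.
have {}E i : Num.ceil (2 ^+ k * y ord0 i) = Num.ceil (2 ^+ k * x ord0 i) :> int.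
  by move/rowP : E => /(_ i); rewrite !mxE => /addIr.
apply/rowP => i; rewrite !mxE; congr (_ - 1).
have K (z : R) : Num.ceil (2 ^+ j * z) = Num.ceil ((2 ^+ (k - j))^-1 * (Num.ceil (2 ^+ k * z))%:~R : R) :> int.
  apply/eqP; rewrite eq_le; apply/andP; split.
    apply: le_ceil; rewrite ler_pdivlMl ?exprn_gt0// mulrA -exprD subnK//.
    exact: ceil_ge.
  rewrite ceil_le_int ler_pdivrMl ?exprn_gt0//.
  have -> : (2 ^+ (k - j) : R) = ((2 ^+ (k - j))%:~R : R) by rewrite rmorphXn.
  rewrite -intrM ler_int ceil_le_int.
  rewrite intrM rmorphXn -[in leLHS](subnK jk) exprD -mulrA.
  by rewrite ler_pM2l ?exprn_gt0// ceil_ge.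
by rewrite K E -K.
Qed.

Lemma dcube_sub_open n k0 (U : set 'rV[R]_n) x : open U -> U x ->
  exists2 k, (k0 <= k)%N & dcube k (idx k x) `<=` U.
Proof.
move=> oU Ux; have /nbhs_ballP [e e0 He] : nbhs x U by exact: open_nbhs_nbhs.
have /cvgrPdist_lt /(_ e e0) [N _ HN] : (fun k => (2^-1 : R) ^+ k) @ \oo --> 0.
  by apply: cvg_expr; rewrite ger0_norm ?invr_ge0// invf_lt1// ltr1n.
exists (maxn k0 N); first exact: leq_maxl.
move=> y Qy; apply: He.
have sk : side (maxn k0 N) < e.
  have := HN (maxn k0 N) (leq_maxr _ _); rewrite /= sub0r normrN exprVn.
  by rewrite ger0_norm ?invr_ge0 ?exprn_ge0.
split => // i0 i; rewrite ord1 /ball /=.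
have := Qy; have := dcube_idx (maxn k0 N) x; rewrite dcubeE => /(_ i) + /(_ i).
rewrite !mxE !intrD !mulrDr ![_ * 1%:~R]mulr1.
set A := side _ * _; move=> /andP[h1 h2] /andP[h3 h4].
by rewrite ltr_norml; apply/andP; split; lra.
Qed.

Lemma esum_countable (I : countType) (a : I -> \bar R) : (forall i, (0 <= a i)%E) ->
  (\esum_(i in [set: I]) a i = \sum_(0 <= n <oo) oapp a 0 (pickle_inv n))%E.
Proof.
move=> a0; rewrite nneseries_esumT; last by move=> n; case: (pickle_inv n) => [i|] /=.
transitivity (\esum_(n in range (@pickle I)) oapp a 0%E (pickle_inv n)).
  rewrite esum_image; last by move=> x y _ _; exact: (pcan_inj (@pickleK I)).
  by apply: eq_esum => i _; rewrite pickleK_inv.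
rewrite esum_mkcond; apply: eq_esum => n _; case: ifPn => // /negP nr.
case E : (pickle_inv n) => [i|]//=; exfalso; apply: nr; rewrite inE; exists i => //.
by have := @pickle_invK I n; rewrite /= E.
Qed.

Lemma esum_single (I : choiceType) (a : I -> \bar R) i0 : (0 <= a i0)%E ->
  (forall i, i != i0 -> a i = 0%E) -> (\esum_(i in [set: I]) a i = a i0)%E.
Proof.
move=> a0 H; rewrite -[RHS]esum_set1// [RHS]esum_mkcond; apply: eq_esum => i _.
have [->|/[dup] ii /H ->] := eqVneq i i0; first by rewrite mem_set.
by rewrite memNset// => E; move: ii; rewrite E eqxx.
Qed.

Lemma bigcup_countType_measurable d (T : measurableType d) (I : countType)
    (P : set I) (F : I -> set T) :
  (forall i, P i -> measurable (F i)) -> measurable (\bigcup_(i in P) F i).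
Proof.
move=> mF.
have -> : \bigcup_(i in P) F i = \bigcup_n
   (if pickle_inv n is Some i then if i \in P then F i else set0 else set0).
  apply/seteqP; split => [x [i Pi Fx]|x [n _]].
    by exists (pickle i) => //; rewrite pickleK_inv mem_set.
  case: (pickle_inv n) => // i; case: ifPn => // /set_mem Pi Fx; by exists i.
apply: bigcupT_measurable => n; case: (pickle_inv n) => // i.
by case: ifPn => // /set_mem; exact: mF.
Qed.

Section countable_integral.
Local Open Scope ereal_scope.
Context d (T : measurableType d) (mu : {measure set T -> \bar R}) (I : countType).

Lemma integral_esum (D : set T) (f : I -> T -> \bar R) : measurable D ->
  (forall i, measurable_fun D (f i)) -> (forall i x, D x -> 0 <= f i x) ->
  \int[mu]_(x in D) (\esum_(i in [set: I]) f i x) =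
  \esum_(i in [set: I]) \int[mu]_(x in D) f i x.
Proof.
move=> mD mf f0.
rewrite (esum_countable (a := fun i => \int[mu]_(x in D) f i x)); last first.
  by move=> i; apply: integral_ge0 => x; exact: f0.
pose g n x := oapp (fun i => f i x) 0 (@pickle_inv I n).
rewrite (eq_integral (fun x => \sum_(0 <= n <oo) g n x)); last first.
  move=> x /set_mem Dx; rewrite esum_countable// => i; exact: f0.
rewrite integral_nneseries//.
- apply: eq_eseriesr => n _; rewrite /g; case: (pickle_inv n) => //=.
  by rewrite integral0.
- by move=> n; rewrite /g; case: (pickle_inv n) => /=.
- by move=> n x Dx; rewrite /g; case: (pickle_inv n) => //= i; exact: f0.
Qed.

Lemma measurable_esum (D : set T) (f : I -> T -> \bar R) : measurable D ->
  (forall i, measurable_fun D (f i)) -> (forall i x, D x -> 0 <= f i x) ->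
  measurable_fun D (fun x => \esum_(i in [set: I]) f i x).
Proof.
move=> mD mf f0.
pose g n x := oapp (fun i => f i x) 0 (@pickle_inv I n).
apply: (eq_measurable_fun (fun x => \sum_(0 <= n <oo) g n x)).
  move=> x /set_mem Dx; rewrite esum_countable// => i; exact: f0.
apply: ge0_emeasurable_sum => [n x Dx _|n _].
- by rewrite /g; case: (pickle_inv n) => //= i; exact: f0.
- by rewrite /g; case: (pickle_inv n) => //=.
Qed.

(** Integration along the fibres of a map to a countable type; it will split
    integrals over the cubes of one level. *)
Lemma fiber_integral (D : set T) (p : T -> I) (f : T -> \bar R) : measurable D ->
  (forall i, measurable (p @^-1` [set i])) -> measurable_fun D f ->
  (forall x, D x -> 0 <= f x) ->
  \int[mu]_(x in D) f x = \esum_(i in [set: I]) \int[mu]_(x in D `&` p @^-1` [set i]) f x.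
Proof.
move=> mD mp mf f0.
under eq_esum do rewrite integral_mkcondr epatch_indic.
rewrite -integral_esum//; last 2 first.
- move=> i; apply: emeasurable_funM => //; apply/measurable_EFinP.
  exact: measurable_funTS.
- by move=> i x Dx; rewrite mule_ge0 ?f0// lee_fin.
apply: eq_integral => x /set_mem Dx.
rewrite (esum_single (i0 := p x)).
- by rewrite /= indicE mem_set ?mule1.
- by rewrite mule_ge0 ?f0// lee_fin.
- move=> i ip; rewrite /= indicE memNset ?mule0// => E; move: ip.
  by rewrite -E eqxx.
Qed.

End countable_integral.

Lemma dyadic_cover n (U : set 'rV[R]_n) k0 : open U ->
  U = \bigcup_(km in [set km : nat * 'rV[int]_n | (k0 <= km.1)%N /\ dcube km.1 km.2 `<=` U])
        dcube km.1 km.2.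
Proof.
move=> oU; apply/seteqP; split => [x Ux|x [km [_ H]]]; last exact: H.
have [k k0k H] := dcube_sub_open k0 oU Ux.
by exists (k, idx k x) => //=; exact: dcube_idx.
Qed.

Lemma open_measurable_rV n (U : set 'rV[R]_n) : open U -> measurable U.
Proof.
move=> /(dyadic_cover 0) ->; apply: bigcup_countType_measurable => km _.
exact: measurable_dcube.
Qed.

Lemma continuous_measurable_rV n (f : 'rV[R]_n -> R) : continuous f ->
  measurable_fun [set: 'rV[R]_n] f.
Proof.
move=> cf; apply: (measurability _ (RGenOpens.measurableE R)).
move=> _ [_ [a [b ->] <-]]; rewrite setTI.
by apply: open_measurable_rV; apply: open_comp => // x _; exact: cf.
Qed.

(** The empty set is added to have a family closed under intersection. *)
Definition dyadic_sets n : set (set 'rV[R]_n) :=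
  [set Q | Q = set0 \/ exists k m, Q = dcube k m].

(** Each open set is a countable union of dyadic cubes ([dyadic_cover]), and the
    preimages of open intervals under the coordinates are open. *)
Lemma dyadic_sets_measurableE n :
  (@measurable _ 'rV[R]_n) = <<s @dyadic_sets n >>.
Proof.
apply/seteqP; split; last first.
  apply: smallest_sub; first exact: sigma_algebra_measurable.
  by move=> _ [->|[k [m ->]]]//; exact: measurable_dcube.
have mid : measurable_fun setT (id : g_sigma_algebraType (@dyadic_sets n) -> 'rV[R]_n).
  apply: measurable_fun_rV => i.
  apply: (measurability _ (RGenOpens.measurableE R)).
  move=> _ [_ [a [b ->] <-]]; rewrite setTI.
  set U := (X in measurable X).
  have oU : open (U : set 'rV[R]_n).
    by apply: open_comp => // x _; exact: coord_continuous.
  rewrite (dyadic_cover 0 oU); apply: bigcup_countType_measurable => km _.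
  by apply: sub_sigma_algebra; right; exists km.1, km.2.
by move=> A mA; have := mid measurableT A mA; rewrite setTI.
Qed.

Lemma dyadic_sets_setI n : setI_closed (@dyadic_sets n).
Proof.
move=> A B [->|[k [m ->]]]; first by rewrite set0I; left.
move=> [->|[k' [m' ->]]]; first by rewrite setI0; left.
wlog kk : k k' m m' / (k <= k')%N.
  by move=> H; case/orP: (leq_total k k') => /H //; rewrite setIC; exact.
have [->|/set0P[x [mx m'x]]] := eqVneq (dcube k m `&` dcube k' m') set0; first by left.
by right; exists k', m'; apply/setIidPr; exact: dcube_nest kk mx m'x.
Qed.

(** Two dyadic cubes are nested or disjoint, so they form a generating family stable
    under intersection, and the cubes of level 0 exhaust the space. *)
Lemma measure_dyadic_unique n (m1 m2 : {measure set 'rV[R]_n -> \bar R}) :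
  (forall k m, m1 (dcube k m) = m2 (dcube k m)) ->
  (forall k m, (m1 (dcube k m) < +oo)%E) ->
  forall A, measurable A -> m1 A = m2 A.
Proof.
move=> E fin A mA.
pose g i : set 'rV[R]_n := if pickle_inv i is Some m then dcube 0 m else set0.
apply: (@measure_unique _ _ _ (@dyadic_sets n) g) => //.
- exact: dyadic_sets_measurableE.
- exact: dyadic_sets_setI.
- move=> i; rewrite /g; case: (pickle_inv i) => [m|]; last by left.
  by right; exists 0, m.
- apply/seteqP; split => // x _; exists (pickle (idx 0 x)) => //.
  by rewrite /g pickleK_inv; exact: dcube_idx.
- by move=> _ [->|[k [m ->]]]//; rewrite !measure0.
- by move=> i; rewrite /g; case: (pickle_inv i) => [m|]; rewrite ?measure0.
Qed.

Lemma measurable_shift n (v : 'rV[R]_n) : measurable_fun setT (fun x : 'rV[R]_n => x + v).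
Proof.
apply: measurable_fun_rV => i; under eq_fun do rewrite mxE.
by apply: measurable_funD => //; exact: measurable_coord.
Qed.

(** A translate of a dyadic cube is a box with the same edges, and measures are
    determined by their values on dyadic cubes. *)
Lemma borel_lebesgue_shift n (v : 'rV[R]_n) A : measurable A ->
  borel_lebesgue n ((fun x => x + v) @^-1` A) = borel_lebesgue n A.
Proof.
move=> mA.
have H k m : borel_lebesgue n ((fun x => x + v) @^-1` dcube k m) = borel_lebesgue n (dcube k m).
  have -> : (fun x => x + v) @^-1` dcube k m = rbox
    (\row_i (side k * (m ord0 i)%:~R) - v) (\row_i (side k * (m ord0 i + 1)%:~R) - v).
    rewrite dcubeE; apply/seteqP; split => x /= Hx i; have := Hx i; rewrite !mxE.
      by rewrite ltrBlDr lerBrDr.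
    by rewrite ltrBlDr lerBrDr.
  have le i : side k * (m ord0 i)%:~R <= side k * (m ord0 i + 1)%:~R.
    by rewrite ler_pM2l ?side_gt0// ler_int lerDl.
  rewrite dcubeE !borel_lebesgue_rbox => [||i]; last 2 first.
  - by move=> i; rewrite !mxE.
  - by rewrite !mxE lerD2r.
  by congr EFin; apply: eq_bigr => i _; rewrite !mxE; ring.
pose phi := fun x : 'rV[R]_n => x + v.
pose m0 : {measure set 'rV[R]_n -> \bar R} := pushforward (borel_lebesgue n) phi.
pose m1 := m0 (measurable_shift v).
apply: (@measure_dyadic_unique n m1 (borel_lebesgue n)) => // k m.
by rewrite /m1 /= /pushforward H -leb_borelE ?leb_dcube ?ltry//; exact: measurable_dcube.
Qed.

Lemma measurable_id_leb n : measurable_fun setT (id : lebesgueType R n -> 'rV[R]_n).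
Proof. by move=> _ A mA; rewrite setTI; exact: borel_measurable_lebesgue. Qed.

Lemma measurable_leb n d (T : measurableType d) (f : 'rV[R]_n -> T) :
  measurable_fun setT f -> measurable_fun setT (f : lebesgueType R n -> T).
Proof. by move=> mf; exact: (measurableT_comp mf (measurable_id_leb (n:=n))). Qed.

Lemma leb_pushforward n (phi : 'rV[R]_n -> 'rV[R]_n) A :
  (forall A, measurable A -> borel_lebesgue n (phi @^-1` A) = borel_lebesgue n A) ->
  measurable_fun setT phi -> measurable A ->
  pushforward (@leb R n) (phi : lebesgueType R n -> 'rV[R]_n) A = borel_lebesgue n A.
Proof.
move=> H mphi mA; rewrite /pushforward.
rewrite -H// leb_borelE//.
by rewrite -[X in measurable X]setTI; exact: mphi.
Qed.

(** Both sides equal the integral for [borel_lebesgue], which is the image of [leb]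
    under [phi] and under the identity. *)
Lemma leb_integral_pres n (phi : 'rV[R]_n -> 'rV[R]_n) (f : 'rV[R]_n -> \bar R) :
  (forall A, measurable A -> borel_lebesgue n (phi @^-1` A) = borel_lebesgue n A) ->
  measurable_fun setT phi -> measurable_fun setT f ->
  (\int[@leb R n]_x f (phi x) = \int[@leb R n]_x f x)%E.
Proof.
move=> H mphi mf.
have K psi : (forall A, measurable A -> borel_lebesgue n (psi @^-1` A) = borel_lebesgue n A) ->
  measurable_fun setT psi -> 
  (\int[@leb R n]_x (f (psi x)) = \int[borel_lebesgue n]_x f x)%E.
  move=> Hp mp.
  have mp' : measurable_fun setT (psi : lebesgueType R n -> 'rV[R]_n) by exact: measurable_leb.
  have P (g : 'rV[R]_n -> \bar R) : measurable_fun setT g -> (forall x, 0 <= g x)%E ->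
      (\int[borel_lebesgue n]_x g x = \int[@leb R n]_x g (psi x))%E.
    move=> mg g0; have := ge0_integral_pushforward mp' (@leb R n) measurableT mg.
    rewrite preimage_setT => <-; last by move=> y _.
    by apply: eq_measure_integral => A mA _; exact/esym/leb_pushforward.
  rewrite integralE [RHS]integralE; congr (_ - _)%E.
    have -> := P f^\+%E (measurable_funepos mf) (fun x => funepos_ge0 f x).
    by apply: eq_integral => x _; rewrite !funeposE.
  have -> := P f^\-%E (measurable_funeneg mf) (fun x => funeneg_ge0 f x).
  by apply: eq_integral => x _; rewrite !funenegE.
by rewrite K// -(K id).
Qed.

Lemma leb_integral_shift n (v : 'rV[R]_n) (f : 'rV[R]_n -> \bar R) :
  measurable_fun setT f ->
  (\int[@leb R n]_x f (x + v)%R = \int[@leb R n]_x f x)%E.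
Proof.
by move=> mf; apply: leb_integral_pres => //; [exact: borel_lebesgue_shift|exact: measurable_shift].
Qed.

Section density.
Local Open Scope ereal_scope.
Import HBNNSimple.
Context d (T : measurableType d) (mu nu : {measure set T -> \bar R}).
Variables (H : set T) (w : T -> R).
Hypotheses (mH : measurable H) (mw : measurable_fun H w) (w0 : forall x, (0 <= w x)%R).
Hypothesis nuE : forall A, measurable A -> nu A = \int[mu]_(x in A `&` H) (w x)%:E.

Let density_nnsfun (f : {nnsfun T >-> R}) :
  \int[nu]_(x in H) (f x)%:E = \int[mu]_(x in H) ((f x)%:E * (w x)%:E).
Proof.
have mfr r : measurable (f @^-1` [set r]) by exact: measurable_funPTI.
transitivity (\sum_(r \in range f) r%:E * nu (f @^-1` [set r] `&` H)).
  under eq_integral do rewrite fimfunE -fsumEFin//.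
  rewrite ge0_integral_fsum//; last 2 first.
  - by move=> r; exact/measurable_EFinP/measurable_funM.
  - by move=> r x _; rewrite nnfun_muleindic_ge0.
  apply: eq_fsbigr => r _; rewrite integralZl_indic_nnsfun// integral_indic//.
transitivity (\int[mu]_(x in H) (\sum_(r \in range f) (r * \1_(f @^-1` [set r]) x)%:E * (w x)%:E)).
  rewrite ge0_integral_fsum//; last 2 first.
  - move=> r; apply: emeasurable_funM; last exact/measurable_EFinP.
    exact/measurable_EFinP/measurable_funM.
  - by move=> r x _; rewrite mule_ge0 ?lee_fin// -lee_fin EFinM nnfun_muleindic_ge0.
  apply: eq_fsbigr => r rf.
  have r0 : (0 <= r)%R by move: rf => /set_mem[x _ <-].
  rewrite nuE; last exact: measurableI.
  rewrite -setIA setIid setIC integral_mkcondr epatch_indic -ge0_integralZl//.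
  - by apply: eq_integral => x _; rewrite EFinM muleAC -muleA.
  - by apply: emeasurable_funM; apply/measurable_EFinP => //; exact: measurable_funTS.
  - by move=> x _; rewrite mule_ge0//= lee_fin.
apply: eq_integral => x _; rewrite fimfunE -fsumEFin// ge0_mule_fsuml//.
by move=> r; rewrite nnfun_muleindic_ge0.
Qed.

(** The formula [nuE] is the case of indicator functions; simple functions follow
    by linearity and all nonnegative functions by monotone convergence. *)
Lemma density_integral (f : T -> \bar R) : measurable_fun H f ->
  (forall x, H x -> 0 <= f x) ->
  \int[nu]_(x in H) f x = \int[mu]_(x in H) (f x * (w x)%:E).
Proof.
move=> mf f0; pose g := nnsfun_approx mH mf.
have gf x : H x -> (EFin \o g ^~ x) @ \oo --> f x by move=> Hx; exact: cvg_nnsfun_approx.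
have nd x : H x -> {homo (fun n => (g n x)%:E) : n m / (n <= m)%N >-> n <= m}.
  by move=> Hx n m nm; rewrite lee_fin; exact/lefP/nd_nnsfun_approx.
transitivity (limn (fun n => \int[nu]_(x in H) (g n x)%:E)).
  rewrite -monotone_convergence//.
  - by apply: eq_integral => x /set_mem Hx; apply/esym/cvg_lim => //; exact: gf.
  - by move=> n; exact/measurable_EFinP/measurable_funTS.
  - by move=> n x _; rewrite lee_fin.
transitivity (limn (fun n => \int[mu]_(x in H) ((g n x)%:E * (w x)%:E))).
  by congr (limn _); apply/funext => n; exact: density_nnsfun.
rewrite -monotone_convergence//.
- apply: eq_integral => x /set_mem Hx; apply/cvg_lim => //.
  by apply: cvgeZr => //; exact: gf.
- move=> n; apply: emeasurable_funM; last exact/measurable_EFinP.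
  exact/measurable_EFinP/measurable_funTS.
- by move=> n x _; rewrite mule_ge0// lee_fin.
- by move=> x Hx n m nm; rewrite lee_wpmul2r ?lee_fin//; exact: nd.
Qed.

End density.

End boxes.

(** * A smooth step on the line *)

Section smooth_1d.
Context {R : realType}.
Implicit Types f g : R -> R.

(** Existence of [n.+1] derivatives.  Carrying the derivative [f'] in the definition
    lets closure properties be proved by a plain induction on [n]. *)
Fixpoint nderivable (n : nat) f : Prop :=
  if n is n'.+1 then exists f', (forall x, is_derive (x : R) (1 : R) f (f' x)) /\ nderivable n' f'
  else forall x : R, derivable f (x : R) (1 : R).

Definition smooth1 f := forall n, nderivable n f.

Lemma derive1_eq f f' : (forall x, is_derive (x : R) (1 : R) f (f' x)) -> derive1 f = f'.
Proof. by move=> H; apply/funext => x; rewrite derive1E; have [_ ->] := H x. Qed.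

Lemma smooth1_derivable f x : smooth1 f -> derivable f (x : R) (1 : R).
Proof. by move=> /(_ 0%N). Qed.

Lemma smooth1_is_derive f x : smooth1 f -> is_derive (x : R) (1 : R) f (derive1 f x).
Proof. by move=> sf; rewrite derive1E; apply: DeriveDef => //; exact: smooth1_derivable. Qed.

Lemma smooth1_derive1 f : smooth1 f -> smooth1 (derive1 f).
Proof. by move=> sf n; have [f' [H nf']] := sf n.+1; rewrite (derive1_eq H). Qed.

Lemma smooth1_primitive f f' : (forall x, is_derive (x : R) (1 : R) f (f' x)) -> smooth1 f' -> smooth1 f.
Proof.
move=> H sf' [|n]; first by move=> x; have [] := H x.
by exists f'; split.
Qed.

Lemma smooth1_continuous f : smooth1 f -> continuous f.
Proof.
by move=> sf x; apply/differentiable_continuous/derivable1_diffP/smooth1_derivable.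
Qed.

Lemma nderivable_cst n (c : R) : nderivable n (cst c).
Proof.
elim: n c => [|n IH] c; first by move=> x; exact: derivable_cst.
by exists (cst 0); split => // x; exact: is_derive_cst.
Qed.

Lemma nderivable_weak n f : nderivable n.+1 f -> nderivable n f.
Proof.
elim: n f => [|n IH] f [f' [H nf']]; first by move=> x; have [] := H x.
by exists f'; split => //; exact: IH.
Qed.

Lemma nderivableD n f g : nderivable n f -> nderivable n g -> nderivable n (f \+ g).
Proof.
elim: n f g => [|n IH] f g.
  by move=> nf ng x; apply: derivableD; [exact: nf|exact: ng].
move=> [f' [Hf nf]] [g' [Hg ng]]; exists (f' \+ g'); split; last exact: IH.
by move=> x; apply: is_deriveD.
Qed.

Lemma nderivableM n f g : nderivable n f -> nderivable n g -> nderivable n (f \* g).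
Proof.
elim: n f g => [|n IH] f g.
  by move=> nf ng x; apply: derivableM; [exact: nf|exact: ng].
move=> nf0 ng0; have [f' [Hf nf]] := nf0; have [g' [Hg ng]] := ng0.
exists ((f \* g') \+ (g \* f')); split.
  by move=> x; apply: is_deriveM.
by apply: nderivableD; apply: IH => //; exact: nderivable_weak.
Qed.

Lemma is_derive_aff (a b x : R) : is_derive (x : R) (1 : R) (fun x : R => a * x + b) a.
Proof.
rewrite -[X in is_derive _ _ _ X]mulr1 -[X in is_derive _ _ _ X]addr0.
exact: (is_deriveD (is_deriveZ a (is_derive_id x (1 : R))) (is_derive_cst b x (1 : R))).
Qed.

Lemma nderivable_aff n f (a b : R) : nderivable n f -> nderivable n (fun x => f (a * x + b)).
Proof.
have aff x := is_derive_aff a b x.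
elim: n f => [|n IH] f.
  move=> nf x; have [+ _] := @is_derive1_comp R f (fun x => a * x + b) x _ a (derivableP (nf _)) (aff x).
  exact.
move=> [f' [H nf]]; exists ((fun x => f' (a * x + b)) \* cst a); split.
  by move=> x; apply: (@is_derive1_comp R f (fun x => a * x + b)).
by apply: nderivableM; [exact: IH|exact: nderivable_cst].
Qed.

Lemma smooth1_cst (c : R) : smooth1 (cst c). Proof. by move=> n; exact: nderivable_cst. Qed.
Lemma smooth1D f g : smooth1 f -> smooth1 g -> smooth1 (f \+ g).
Proof. by move=> sf sg n; exact: nderivableD. Qed.
Lemma smooth1M f g : smooth1 f -> smooth1 g -> smooth1 (f \* g).
Proof. by move=> sf sg n; exact: nderivableM. Qed.
Lemma smooth1_aff f (a b : R) : smooth1 f -> smooth1 (fun x => f (a * x + b)).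
Proof. by move=> sf n; exact: nderivable_aff. Qed.
Lemma smooth1Z f (a : R) : smooth1 f -> smooth1 (fun x => a * f x).
Proof. by move=> sf; exact: smooth1M (smooth1_cst a) sf. Qed.
Lemma smooth1B f g : smooth1 f -> smooth1 g -> smooth1 (fun x => f x - g x).
Proof.
move=> sf sg; have -> : (fun x => f x - g x) = f \+ (fun x => (-1) * g x).
  by apply/funext => x /=; rewrite mulN1r.
by apply: smooth1D => //; exact: smooth1Z.
Qed.

Lemma derive1_aff f (a b : R) x : smooth1 f ->
  derive1 (fun x => f (a * x + b)) x = a * derive1 f (a * x + b).
Proof.
move=> sf; have aff y := is_derive_aff a b y.
rewrite derive1E.
have [_ ->] := @is_derive1_comp R f (fun x => a * x + b) x _ a (smooth1_is_derive _ sf) (aff x).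
by rewrite mulrC.
Qed.

Lemma derive1_cst_near f (a b : R) : (forall y, y < b -> f y = a) -> forall x, x < b -> derive1 f x = 0.
Proof.
move=> H x xb; rewrite derive1E.
have [_ ->] : is_derive (x : R) (1 : R) f 0 => //.
apply: (@near_eq_is_derive _ _ _ (cst a)).
  near=> y; apply/esym/H; near: y; exact: lt_nbhsl.
Unshelve. all: by end_near. Qed.

(** The functions [exp (- 1 / x) / x ^ N]: dividing by all powers of [x] gives a
    family whose derivatives are combinations of its members. *)
Definition flat (N : nat) (x : R) : R := if 0 < x then x ^- N * expR (- x^-1) else 0.

Lemma flat_ge0 N x : 0 <= flat N x.
Proof.
rewrite /flat; case: ltP => // x0.
by rewrite mulr_ge0 ?expR_ge0// invr_ge0 exprn_ge0// ltW.
Qed.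

(** From [exp (1 / x) >= x ^- (N + 2) / (N + 2)!]; it gives the derivative of [flat N]
    at the origin. *)
Lemma flat_le N x : 0 < x -> x <= 1 -> flat N x <= (N.+2)`!%:R * x ^+ 2.
Proof.
move=> x0 x1; rewrite /flat x0 expRN.
have H := @expR_ge1Dxn R x^-1 N.+1; rewrite invr_ge0 (ltW x0) in H.
have {}H : (x ^- N.+2) / (N.+2)`!%:R <= expR x^-1.
  by apply: le_trans (H isT); rewrite -exprVn lerDr.
have f0 : 0 < (N.+2)`!%:R :> R by rewrite ltr0n fact_gt0.
have xN : 0 < x ^- N.+2 by rewrite invr_gt0 exprn_gt0.
have : (expR x^-1)^-1 <= (x ^- N.+2 / (N.+2)`!%:R)^-1.
  by rewrite lef_pV2// posrE ?expR_gt0// divr_gt0.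
have xN0 : 0 <= x ^- N by rewrite invr_ge0 exprn_ge0// ltW.
move=> /(ler_wpM2l xN0)/le_trans; apply.
rewrite invf_div invrK mulrCA ler_pM2l// -addn2 exprD mulrA mulVf ?mul1r//.
by rewrite expf_neq0// gt_eqF.
Qed.

Lemma flat_derive N x : is_derive (x : R) (1 : R) (flat N) (flat N.+2 x - N%:R * flat N.+1 x).
Proof.
have [x0|x0|->] := ltgtP x 0.
- have -> : flat N.+2 x - N%:R * flat N.+1 x = 0.
    by rewrite /flat !ltNge (ltW x0)/= mulr0 subr0.
  apply: (@near_eq_is_derive _ _ _ (cst 0)).
  near=> y; rewrite /flat ltNge ltW//; near: y; exact: lt_nbhsl.
- apply: (@near_eq_is_derive _ _ _ (fun y : R => y ^- N * expR (- y^-1))).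
    near=> y; rewrite /flat; suff -> : 0 < y by [].
    near: y; exact: lt_nbhsr.
  rewrite /flat x0.
  have xn0 : x != 0 by rewrite gt_eqF.
  have dV : is_derive (x : R) (1 : R) (fun y : R => y^-1) (- x ^- 2).
    have := @is_deriveV R id x 1 1 xn0 (is_derive_id x (1 : R)).
    by rewrite -[_ *: 1]/(_ * 1) mulr1; apply.
  have dE : is_derive (x : R) (1 : R) (fun y : R => expR (- y^-1)) (expR (- x^-1) * x ^- 2).
    apply: (@is_derive1_comp R expR (fun y => - y^-1)).
    by rewrite -[X in is_derive _ _ _ X]opprK; apply: is_deriveN.
  have dP : is_derive (x : R) (1 : R) (fun y : R => y ^- N) (- N%:R * x ^- N.+1).
    have := @is_deriveX R _ (fun y : R => y^-1) N x 1 _ dV.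
    have -> : (fun y : R => y^-1) ^+ N = (fun y => y ^- N).
      by apply/funext => y; rewrite exprfctE exprVn.
    move=> H; apply: is_derive_eq; rewrite -[_ *: _]/(_ * _).
    case: (N) => [|N']; first by rewrite !mul0r oppr0 mul0r.
    by rewrite /= mulrN -mulrA exprVn mulNr; congr (- (_ * _)); rewrite -invfM -exprD addn2.
  have H := is_deriveM dP dE; apply: (is_derive_eq H).
  rewrite -![_ *: _]/(_ * _).
  have -> : x ^- N * (expR (- x^-1) * x ^- 2) = x ^- N.+2 * expR (- x^-1).
    by rewrite mulrCA mulrC; congr (_ * _); rewrite -invfM -exprD addn2.
  by rewrite mulNr mulrN; congr (_ - _); rewrite mulrC mulrA.
(* at the origin the difference quotient is O(h) by flat_le *)
- have -> : flat N.+2 0 - N%:R * flat N.+1 0 = 0 by rewrite /flat ltxx mulr0 subr0.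
  have H : h^-1 *: ((flat N \o shift 0) (h *: (1 : R)) - flat N 0) @[h --> (0 : R)^'] --> (0 : R).
    have C0 : 0 < (N.+2)`!%:R :> R by rewrite ltr0n fact_gt0.
    apply/cvgrPdist_le => e e0; near=> h.
    have h1 : `|h| <= 1 by near: h; exact: dnbhs0_le.
    have h2 : `|h| <= e / (N.+2)`!%:R by near: h; apply: dnbhs0_le; rewrite divr_gt0.
    rewrite /= addr0 -[h *: 1]/(h * 1) mulr1 {2}/flat ltxx subr0 sub0r normrN.
    rewrite -[_ *: _]/(_ * _) normrM (ger0_norm (flat_ge0 _ _)).
    have [hn|hp] := leP h 0; first by rewrite /flat ltNge hn/= mulr0 ltW.
    rewrite !gtr0_norm ?invr_gt0// in h1 h2 *.
    rewrite ler_pdivrMl//; apply: (le_trans (flat_le N hp h1)).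
    by rewrite expr2 mulrCA ler_pM2l// mulrC -ler_pdivlMr.
  by apply: DeriveDef; [apply/cvg_ex; exists 0|exact/cvg_lim].
Unshelve. all: by end_near. Qed.

Lemma nderivable_flat n N : nderivable n (flat N).
Proof.
elim: n N => [|n IH] N; first by move=> x; have [] := flat_derive N x.
exists (fun x => flat N.+2 x - N%:R * flat N.+1 x); split; first exact: flat_derive.
have -> : (fun x => flat N.+2 x - N%:R * flat N.+1 x) = flat N.+2 \+ (cst (- N%:R) \* flat N.+1).
  by apply/funext => x /=; rewrite mulNr.
by apply: nderivableD => //; apply: nderivableM => //; exact: nderivable_cst.
Qed.

Definition bump0 (x : R) : R := flat 0 x * flat 0 (1 - x).

Lemma smooth1_bump0 : smooth1 bump0.
Proof.
apply: smooth1M; first by move=> n; exact: nderivable_flat.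
have -> : (fun x : R => flat 0 (1 - x)) = (fun x => flat 0 (-1 * x + 1)).
  by apply/funext => x; rewrite mulN1r addrC.
by apply: smooth1_aff => n; exact: nderivable_flat.
Qed.

Lemma bump0_ge0 x : 0 <= bump0 x.
Proof. by rewrite mulr_ge0// flat_ge0. Qed.

Lemma bump0_gt0 x : 0 < x < 1 -> 0 < bump0 x.
Proof.
move=> /andP[x0 x1]; rewrite /bump0 /flat x0 subr_gt0 x1 !invr1 !mul1r.
by rewrite mulr_gt0 ?expR_gt0.
Qed.

Lemma bump0_out x : (x <= 0) || (1 <= x) -> bump0 x = 0.
Proof.
rewrite /bump0 /flat => /orP[x0|x1]; first by rewrite ltNge x0/= mul0r.
by rewrite subr_gt0 [x < 1]ltNge x1/= mulr0.
Qed.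

Lemma primitive_left (u : R -> R) : continuous u -> (forall x, x <= 0 -> u x = 0) ->
  exists U : R -> R, (forall x, is_derive (x : R) (1 : R) U (u x)) /\ (forall x, x <= 0 -> U x = 0).
Proof.
move=> cu u0.
pose U x := \int[@lebesgue_measure R]_(t in `[-1, x]) (u t).
have U0 x : x <= 0 -> U x = 0.
  move=> x0; rewrite /U /Rintegral (eq_integral (cst 0%E)) ?integral0// => t.
  by rewrite inE/= in_itv/= => /andP[_ tx]; rewrite u0//; exact: le_trans x0.
exists U; split => // x.
have [x0|x0] := ltP x 0.
  rewrite u0 ?ltW//.
  apply: (@near_eq_is_derive _ _ _ (cst 0)).
  near=> y; rewrite /= U0// ltW//; near: y; exact: lt_nbhsl.
have := @continuous_FTC1_closed R u (-1) x (x + 1) _ _ _ (cu x).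
rewrite -/U; case.
- by rewrite ltrDl.
- apply: continuous_compact_integrable; first exact: segment_compact.
  exact: continuous_subspaceT.
- by lra.
- by move=> dU <-; rewrite derive1E; exact: DeriveDef.
Unshelve. all: by end_near. Qed.

Lemma is_derive_nondecr (f f' : R -> R) : (forall x, is_derive (x : R) (1 : R) f (f' x)) ->
  (forall x, 0 <= f' x) -> {homo f : x y / x <= y}.
Proof.
move=> H f0 x y xy; rewrite -subr_ge0.
have [|c _ ->] := @MVT_segment R f f' x y xy (fun z _ => H z).
  apply: continuous_subspaceT => z; apply/differentiable_continuous/derivable1_diffP.
  by have [] := H z.
by rewrite mulr_ge0// subr_ge0.
Qed.

Lemma is_derive_cst_on (f f' : R -> R) (a : R) : (forall x, is_derive (x : R) (1 : R) f (f' x)) ->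
  (forall x, a <= x -> f' x = 0) -> forall x, a <= x -> f x = f a.
Proof.
move=> H f0 x ax; apply/eqP; rewrite -subr_eq0; apply/eqP.
have [|c + ->] := @MVT_segment R f f' a x ax (fun z _ => H z).
  apply: continuous_subspaceT => z; apply/differentiable_continuous/derivable1_diffP.
  by have [] := H z.
by rewrite in_itv/= => /andP[ac _]; rewrite f0 ?mul0r.
Qed.

(** The normalised primitive of a smooth nonnegative function with support [0, 1]. *)
Lemma smooth_step_ex : exists Th : R -> R, [/\ smooth1 Th, forall x, x <= 0 -> Th x = 0,
  forall x, 1 <= x -> Th x = 1 & forall x, 0 <= Th x <= 1].
Proof.
have [U [HU U0]] := primitive_left (smooth1_continuous smooth1_bump0)
  (fun x x0 => bump0_out (introT orP (or_introl x0))).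
have mono := is_derive_nondecr HU bump0_ge0.
have U1 x : 1 <= x -> U x = U 1.
  by move=> x1; apply: (is_derive_cst_on HU) => // y y1; rewrite bump0_out// y1 orbT.
have Upos : 0 < U 1.
  have [|c + E] := @MVT R U bump0 0 1 ltr01 (fun z _ => HU z).
    apply: continuous_subspaceT => z; apply/differentiable_continuous/derivable1_diffP.
    by have [] := HU z.
  move: E; rewrite (U0 0 (lexx 0)) !subr0 mulr1 => ->; rewrite in_itv/=; exact: bump0_gt0.
exists (fun x => (U 1)^-1 * U x); split.
- by apply: smooth1Z; exact: smooth1_primitive HU smooth1_bump0.
- by move=> x /U0 ->; rewrite mulr0.
- by move=> x /U1 ->; rewrite mulVf// gt_eqF.
- move=> x; rewrite mulrC ler_pdivlMr// mul0r ler_pdivrMr// mul1r.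
  have [x0|x0] := leP x 0; first by rewrite U0// lexx ltW.
  apply/andP; split; first by rewrite -(U0 0 (lexx 0)); apply: mono; exact: ltW.
  by have [x1|x1] := leP x 1; [exact: mono|rewrite (U1 x (ltW x1))].
Qed.

Lemma smooth_primitive_left (u : R -> R) : smooth1 u -> (forall x, x <= 0 -> u x = 0) ->
  exists U : R -> R, [/\ smooth1 U, derive1 U = u & forall x, x <= 0 -> U x = 0].
Proof.
move=> su u0; have [U [HU U0]] := primitive_left (smooth1_continuous su) u0.
by exists U; split => //; [exact: smooth1_primitive HU su|exact: derive1_eq].
Qed.

End smooth_1d.

(** * Tensor products and bump profiles *)

Section tensor.
Context {R : realType}.

Definition tens n (u : 'I_n -> R -> R) (y : 'rV[R]_n) : R := \prod_i u i (y ord0 i).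

Definition upd n (u : 'I_n -> R -> R) (i : 'I_n) (v : R -> R) : 'I_n -> R -> R :=
  fun j => if j == i then v else u j.

Lemma tens_upd n (u : 'I_n -> R -> R) i v y :
  tens (upd u i v) y = v (y ord0 i) * \prod_(j | j != i) u j (y ord0 j).
Proof.
rewrite /tens (bigD1 i)//= /upd eqxx; congr (_ * _).
by apply: eq_bigr => j /negbTE ->.
Qed.

Lemma tensD1 n (u : 'I_n -> R -> R) i y :
  tens u y = u i (y ord0 i) * \prod_(j | j != i) u j (y ord0 j).
Proof. by rewrite /tens (bigD1 i). Qed.

(** Along the [i]-th axis all factors but the [i]-th are constant. *)
Lemma tens_derive n (u : 'I_n -> R -> R) i (y : 'rV[R]_n) : smooth1 (u i) ->
  partial i (tens u) y = tens (upd u i (derive1 (u i))) y.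
Proof.
move=> su; rewrite tens_upd /partial.
set P := \prod_(j | _) _.
have [_ <-] : is_derive (y ord0 i) (1 : R) (fun t : R => u i t * P) (derive1 (u i) (y ord0 i) * P).
  have := is_deriveM (smooth1_is_derive (y ord0 i) su) (is_derive_cst P (y ord0 i) (1:R)).
  move=> H; apply: (is_derive_eq H).
  by rewrite scaler0 add0r -[LHS]/(_ * _) mulrC.
rewrite /derive.
suff -> : (fun h : R => h^-1 *: ((tens u \o shift y) (h *: delta_mx ord0 i) - tens u y)) =
  (fun h : R => h^-1 *: (((fun t : R => u i t * P) \o shift (y ord0 i)) (h *: (1 : R)) -
     u i (y ord0 i) * P)) by [].
apply/funext => h /=; congr (_ *: (_ - _)); last by rewrite (tensD1 u i).
rewrite (tensD1 u i) !mxE !eqxx/=; congr (u i (_ + _) * _).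
apply: eq_bigr => j ji; congr (u j _).
by rewrite !mxE (negbTE ji) andbF mulr0 add0r.
Qed.

Lemma tens_differentiable n (u : 'I_n -> R -> R) (y : 'rV[R]_n) :
  (forall i, smooth1 (u i)) -> differentiable (tens u) y.
Proof.
move=> su; rewrite /tens.
elim: (index_enum _) => [|j r IH].
  under eq_fun do rewrite big_nil; exact: differentiable_cst.
under eq_fun do rewrite big_cons.
apply: differentiableM => //.
apply: (@differentiable_comp _ _ _ _ (fun y : 'rV[R]_n => y ord0 j) (u j)).
  exact: differentiable_coord.
exact/derivable1_diffP/smooth1_derivable.
Qed.

(** Partial derivatives of tensor products are tensor products, so it suffices that
    all tensor products of smooth functions are differentiable. *)
Lemma tens_smooth n (u : 'I_n -> R -> R) : (forall i, smooth1 (u i)) -> smooth (tens u).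
Proof.
move=> su s.
suff [v [sv E]] : exists v, (forall i, smooth1 (v i)) /\ foldr (@partial R n) (tens u) s = tens v.
  by move=> x; rewrite E; exact: tens_differentiable.
elim: s => [|i s [v [sv E]]]; first by exists u.
exists (upd v i (derive1 (v i))); split.
  by move=> j; rewrite /upd; case: eqP => // _; exact: smooth1_derive1.
by rewrite /= E; apply/funext => y; rewrite tens_derive.
Qed.

Lemma tens_neq0 n (u : 'I_n -> R -> R) y : tens u y != 0 -> forall i, u i (y ord0 i) != 0.
Proof. by move=> + i; rewrite (tensD1 u i); apply: contra => /eqP ->; rewrite mul0r. Qed.

Definition cbox n (a b : 'rV[R]_n) : set 'rV[R]_n :=
  [set y | forall i, a ord0 i <= y ord0 i <= b ord0 i].

Lemma compact_cbox n (a b : 'rV[R]_n) : compact (cbox a b).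
Proof.
have := @rV_compact R n (fun i => `[a ord0 i, b ord0 i]%classic).
move=> /(_ (fun i => @segment_compact R _ _)); congr compact.
Qed.

Lemma tens_test n (u : 'I_n -> R -> R) (a b : 'rV[R]_n) (U : set 'rV[R]_n) :
  (forall i, smooth1 (u i)) ->
  (forall i t, ~~ (a ord0 i <= t <= b ord0 i) -> u i t = 0) ->
  cbox a b `<=` U -> test_function U (tens u).
Proof.
move=> su u0 sub; split; first exact: tens_smooth.
exists (cbox a b); split => //; first exact: compact_cbox.
move=> y nK; apply: contra_notP nK => /eqP /tens_neq0 H i.
by have := H i; apply: contraTT => /u0 ->; rewrite eqxx.
Qed.

Lemma measurable_tens n (u : 'I_n -> R -> R) : (forall i, smooth1 (u i)) ->
  measurable_fun setT (tens u : lebesgueType R n -> R).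
Proof.
move=> su; apply: measurable_leb; apply: continuous_measurable_rV => y.
exact/differentiable_continuous/tens_differentiable.
Qed.

Lemma smooth_continuous n (f : 'rV[R]_n -> R) : smooth f -> continuous f.
Proof. by move=> sf y; apply/differentiable_continuous; exact: (sf [::]). Qed.

Lemma smooth_partial_continuous n (f : 'rV[R]_n -> R) i : smooth f -> continuous (partial i f).
Proof. by move=> sf y; apply/differentiable_continuous; exact: (sf [:: i]). Qed.

Lemma smooth_is_derive n (f : 'rV[R]_n -> R) i y : smooth f ->
  is_derive y (delta_mx ord0 i) f (partial i f y).
Proof. by move=> sf; apply/derivableP/diff_derivable; exact: (sf [::]). Qed.

Definition step : R -> R := projT1 (cid (@smooth_step_ex R)).
Lemma step_smooth : smooth1 step.
Proof. by rewrite /step; case: cid => /= f []. Qed.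
Lemma step_le0 x : x <= 0 -> step x = 0.
Proof. by rewrite /step; case: cid => /= f [_ + _ _]; apply. Qed.
Lemma step_ge1 x : 1 <= x -> step x = 1.
Proof. by rewrite /step; case: cid => /= f [_ _ + _]; apply. Qed.
Lemma step_itv x : 0 <= step x <= 1.
Proof. by rewrite /step; case: cid => /= f [_ _ _ +]; apply. Qed.

Definition prim : R -> R := projT1 (cid (smooth_primitive_left step_smooth step_le0)).
Lemma prim_smooth : smooth1 prim.
Proof. by rewrite /prim; case: cid => /= f []. Qed.
Lemma prim_derive : derive1 prim = step.
Proof. by rewrite /prim; case: cid => /= f []. Qed.
Lemma prim_le0 x : x <= 0 -> prim x = 0.
Proof. by rewrite /prim; case: cid => /= f [_ _ +]; apply. Qed.
Lemma prim_is_derive x : is_derive (x : R) (1 : R) prim (step x).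
Proof. by rewrite -prim_derive; apply: smooth1_is_derive; exact: prim_smooth. Qed.

(** Integer translates of [hat], and of [edge], telescope, so they sum to at most 1.
    Moreover the derivative of [edge] is a difference of two translates of [hat], and
    [edge] has compact support although it is a second difference of primitives. *)
Definition hat (x : R) := step x - step (x - 1).
Definition dprim (x : R) := prim x - prim (x - 1).
Definition edge (x : R) := dprim x - dprim (x - 1).

Lemma shift_smooth (f : R -> R) (b : R) : smooth1 f -> smooth1 (fun x => f (x - b)).
Proof.
move=> /(smooth1_aff 1 (- b)); congr smooth1; apply/funext => x; by rewrite mul1r.
Qed.

Lemma hat_smooth : smooth1 hat.
Proof. by apply: smooth1B; [exact: step_smooth|exact/shift_smooth/step_smooth]. Qed.

Lemma dprim_smooth : smooth1 dprim.
Proof. by apply: smooth1B; [exact: prim_smooth|exact/shift_smooth/prim_smooth]. Qed.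

Lemma edge_smooth : smooth1 edge.
Proof. by apply: smooth1B; [exact: dprim_smooth|exact/shift_smooth/dprim_smooth]. Qed.

Lemma is_derive_shiftB (f f' : R -> R) (b x : R) :
  (forall x, is_derive (x : R) (1 : R) f (f' x)) ->
  is_derive (x : R) (1 : R) (fun x => f (x - b)) (f' (x - b)).
Proof.
move=> H.
have := @is_derive1_comp R f (fun x => 1 * x + - b) x _ _ (H _) (is_derive_aff 1 (- b) x).
rewrite mulr1 mul1r; congr is_derive; apply/funext => y /=; by rewrite mul1r.
Qed.

Lemma dprim_is_derive x : is_derive (x : R) (1 : R) dprim (hat x).
Proof. by apply: is_deriveB; [exact: prim_is_derive|apply: is_derive_shiftB; exact: prim_is_derive]. Qed.

Lemma edge_derive x : derive1 edge x = hat x - hat (x - 1).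
Proof.
rewrite derive1E; have [_ ->] : is_derive (x : R) (1 : R) edge (hat x - hat (x - 1)) => //.
by apply: is_deriveB; [exact: dprim_is_derive|apply: is_derive_shiftB; exact: dprim_is_derive].
Qed.

Lemma hat_ge0 x : 0 <= hat x.
Proof.
rewrite /hat; have /andP[s0 _] := step_itv x; have /andP[_ s1] := step_itv (x - 1).
have [x1|x1] := leP x 1; first by rewrite (@step_le0 (x - 1)) ?subr0// subr_le0.
by rewrite (step_ge1 (ltW x1)); lra.
Qed.

Lemma hat_out x : ~~ (0 < x < 2) -> hat x = 0.
Proof.
rewrite negb_and -!leNgt /hat => /orP[x0|x2].
  by rewrite !step_le0 ?subrr//; lra.
by rewrite !step_ge1 ?subrr//; lra.
Qed.

Lemma sum_hat K (x : R) : \sum_(m < K) hat (x - m%:R) = step x - step (x - K%:R).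
Proof.
elim: K => [|K IH]; first by rewrite big_ord0 subr0 subrr.
by rewrite big_ord_recr/= IH /hat -natr1 opprD addrA addrA subrK.
Qed.

Lemma sum_hat_le1 K (x : R) : \sum_(m < K) hat (x - m%:R) <= 1.
Proof.
by rewrite sum_hat; have /andP[_ ?] := step_itv x; have /andP[? _] := step_itv (x - K%:R); lra.
Qed.

Lemma sum_hat_eq1 K (x : R) : 1 <= x <= K%:R -> \sum_(m < K) hat (x - m%:R) = 1.
Proof. by move=> /andP[x1 xK]; rewrite sum_hat step_ge1// step_le0 ?subr0// subr_le0. Qed.

Lemma dprim_itv x : 0 <= dprim x <= 1.
Proof.
have xx : x - 1 <= x by lra.
have [|c _ E] := @MVT_segment R prim step (x - 1) x xx (fun z _ => prim_is_derive z).
  by apply: continuous_subspaceT; exact/smooth1_continuous/prim_smooth.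
by rewrite /dprim E opprB addrCA subrr addr0 mulr1 step_itv.
Qed.

Lemma edge_ge0 x : 0 <= edge x.
Proof.
rewrite subr_ge0; apply: (is_derive_nondecr dprim_is_derive); last by lra.
exact: hat_ge0.
Qed.

(** To the right, [dprim] is constant because its derivative [hat] vanishes. *)
Lemma edge_out x : ~~ (0 < x < 3) -> edge x = 0.
Proof.
rewrite negb_and -!leNgt /edge => /orP[x0|x2].
  by rewrite /dprim !prim_le0 ?subrr//; lra.
have D y : 2 <= y -> dprim y = dprim 2.
  by apply: (is_derive_cst_on dprim_is_derive) => z z2; rewrite hat_out// negb_and -!leNgt z2 orbT.
by rewrite !D ?subrr//; lra.
Qed.

Lemma sum_edge_le1 K (x : R) : \sum_(m < K) edge (x - m%:R) <= 1.
Proof.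
have -> : \sum_(m < K) edge (x - m%:R) = dprim x - dprim (x - K%:R).
  elim: K => [|K IH]; first by rewrite big_ord0 subr0 subrr.
  have -> : x - K.+1%:R = x - K%:R - 1 by rewrite -natr1; ring.
  by rewrite big_ord_recr/= IH /edge; ring.
by have /andP[_ ?] := dprim_itv x; have /andP[? _] := dprim_itv (x - K%:R); lra.
Qed.

End tensor.

(** * Differences on a finite lattice *)

Section combinatorics.
Context {R : realType}.

Lemma telescope_le (K : nat) (G : 'I_K.+1 -> R) (a b : 'I_K.+1) :
  `|G a - G b| <= \sum_(s < K) `|G (lift ord0 s) - G (widen_ord (leqnSn K) s)|.
Proof.
wlog ab : a b / (a <= b)%N.
  by move=> H; case/orP : (leq_total a b) => /H //; rewrite distrC.
pose g (i : nat) := G (inord i).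
have gE (i : 'I_K.+1) : G i = g i by rewrite /g inord_val.
rewrite (eq_bigr (fun s : 'I_K => `|g s.+1 - g s|)); last first.
  by move=> s _; rewrite !gE.
rewrite !gE distrC -(telescope_sumr g ab).
apply: le_trans (ler_norm_sum _ _ _) _.
rewrite -(big_mkord xpredT (fun s => `|g s.+1 - g s|)).
have bK : (b <= K)%N by rewrite -ltnS.
rewrite [leRHS](@big_cat_nat _ _ _ a) ?(leq_trans ab)//= [X in _ + X](@big_cat_nat _ _ _ b)//=.
by rewrite addrCA lerDl addr_ge0// sumr_ge0.
Qed.

Variables (n K : nat).
Notation T := {ffun 'I_n -> 'I_K.+1}.
Implicit Types (F : T -> R) (m p q : T).

Definition fset_at p (i : 'I_n) (s : 'I_K.+1) : T := [ffun j => if j == i then s else p j].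

(** Interpolates between [m] and [m'] one coordinate at a time. *)
Definition mix (k : nat) (m m' : T) : T := [ffun j : 'I_n => if (j < k)%N then m' j else m j].

(** Set to 0 at the upper end of the line, where there is no next lattice point. *)
Definition step_diff F (i : 'I_n) m : R :=
  if (m i < K)%N then `|F (fset_at m i (inord (m i).+1)) - F m| else 0.

(** The map [(p, s) -> (p with s at place i, p i)] is an involution. *)
Lemma sum_fset_at (X : T -> R) i :
  \sum_p \sum_s X (fset_at p i s) = (K.+1)%:R * \sum_p X p.
Proof.
rewrite pair_big/=.
pose h (ps : T * 'I_K.+1) : T * 'I_K.+1 := (fset_at ps.1 i ps.2, ps.1 i).
have hK : involutive h.
  move=> [p s]; rewrite /h/=; congr (_, _); last by rewrite ffunE eqxx.
  by apply/ffunP => j; rewrite !ffunE; case: eqP => [->|].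
rewrite (reindex_inj (inv_inj hK))/=.
rewrite (eq_bigr (fun ps : T * 'I_K.+1 => X ps.1)); last first.
  move=> [p s] _ /=; congr X; apply/ffunP => j; rewrite !ffunE.
  by case: eqP => [->|].
rewrite -(pair_big xpredT xpredT (fun p s => X p))/= exchange_big/=.
by rewrite sumr_const card_ord mulr_natl.
Qed.

Lemma sum_line F i p (s t : 'I_K.+1) :
  `|F (fset_at p i s) - F (fset_at p i t)| <= \sum_r step_diff F i (fset_at p i r).
Proof.
apply: le_trans (telescope_le (fun s => F (fset_at p i s)) s t) _.
rewrite big_ord_recr/= {2}/step_diff ffunE eqxx/= ltnn addr0.
apply: ler_sum => r _; rewrite /step_diff ffunE eqxx /= ltn_ord.
rewrite (_ : fset_at (fset_at p i _) i _ = fset_at p i (lift ord0 r))//.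
apply/ffunP => j; rewrite !ffunE; case: eqP => // _; apply: val_inj => /=.
by rewrite inordK// ltnS.
Qed.

(** Walk from [m] to [m'] by changing one coordinate at a time.  Swapping the first
    [i] coordinates of [m] and [m'] is an involution, which turns the sum over pairs of
    the [i]-th differences into a sum over lines parallel to the [i]-th axis, and on a
    line differences telescope. *)
Lemma sum_all_diff F :
  \sum_m \sum_m' `|F m - F m'| <=
    (K.+1)%:R ^+ n * (K.+1)%:R * \sum_i \sum_m step_diff F i m.
Proof.
have cardT : #|{: T}| = (K.+1 ^ n)%N by rewrite card_ffun !card_ord.
have tel m m' : F m - F m' = \sum_(i < n) (F (mix i m m') - F (mix i.+1 m m')).
  rewrite -(big_mkord xpredT (fun i => F (mix i m m') - F (mix i.+1 m m'))).
  rewrite -[RHS]opprK -sumrN (eq_bigr (fun i => F (mix i.+1 m m') - F (mix i m m'))).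
    rewrite telescope_sumr// opprB; congr (F _ - F _); apply/ffunP => j.
      by rewrite ffunE ltn0.
    by rewrite ffunE ltn_ord.
  by move=> i _; rewrite opprB.
have H (i : 'I_n) : \sum_m \sum_m' `|F (mix i m m') - F (mix i.+1 m m')| <=
    (K.+1)%:R ^+ n * ((K.+1)%:R * \sum_m step_diff F i m).
  rewrite pair_big/=.
  (* swaps the first i coordinates of the two lattice points *)
  pose h (mm : T * T) := (mix i mm.1 mm.2, mix i mm.2 mm.1).
  have hK : involutive h.
    move=> [m m']; rewrite /h/=; congr (_, _); apply/ffunP => j; rewrite !ffunE;
      by case: (j < i)%N.
  rewrite (reindex_inj (inv_inj hK))/=.
  rewrite (eq_bigr (fun pq : T * T => `|F pq.1 - F (fset_at pq.1 i (pq.2 i))|)); last first.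
    move=> [p q] _ /=; congr (`|F _ - F _|); apply/ffunP => j; rewrite !ffunE.
      by case: (j < i)%N.
    rewrite ltnS leq_eqVlt; case: ltngtP => //= [ji|ji|/val_inj ->].
    - by rewrite (negbTE (_ : j != i))//; apply: contraTneq ji => ->; rewrite ltnn.
    - by rewrite (negbTE (_ : j != i))//; apply: contraTneq ji => ->; rewrite ltnn.
    - by rewrite eqxx.
  rewrite -(pair_big xpredT xpredT (fun p q => `|F p - F (fset_at p i (q i))|))/=.
  rewrite -(sum_fset_at _ i) mulr_sumr; apply: ler_sum => p _.
  rewrite -natrX -cardT mulr_natl -sumr_const; apply: ler_sum => q _.
  rewrite -{1}(_ : fset_at p i (p i) = p); first exact: sum_line.
  by apply/ffunP => j; rewrite ffunE; case: eqP => [->|].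
rewrite -mulrA !mulr_sumr.
apply: (@le_trans _ _ (\sum_(i < n) \sum_m \sum_m' `|F (mix i m m') - F (mix i.+1 m m')|)).
  rewrite [leRHS]exchange_big/=; apply: ler_sum => m _; rewrite [leRHS]exchange_big/=; apply: ler_sum => m' _.
  by rewrite tel; exact: ler_norm_sum.
by apply: ler_sum => i _; exact: H.
Qed.

End combinatorics.

(** * The Poincare inequality on a box *)

Section rintegral.
Context {R : realType} d (T : measurableType d) (mu : {measure set T -> \bar R}).
Variables (D : set T) (mD : measurable D).

Lemma integrable_bounded_mul (f g : T -> R) (C : R) :
  mu.-integrable D (EFin \o f) -> measurable_fun D g -> (forall x, D x -> `|g x| <= C) ->
  mu.-integrable D (EFin \o (fun x => f x * g x)).
Proof.
move=> fi mg gC.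
have mf : measurable_fun D f by apply/measurable_EFinP; exact: measurable_int fi.
apply: (@le_integrable _ _ _ mu _ mD _ (fun x => (C%:E * (EFin \o f) x)%E)).
- by apply/measurable_EFinP; exact: measurable_funM.
- move=> x Dx /=; rewrite lee_fin normrM [leRHS]normrM mulrC ler_wpM2r//.
  by apply: (le_trans (gC x Dx)); exact: ler_norm.
- exact: integrableZl.
Qed.

Lemma Rint_sum (I : Type) (r : seq I) (P : pred I) (f : I -> T -> R) :
  (forall i, P i -> mu.-integrable D (EFin \o f i)) ->
  \int[mu]_(x in D) (\sum_(i <- r | P i) f i x) = \sum_(i <- r | P i) \int[mu]_(x in D) f i x.
Proof.
move=> fi; elim: r => [|i r IH].
  under eq_Rintegral do rewrite big_nil.
  by rewrite big_nil /Rintegral integral0.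
under eq_Rintegral do rewrite big_cons.
rewrite big_cons; case: ifPn => Pi; last exact: IH.
rewrite RintegralD//; last 2 first.
- exact: fi.
- rewrite (_ : _ \o _ = fun x => (\sum_(j <- r | P j) (f j x)%:E)%E); last first.
    by apply/funext => x /=; rewrite sumEFin.
  by apply: integrable_sum => //= j Pj; exact: fi.
by rewrite IH.
Qed.

Lemma integrable_Rsum (I : Type) (r : seq I) (P : pred I) (f : I -> T -> R) :
  (forall i, P i -> mu.-integrable D (EFin \o f i)) ->
  mu.-integrable D (EFin \o (fun x => \sum_(i <- r | P i) f i x)).
Proof.
move=> fi.
rewrite (_ : _ \o _ = fun x => (\sum_(j <- r | P j) (f j x)%:E)%E); last first.
  by apply/funext => x /=; rewrite sumEFin.
by apply: integrable_sum => //= j Pj; exact: fi.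
Qed.

Lemma Rint_dominated (f_ : nat -> T -> R) (f g : T -> R) :
  (forall n, measurable_fun D (f_ n)) ->
  (forall x, D x -> f_ ^~ x @ \oo --> f x) ->
  mu.-integrable D (EFin \o g) -> (forall n x, D x -> `|f_ n x| <= g x) ->
  (fun n => \int[mu]_(x in D) f_ n x) @ \oo --> \int[mu]_(x in D) f x.
Proof.
move=> mf_ cf gi fg.
have mf : measurable_fun D f by exact: measurable_fun_cvg mf_ cf.
have cE x : D x -> (fun n => (f_ n x)%:E) @ \oo --> (f x)%:E.
  by move=> Dx; apply/cvg_EFin; [exact: nearW|exact: cf].
have [i1 _ i3] := @dominated_convergence _ _ _ mu D mD (fun n => EFin \o f_ n) (EFin \o f) (EFin \o g)
  (fun n => (measurable_EFinP _ _).2 (mf_ n)) ((measurable_EFinP _ _).2 mf)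
  (aeW _ cE) gi (aeW _ (fun x n Dx => fg n x Dx)).
by move: i3; rewrite -(fineK (integrable_fin_num mD i1)) => /fine_cvg.
Qed.

Lemma Rint_le_norm (f : T -> R) (g : T -> R) :
  mu.-integrable D (EFin \o f) -> mu.-integrable D (EFin \o g) ->
  (forall x, D x -> `|f x| <= g x) -> `|\int[mu]_(x in D) f x| <= \int[mu]_(x in D) g x.
Proof.
move=> fi gi fg; apply: le_trans (le_normr_Rintegral mD fi) _.
apply: le_Rintegral => //.
by have := integrable_norm fi; apply: eq_integrable.
Qed.

Lemma Rint_restrict (A : set T) (f : T -> R) : A `<=` D -> (forall x, D x -> ~ A x -> f x = 0) ->
  \int[mu]_(x in D) f x = \int[mu]_(x in A) f x.
Proof.
move=> AD f0; rewrite Rintegral_mkcond [RHS]Rintegral_mkcond; congr (Rintegral _ _ _).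
apply/funext => x; rewrite !patchE; case: ifPn => xD; case: ifPn => xA //.
- by apply: f0; [exact/set_mem|move/mem_set; exact/negP].
- by move: xD; rewrite mem_set//; apply: AD; exact: set_mem.
Qed.

End rintegral.

Section lattice.
Context {R : realType} (n : nat) (a L : 'rV[R]_n).
Hypothesis L0 : forall i, 0 < L ord0 i.

Definition obox (a b : 'rV[R]_n) : set 'rV[R]_n :=
  [set y | forall i, a ord0 i < y ord0 i < b ord0 i].

Lemma measurable_cbox (b c : 'rV[R]_n) : measurable (cbox b c).
Proof.
have -> : cbox b c = \bigcap_(i in [set: 'I_n])
    ((fun x : 'rV[R]_n => x ord0 i) @^-1` `[b ord0 i, c ord0 i]%classic).
  apply/seteqP; split => [x H i _ /=|x H i]; first by rewrite in_itv /= H.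
  by have := H i I; rewrite /= in_itv.
apply: fin_bigcap_measurable => // i _.
by rewrite -[X in measurable X]setTI; apply: measurable_coord.
Qed.

Let B : set (lebesgueType R n) := cbox a (a + L).
Let mB : measurable B. Proof. exact: borel_measurable_lebesgue (measurable_cbox _ _). Qed.

Section fixedK.
Variable K : nat.
Notation T := {ffun 'I_n -> 'I_K.+1}.
Implicit Types (m : T).

(** The lattice has [K.+1] points along each edge; a bump is two meshes wide, so
    together they span [K.+2] meshes, which is the whole edge. *)
Definition mesh i : R := L ord0 i / (K.+2)%:R.
Definition mesh_coord i (t : R) (s : nat) : R := (t - a ord0 i) / mesh i - s%:R.

Lemma mesh_gt0 i : 0 < mesh i. Proof. by rewrite divr_gt0. Qed.

(** The bumps form a partition of unity inside the box, up to one mesh from the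
    boundary. *)
Definition hat_bump m : 'rV[R]_n -> R := tens (fun i t => hat (mesh_coord i t (m i))).
(** The test function whose [i]-th derivative is proportional to the difference of two
    neighbouring bumps. *)
Definition edge_bump i m : 'rV[R]_n -> R :=
  tens (fun j t => (if j == i then edge else hat) (mesh_coord j t (m j))).

Lemma mesh_coord_smooth (f : R -> R) i s : smooth1 f -> smooth1 (fun t => f (mesh_coord i t s)).
Proof.
move=> /(smooth1_aff (mesh i)^-1 (- (a ord0 i / mesh i) - s%:R)); congr smooth1.
by apply/funext => t; congr f; rewrite /mesh_coord; ring.
Qed.

Lemma mesh_coord_derive1 (f : R -> R) i s t : smooth1 f ->
  derive1 (fun t => f (mesh_coord i t s)) t = (mesh i)^-1 * derive1 f (mesh_coord i t s).
Proof.
move=> sf; have -> : (fun t => f (mesh_coord i t s)) =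
  (fun t => f ((mesh i)^-1 * t + (- (a ord0 i / mesh i) - s%:R))).
  by apply/funext => u; congr f; rewrite /mesh_coord; ring.
rewrite derive1_aff//; congr (_ * derive1 f _); rewrite /mesh_coord; ring.
Qed.

Lemma hat_bump_smooth m i : smooth1 (fun t => hat (mesh_coord i t (m i))).
Proof. exact/mesh_coord_smooth/hat_smooth. Qed.

Lemma edge_bump_smooth i m j : smooth1 (fun t => (if j == i then edge else hat) (mesh_coord j t (m j)) : R).
Proof. by apply: mesh_coord_smooth; case: eqP => _; [exact: edge_smooth|exact: hat_smooth]. Qed.

Lemma hat_bump_ge0 m y : 0 <= hat_bump m y.
Proof. by apply: prodr_ge0 => i _; exact: hat_ge0. Qed.

Lemma edge_bump_ge0 i m y : 0 <= edge_bump i m y.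
Proof.
by apply: prodr_ge0 => j _; case: eqP => _; [exact: edge_ge0|exact: hat_ge0].
Qed.

Lemma sum_hat_bumpE y : \sum_m hat_bump m y = \prod_i \sum_(s < K.+1) hat (mesh_coord i (y ord0 i) s).
Proof. by rewrite bigA_distr_bigA. Qed.

Lemma sum_hat_bump_le1 y : \sum_m hat_bump m y <= 1.
Proof.
rewrite sum_hat_bumpE; apply: prodr_ile1 => i _; apply/andP; split.
  by apply: sumr_ge0 => s _; exact: hat_ge0.
exact: sum_hat_le1.
Qed.

Lemma sum_hat_bump_eq1 (y : 'rV[R]_n) : (forall i, mesh i <= y ord0 i - a ord0 i <= L ord0 i - mesh i) ->
  \sum_m hat_bump m y = 1.
Proof.
move=> H; rewrite sum_hat_bumpE; apply: big1 => i _; apply: sum_hat_eq1.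
have m0 := mesh_gt0 i; have /andP[h1 h2] := H i.
apply/andP; split; first by rewrite ler_pdivlMr// mul1r.
rewrite ler_pdivrMr//; apply: (le_trans h2).
by rewrite lerBlDr -[X in _ + X]mul1r -mulrDl natr1 /mesh mulrC mulfVK// pnatr_eq0.
Qed.

Lemma sum_edge_bump_le1 i y : \sum_m edge_bump i m y <= 1.
Proof.
rewrite [leLHS](_ : _ = \prod_j \sum_(s < K.+1) (if j == i then edge else hat) (mesh_coord j (y ord0 j) s)); last first.
  by rewrite bigA_distr_bigA.
apply: prodr_ile1 => j _; apply/andP; split.
  by apply: sumr_ge0 => s _; case: eqP => _; [exact: edge_ge0|exact: hat_ge0].
by case: eqP => _; [exact: sum_edge_le1|exact: sum_hat_le1].
Qed.

Definition cell m : set 'rV[R]_n := [set y | forall i, 0 < mesh_coord i (y ord0 i) (m i) < 2].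

Lemma hat_bump_cell m y : hat_bump m y != 0 -> cell m y.
Proof.
move=> /tens_neq0 H i; have := H i; apply: contraNT => /hat_out ->//.
Qed.

Lemma mesh_coord_itv i t (s : nat) (u : nat) : (s + u <= K.+2)%N -> 0 < mesh_coord i t s < u%:R ->
  a ord0 i <= t <= a ord0 i + L ord0 i.
Proof.
move=> sK; have m0 := mesh_gt0 i.
rewrite /mesh_coord subr_gt0 ltr_pdivlMr// ltrBrDl ltrBlDl ltr_pdivrMr// => /andP[h1 h2].
apply/andP; split.
  by apply: le_trans (ltW h1); rewrite lerDl mulr_ge0// ltW.
rewrite -lerBlDl; apply: (le_trans (ltW h2)); rewrite -natrD.
apply: (@le_trans _ _ ((K.+2)%:R * mesh i)); first by rewrite ler_pM2r// ler_nat.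
by rewrite /mesh mulrC mulfVK// pnatr_eq0.
Qed.

Lemma cell_sub m : cell m `<=` B.
Proof.
move=> y H i; rewrite !mxE; apply: (@mesh_coord_itv _ _ (m i) 2) => //.
by rewrite addn2 !ltnS -ltnS ltn_ord.
Qed.

Lemma hat_bump_out m y : ~ B y -> hat_bump m y = 0.
Proof. by move=> nB; apply: contra_notP nB => /eqP/hat_bump_cell/cell_sub. Qed.

Lemma edge_bump_test i m (U : set 'rV[R]_n) : (m i < K)%N -> B `<=` U -> test_function U (edge_bump i m).
Proof.
move=> mK BU; apply: (@tens_test _ _ _ a (a + L)) => //; first by move=> j; exact: edge_bump_smooth.
move=> j t; rewrite !mxE => H.
case: eqP => [ji|_].
  apply: edge_out; apply: contra H; apply: (@mesh_coord_itv _ _ _ 3).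
  by rewrite addn3 ji !ltnS.
apply: hat_out; apply: contra H; apply: (@mesh_coord_itv _ _ _ 2).
by rewrite addn2 !ltnS -ltnS ltn_ord.
Qed.

(** This is where the weak derivative enters: a finite difference of bumps is
    a multiple of a partial derivative of a test function. *)
Lemma hat_bump_step i m y : (m i < K)%N ->
  hat_bump (fset_at m i (inord (m i).+1)) y - hat_bump m y = - mesh i * partial i (edge_bump i m) y.
Proof.
move=> mK; have m0 := mesh_gt0 i.
rewrite tens_derive; last exact: edge_bump_smooth.
rewrite tens_upd /hat_bump (tensD1 _ i) (tensD1 (fun j t => hat (mesh_coord j t (m j))) i) eqxx.
rewrite mesh_coord_derive1 ?edge_derive; last exact: edge_smooth.
rewrite (eq_bigr (fun j => hat (mesh_coord j (y ord0 j) (m j)))); last first.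
  by move=> j /negbTE ji; rewrite ffunE ji.
rewrite [in RHS](eq_bigr (fun j => hat (mesh_coord j (y ord0 j) (m j)))); last first.
  by move=> j /negbTE ->.
rewrite ffunE eqxx inordK//.
have -> : mesh_coord i (y ord0 i) (m i).+1 = mesh_coord i (y ord0 i) (m i) - 1 by rewrite /mesh_coord -natr1; ring.
by field; rewrite gt_eqF.
Qed.

Section forms.
Variables (U : set 'rV[R]_n) (f : 'rV[R]_n -> R).
Hypotheses (BU : B `<=` U) (fi : (@leb R n).-integrable B (EFin \o f)).

Let mhat_bump m : measurable_fun B (hat_bump m).
Proof. by apply: measurable_funTS; apply: measurable_tens => i; exact: hat_bump_smooth. Qed.

Let medge_bump i m : measurable_fun B (edge_bump i m).
Proof. by apply: measurable_funTS; apply: measurable_tens => j; exact: edge_bump_smooth. Qed.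

Let hat_bump_le1 m y : hat_bump m y <= 1.
Proof.
apply: le_trans (sum_hat_bump_le1 y); rewrite (bigD1 m)//= lerDl.
by apply: sumr_ge0 => p _; exact: hat_bump_ge0.
Qed.

Let edge_bump_le1 i m y : edge_bump i m y <= 1.
Proof.
apply: le_trans (sum_edge_bump_le1 i y); rewrite (bigD1 m)//= lerDl.
by apply: sumr_ge0 => p _; exact: edge_bump_ge0.
Qed.

Lemma integrable_hat_bump (g : 'rV[R]_n -> R) m : (@leb R n).-integrable B (EFin \o g) ->
  (@leb R n).-integrable B (EFin \o (fun y => g y * hat_bump m y)).
Proof.
move=> gi; apply: (@integrable_bounded_mul _ _ _ _ _ mB g (hat_bump m) 1) => // y _.
by rewrite ger0_norm ?hat_bump_ge0.
Qed.

Lemma integrable_edge_bump (g : 'rV[R]_n -> R) i m : (@leb R n).-integrable B (EFin \o g) ->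
  (@leb R n).-integrable B (EFin \o (fun y => g y * edge_bump i m y)).
Proof.
move=> gi; apply: (@integrable_bounded_mul _ _ _ _ _ mB g (edge_bump i m) 1) => // y _.
by rewrite ger0_norm ?edge_bump_ge0.
Qed.

(** The averages of [f] against the bumps, up to the common factor [bump_mass]. *)
Definition bump_int m : R := \int[@leb R n]_(y in B) (f y * hat_bump m y).

(** Test the weak derivative against [edge_bump i m]. *)
Lemma step_diff_bump_int i m (g : 'rV[R]_n -> R) : (@leb R n).-integrable B (EFin \o g) ->
  weak_partial U i f g ->
  step_diff bump_int i m <= mesh i * \int[@leb R n]_(y in B) (`|g y| * edge_bump i m y).
Proof.
move=> gi wg; have m0 := mesh_gt0 i.
have gni : (@leb R n).-integrable B (EFin \o (fun y => `|g y|)).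
  by have := integrable_norm gi; apply: eq_integrable.
rewrite /step_diff; case: ifPn => mK; last first.
  apply: mulr_ge0; [exact: ltW|apply: Rintegral_ge0 => y _].
  by rewrite mulr_ge0// edge_bump_ge0.
have pt := edge_bump_test mK BU.
have [Km [cK KU K0]] := pt.2.
have pz (F : 'rV[R]_n -> R) : \int[@leb R n]_(y in U) (F y * edge_bump i m y) =
     \int[@leb R n]_(y in B) (F y * edge_bump i m y).
  apply: Rint_restrict => // y _ nB; rewrite [edge_bump _ _ _](_ : _ = 0) ?mulr0//.
  have [_ [K1 [_ K1B K10]]] := edge_bump_test mK (@subset_refl _ B).
  by apply: K10 => /K1B.
have pz' : \int[@leb R n]_(y in U) (f y * partial i (edge_bump i m) y) =
     \int[@leb R n]_(y in B) (f y * partial i (edge_bump i m) y).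
  apply: Rint_restrict => // y _ nB.
  have /eqP := hat_bump_step y mK; rewrite !hat_bump_out// subrr eq_sym mulf_eq0.
  by rewrite oppr_eq0 gt_eqF//= => /eqP ->; rewrite mulr0.
have -> : bump_int (fset_at m i (inord (m i).+1)) - bump_int m =
    mesh i * \int[@leb R n]_(y in B) (g y * edge_bump i m y).
  rewrite -[RHS]opprK -mulrN -pz -(wg _ pt) pz' -mulNr -RintegralZl//; last first.
    have := @integrable_bounded_mul _ _ _ _ _ mB f (partial i (edge_bump i m)) ((mesh i)^-1 * 2) fi.
    apply.
      apply: measurable_funTS; apply: measurable_leb; apply: continuous_measurable_rV.
      exact: (smooth_partial_continuous pt.1).
    move=> y _; rewrite ler_pdivlMl//.
    have -> : mesh i * `|partial i (edge_bump i m) y| = `|- mesh i * partial i (edge_bump i m) y|.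
      by rewrite normrM normrN (gtr0_norm m0).
    rewrite -hat_bump_step//; apply: le_trans (ler_normB _ _) _.
    by rewrite !ger0_norm ?hat_bump_ge0// -[2]/(1 + 1) lerD.
  rewrite /bump_int -RintegralB//; try exact: integrable_hat_bump.
  by apply: eq_Rintegral => y _; rewrite -mulrBr hat_bump_step//; ring.
rewrite normrM (gtr0_norm m0) ler_pM2l//.
apply: Rint_le_norm => //; first exact: integrable_edge_bump.
  exact: integrable_edge_bump.
by move=> y _; rewrite normrM (ger0_norm (edge_bump_ge0 _ _ _)).
Qed.

(** The functions [edge_bump i m] sum to at most 1 over [m]. *)
Lemma sum_step_diff i (g : 'rV[R]_n -> R) : (@leb R n).-integrable B (EFin \o g) ->
  weak_partial U i f g ->
  \sum_m step_diff bump_int i m <= mesh i * \int[@leb R n]_(y in B) `|g y|.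
Proof.
move=> gi wg; have m0 := mesh_gt0 i.
have gni : (@leb R n).-integrable B (EFin \o (fun y => `|g y|)).
  by have := integrable_norm gi; apply: eq_integrable.
apply: le_trans (ler_sum _ (fun m _ => step_diff_bump_int m gi wg)) _.
rewrite -mulr_sumr ler_pM2l// -Rint_sum//; last first.
  by move=> m _; exact: integrable_edge_bump.
apply: le_Rintegral => //.
  by apply: integrable_Rsum => // m _; exact: integrable_edge_bump.
move=> y _; rewrite -mulr_sumr ler_piMr//; exact: sum_edge_bump_le1.
Qed.

Lemma sum_bump_int_diff (g : 'I_n -> 'rV[R]_n -> R) :
  (forall i, (@leb R n).-integrable B (EFin \o g i)) ->
  (forall i, weak_partial U i f (g i)) ->
  \sum_m \sum_m' `|bump_int m - bump_int m'| <=
  (K.+1)%:R ^+ n * \sum_i L ord0 i * \int[@leb R n]_(y in B) `|g i y|.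
Proof.
move=> gi wg; apply: le_trans (sum_all_diff bump_int) _.
rewrite -mulrA ler_wpM2l ?exprn_ge0// mulr_sumr; apply: ler_sum => i _.
apply: (@le_trans _ _ ((K.+1)%:R * (mesh i * \int[@leb R n]_(y in B) `|g i y|))).
  by rewrite ler_wpM2l//; exact: sum_step_diff.
rewrite mulrA ler_wpM2r//; first by apply: Rintegral_ge0.
rewrite /mesh mulrCA ler_piMr//; first exact: ltW.
by rewrite ler_pdivrMr// mul1r ler_nat.
Qed.

End forms.

Definition bump_mass : R := \int[@leb R n]_(y in B) hat_bump [ffun=> ord0] y.

(** The bumps are translates of one another. *)
Lemma hat_bump_mass m : \int[@leb R n]_(y in B) hat_bump m y = bump_mass.
Proof.
rewrite /bump_mass.
have E p : \int[@leb R n]_(y in B) hat_bump p y = \int[@leb R n]_y hat_bump p y.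
  by apply/esym/Rint_restrict => // y _; exact: hat_bump_out.
rewrite !E.
pose v : 'rV[R]_n := \row_i (- (mesh i * (m i)%:R)).
have -> : hat_bump m = (fun y => hat_bump [ffun=> ord0] (y + v)).
  apply/funext => y; apply: eq_bigr => i _; congr hat; rewrite /mesh_coord !mxE ffunE subr0.
  have m0 := mesh_gt0 i; field; rewrite gt_eqF//.
rewrite /Rintegral (leb_integral_shift v (f := EFin \o hat_bump [ffun=> ord0]))//.
apply/measurable_EFinP; apply: continuous_measurable_rV => y.
by apply/differentiable_continuous/tens_differentiable => i; exact: hat_bump_smooth.
Qed.

End fixedK.

Lemma mesh_near (i : 'I_n) (e : R) : 0 < e -> \forall K \near \oo, mesh K i < e.
Proof.
move=> e0; have eL : 0 < e / L ord0 i by rewrite divr_gt0.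
near=> K; have : K.+1%:R^-1 < e / L ord0 i.
  by near: K; exact: (near_infty_natSinv_lt (PosNum eL)).
rewrite ltr_pdivlMr// => H; apply: le_lt_trans H; rewrite /mesh [leLHS]mulrC ler_pM2r//.
by rewrite lef_pV2 ?posrE// ler_nat.
Unshelve. all: by end_near. Qed.

(** A smooth approximation from inside of the indicator function of [A]. *)
Definition inner_sum K (A : set 'rV[R]_n) y : R :=
  \sum_(m : {ffun 'I_n -> 'I_K.+1} | `[< cell m `<=` A >]) hat_bump m y.

Lemma inner_sum_itv K A y : 0 <= @inner_sum K A y <= 1.
Proof.
apply/andP; split; first by apply: sumr_ge0 => m _; exact: hat_bump_ge0.
apply: le_trans (sum_hat_bump_le1 K y); rewrite [leRHS](bigID (fun m => `[< cell m `<=` A >]))/=.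
by rewrite lerDl; apply: sumr_ge0 => m _; exact: hat_bump_ge0.
Qed.

(** For a fine mesh, all bumps that do not vanish at a given point of [A] are supported
    in [A]. *)
Lemma inner_sum_cvg A y : open A -> A `<=` obox a (a + L) ->
  (fun K => @inner_sum K A y) @ \oo --> (\1_A y : R).
Proof.
move=> oA Ab; rewrite indicE; have [yA|yA] := boolP (y \in A); last first.
  rewrite [X in X @ _](_ : _ = fun=> 0); first exact: cvg_cst.
  apply/funext => K; apply: big1 => m /asboolP mA; apply/eqP; apply: contraNT yA.
  by move=> /hat_bump_cell/mA; exact: mem_set.
have /nbhs_ballP [e e0 He] : nbhs y A by apply: open_nbhs_nbhs; split => //; exact: set_mem.
have {Ab} yb : obox a (a + L) y by apply: Ab; exact: set_mem.
apply: cvg_near_cst; near=> K.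
have He2 : forall i : 'I_n, mesh K i < e / 2 by near: K; apply: filter_forall => i; apply: mesh_near; rewrite divr_gt0.
have Hl : forall i : 'I_n, mesh K i < y ord0 i - a ord0 i.
  by near: K; apply: filter_forall => i; apply: mesh_near; have := yb i; rewrite !mxE; lra.
have Hr : forall i : 'I_n, mesh K i < a ord0 i + L ord0 i - y ord0 i.
  by near: K; apply: filter_forall => i; apply: mesh_near; have := yb i; rewrite !mxE; lra.
have E1 := sum_hat_bump_eq1 (K := K) (y := y).
rewrite (bigID (fun m => `[< cell m `<=` A >]))/= in E1.
rewrite -[LHS]addr0 /inner_sum -{}E1; last first.
  by move=> i; have := Hl i; have := Hr i; move=> h1 h2; apply/andP; split; lra.
congr (_ + _); apply/esym/big1 => m; apply: contraNeq => /hat_bump_cell ym; apply/asboolP => z zm.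
apply: He; split => // i0 i; rewrite ord1 /ball/=.
have m0 := mesh_gt0 K i.
have := ym i; have := zm i; have := He2 i; rewrite /mesh_coord => h /andP[z1 z2] /andP[y1 y2].
have dz : `|(y ord0 i - z ord0 i) / mesh K i| < 2.
  rewrite ltr_norml mulrBl; apply/andP; split.
    by move: z1 z2 y1 y2; rewrite !mulrBl; lra.
  by move: z1 z2 y1 y2; rewrite !mulrBl; lra.
move: dz; rewrite normrM (gtr0_norm (x := (mesh K i)^-1)) ?invr_gt0// ltr_pdivrMr//.
by move=> /lt_trans; apply; lra.
Unshelve. all: by end_near. Qed.

Section poincare.
Variables (U : set 'rV[R]_n) (f : 'rV[R]_n -> R) (g : 'I_n -> 'rV[R]_n -> R).
Hypotheses (BU : B `<=` U) (fi : (@leb R n).-integrable B (EFin \o f)).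
Hypothesis gi : forall i, (@leb R n).-integrable B (EFin \o g i).
Hypothesis wg : forall i, weak_partial U i f (g i).

Let finB : (@leb R n B < +oo)%E.
Proof.
apply: (@le_lt_trans _ _ (@leb R n (rbox (a - const_mx 1) (a + L)))).
  apply: le_measure; rewrite ?inE//.
    exact: borel_measurable_lebesgue (measurable_rbox _ _).
  by move=> y H i; have := H i; rewrite !mxE => /andP[h1 ->]; rewrite andbT; lra.
by rewrite leb_rbox ?ltry// => i; rewrite !mxE; have := L0 i; lra.
Qed.

Let inner_measurable K A : measurable_fun B (@inner_sum K A).
Proof.
rewrite /inner_sum; under eq_fun do rewrite big_mkcond.
apply: (@measurable_sum _ _ _ B _ _
  (fun (m : {ffun 'I_n -> 'I_K.+1}) y => if `[< cell m `<=` A >] then hat_bump m y else 0)) => m.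
case: (`[< cell m `<=` A >]); last exact: measurable_cst.
by apply: measurable_funTS; apply: measurable_tens => i; exact: hat_bump_smooth.
Qed.

Let one_integrable : (@leb R n).-integrable B (EFin \o cst (1 : R)).
Proof.
apply/integrableP; split; first by apply/measurable_EFinP; exact: measurable_cst.
under eq_integral do rewrite /= normr1.
by rewrite integral_cst// mul1e.
Qed.

Let inner_cvg (h : 'rV[R]_n -> R) A : (@leb R n).-integrable B (EFin \o h) ->
  open A -> A `<=` obox a (a + L) ->
  (fun K => \int[@leb R n]_(y in B) (h y * @inner_sum K A y)) @ \oo -->
  \int[@leb R n]_(y in A) h y.
Proof.
move=> hi oA Ab.
have AB : A `<=` B.
  by move=> y /Ab H i; have /andP[h1 h2] := H i; rewrite (ltW h1) ltW.
have -> : \int[@leb R n]_(y in A) h y = \int[@leb R n]_(y in B) (h y * \1_A y).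
  transitivity (\int[@leb R n]_(y in A) (h y * \1_A y)).
    by apply: eq_Rintegral => y yA; rewrite indicE yA mulr1.
  by apply/esym/Rint_restrict => // y _ nA; rewrite indicE memNset ?mulr0.
have mh : measurable_fun B h by apply/measurable_EFinP; exact: measurable_int hi.
apply: (@Rint_dominated _ _ _ _ _ mB _ _ (fun y => `|h y|)).
- by move=> K; exact: measurable_funM.
- by move=> y By; apply: cvgMr; exact: inner_sum_cvg.
- by have := integrable_norm hi; apply: eq_integrable.
- move=> K y By; rewrite normrM ler_piMr//.
  by have /andP[h0 h1] := inner_sum_itv K A y; rewrite ger0_norm.
Qed.

(** The Poincare inequality in the form: difference of averages over two open subsets.
    Replace the indicator functions of [A1] and [A2] by sums of bumps.  All bumps
    having the same mass, the left side becomes that mass times a double sum of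
    differences of bump integrals of [f], which [sum_bump_int_diff] bounds uniformly in
    the mesh; then let the mesh tend to 0. *)
Lemma poincare_box (A1 A2 : set 'rV[R]_n) :
  open A1 -> A1 `<=` obox a (a + L) -> open A2 -> A2 `<=` obox a (a + L) ->
  `|fine (@leb R n A2) * \int[@leb R n]_(y in A1) f y -
    fine (@leb R n A1) * \int[@leb R n]_(y in A2) f y| <=
  fine (@leb R n B) * \sum_i L ord0 i * \int[@leb R n]_(y in B) `|g i y|.
Proof.
move=> o1 s1 o2 s2.
have meas A : open A -> measurable (A : set (lebesgueType R n)).
  by move=> oA; exact: borel_measurable_lebesgue (open_measurable_rV oA).
have one A : open A -> A `<=` obox a (a + L) ->
    (fun K => \int[@leb R n]_(y in B) @inner_sum K A y) @ \oo --> fine (@leb R n A).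
  move=> oA sA.
  have -> : (fun K => \int[@leb R n]_(y in B) @inner_sum K A y) =
      (fun K => \int[@leb R n]_(y in B) (cst 1 y * @inner_sum K A y)).
    by apply/funext => K; apply: eq_Rintegral => y _; rewrite mul1r.
  have := inner_cvg one_integrable oA sA.
  by rewrite Rintegral_cst ?mul1r//; exact: meas.
have lhs := cvg_norm (cvgB (cvgM (one _ o2 s2) (inner_cvg fi o1 s1)) (cvgM (one _ o1 s1) (inner_cvg fi o2 s2))).
apply: (cvgr_to_le (lhs _ _ _ _)); apply: nearW => K.
rewrite -[leLHS]/(`|(\int[@leb R n]_(y in B) inner_sum K A2 y) *
    (\int[@leb R n]_(y in B) (f y * inner_sum K A1 y)) -
  (\int[@leb R n]_(y in B) inner_sum K A1 y) *
    (\int[@leb R n]_(y in B) (f y * inner_sum K A2 y))|).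
have pint m : (@leb R n).-integrable B (EFin \o (fun y => hat_bump (K := K) m y)).
  have := integrable_hat_bump m one_integrable; apply: eq_integrable => // y _ /=.
  by rewrite mul1r.
have E1 A : \int[@leb R n]_(y in B) @inner_sum K A y =
    \sum_(m : {ffun 'I_n -> 'I_K.+1} | `[< cell m `<=` A >]) bump_mass K.
  rewrite Rint_sum//.
  by apply: eq_bigr => m _; exact: hat_bump_mass.
have E2 A : \int[@leb R n]_(y in B) (f y * @inner_sum K A y) =
    \sum_(m : {ffun 'I_n -> 'I_K.+1} | `[< cell m `<=` A >]) bump_int f m.
  rewrite -Rint_sum//; last by move=> m _; exact: integrable_hat_bump.
  by apply: eq_Rintegral => y _; rewrite mulr_sumr.
rewrite !{}E1 !{}E2.
have mass0 : 0 <= bump_mass K by apply: Rintegral_ge0 => y _; exact: hat_bump_ge0.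
(* the bumps sum to at most 1 over the box *)
have massK : bump_mass K * (K.+1)%:R ^+ n <= fine (@leb R n B).
  have -> : bump_mass K * (K.+1)%:R ^+ n = \int[@leb R n]_(y in B) (\sum_(m : {ffun 'I_n -> 'I_K.+1}) hat_bump m y).
    rewrite Rint_sum//.
    rewrite (eq_bigr (fun=> bump_mass K)) => [|m _]; last exact: hat_bump_mass.
    by rewrite sumr_const card_ffun !card_ord -natrX mulr_natr.
  rewrite -[leRHS]mul1r -Rintegral_cst//; apply: le_Rintegral => //.
    exact: integrable_Rsum.
  by move=> y _; exact: sum_hat_bump_le1.
(* a product of two sums minus the swapped product is a double sum of differences *)
have -> (P Q : pred {ffun 'I_n -> 'I_K.+1}) (F : {ffun 'I_n -> 'I_K.+1} -> R) w :
  (\sum_(m | P m) w) * (\sum_(m | Q m) F m) - (\sum_(m | Q m) w) * (\sum_(m | P m) F m) =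
  w * (\sum_(m | Q m) \sum_(m' | P m') (F m - F m')).
  under [in RHS]eq_bigr do rewrite sumrB sumr_const.
  by rewrite sumrB !sumr_const sumrMnl mulrBr !mulrnAl !mulrnAr.
rewrite normrM (ger0_norm mass0).
apply: (@le_trans _ _ (bump_mass K * \sum_m \sum_m' `|bump_int f (K := K) m - bump_int f (K := K) m'|)).
  rewrite ler_wpM2l//; apply: le_trans (ler_norm_sum _ _ _) _.
  rewrite [leRHS](bigID (fun m => `[< cell m `<=` A1 >]))/= -[leLHS]addr0; apply: lerD; last first.
    by apply: sumr_ge0 => m _; apply: sumr_ge0.
  apply: ler_sum => m _; apply: le_trans (ler_norm_sum _ _ _) _.
  rewrite [leRHS](bigID (fun m => `[< cell m `<=` A2 >]))/= lerDl.
  by apply: sumr_ge0.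
apply: le_trans (ler_wpM2l mass0 (sum_bump_int_diff K BU fi gi wg)) _.
rewrite mulrA ler_wpM2r//; apply: sumr_ge0 => i _.
by rewrite mulr_ge0//; [exact: ltW|exact: Rintegral_ge0].
Qed.

End poincare.
End lattice.

(** * Whitney neighbourhoods and reference boxes *)

Section geometry.
Context {R : realType}.
Local Notation side := (@side R).

Lemma enorm_ge_coord n (v : 'rV[R]_n) i : `|v ord0 i| <= enorm v.
Proof.
rewrite -sqrtr_sqr /enorm ler_sqrt; last by apply: sumr_ge0 => j _; exact: sqr_ge0.
by rewrite (bigD1 i)//= lerDl; apply: sumr_ge0 => j _; exact: sqr_ge0.
Qed.

Lemma enorm_ge0 n (v : 'rV[R]_n) : 0 <= enorm v.
Proof. exact: sqrtr_ge0. Qed.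

Lemma enorm0 n : enorm (0 : 'rV[R]_n) = 0.
Proof. by rewrite /enorm big1 ?sqrtr0// => i _; rewrite mxE expr0n. Qed.

Lemma enorm_le_sum n (v : 'rV[R]_n) : enorm v <= \sum_i `|v ord0 i|.
Proof.
have s0 : 0 <= \sum_i `|v ord0 i| by apply: sumr_ge0.
rewrite -[leRHS]ger0_norm// -sqrtr_sqr ler_sqrt ?sqr_ge0//.
rewrite expr2 mulr_suml; apply: ler_sum => i _.
rewrite -real_normK ?num_real// expr2 ler_wpM2l//.
by rewrite (bigD1 i)//= lerDl; apply: sumr_ge0.
Qed.

Lemma enorm_continuous n (z : 'rV[R]_n) : continuous (fun y : 'rV[R]_n => enorm (y - z)).
Proof.
move=> y; apply: (@continuous_comp _ _ _ (fun y : 'rV[R]_n => \sum_i (y - z) ord0 i ^+ 2) Num.sqrt); last exact: sqrt_continuous.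
elim: (index_enum _) => [|i r IH].
  have -> : (fun y0 : 'rV[R]_n => \sum_(i <- [::]) (y0 - z) ord0 i ^+ 2) = cst 0.
    by apply/funext => x; rewrite big_nil.
  exact: cst_continuous.
have H : (fun x : 'rV[R]_n => (x - z) ord0 i) x @[x --> y] --> (y - z) ord0 i.
  rewrite [X in X @ _](_ : _ = fun x : 'rV[R]_n => x ord0 i - z ord0 i); last first.
    by apply/funext => x; rewrite !mxE.
  have -> : (y - z) ord0 i = (y : 'rV[R]_n) ord0 i - z ord0 i by rewrite !mxE.
  exact: (cvgB (@coord_continuous _ _ _ ord0 i y) (cvg_cst (z ord0 i))).
have -> : (fun y0 : 'rV[R]_n => \sum_(j <- i :: r) (y0 - z) ord0 j ^+ 2) =
    (fun y0 : 'rV[R]_n => (y0 - z) ord0 i ^+ 2 + \sum_(j <- r) (y0 - z) ord0 j ^+ 2).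
  by apply/funext => x; rewrite big_cons.
by apply: continuousD => //; exact: (cvgM H H).
Qed.

Lemma edist_ltP n (y : 'rV[R]_n) (A : set 'rV[R]_n) (r : R) : A !=set0 ->
  Defs.edist y A < r <-> exists2 z, A z & enorm (y - z) < r.
Proof.
move=> [z0 Az0]; have lb0 : has_lbound [set enorm (y - z) | z in A].
  by exists 0 => _ [z _ <-]; exact: enorm_ge0.
split => [H|[z Az H]]; last by apply: le_lt_trans H; apply: ge_inf => //; exists z.
have [_ [z Az <-] zr] := inf_lt (ex_intro _ (enorm (y - z0)) (ex_intro2 _ _ z0 Az0 erefl)) H.
by exists z.
Qed.

Variable d : nat.
Implicit Types (k : nat) (m e : 'rV[int]_d) (y : 'rV[R]_d.+1).

Definition nbd k m : set 'rV[R]_d.+1 := whitney_nbhd (Posz k) (dcube k m).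

Lemma init_rcons (x : 'rV[R]_d) (t : R) : rV_init (rV_rcons (x, t)) = x.
Proof. by apply/rowP => i; rewrite !mxE liftK. Qed.
Lemma height_rcons (x : 'rV[R]_d) (t : R) : height (rV_rcons (x, t)) = t.
Proof. by rewrite /height mxE unlift_none. Qed.

Lemma side_z k : 2 ^ (- Posz k) = side k :> R.
Proof. by rewrite -invr_expz. Qed.

Lemma side_z1 k : 2 ^ (- Posz k + 1) = 2 * side k :> R.
Proof. by rewrite exprzDr ?unitfE ?pnatr_eq0// side_z expr1z mulrC. Qed.

Lemma side_S k : side k.+1 = side k / 2 :> R.
Proof. by rewrite /side exprS invfM mulrC. Qed.

Lemma whitneyP k m y : whitney (Posz k) (dcube k m) y <->
  dcube k m (rV_init y) /\ side k < height y <= 2 * side k.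
Proof. by rewrite /whitney/= side_z side_z1. Qed.

Lemma whitney_nonempty k m : whitney (Posz k) (@dcube R d k m) !=set0.
Proof.
exists (rV_rcons (\row_i (side k * (m ord0 i + 1)%:~R), 2 * side k)).
have s0 := side_gt0 (R := R) k.
apply/whitneyP; rewrite init_rcons height_rcons lexx andbT; split; last by rewrite ltr_pMl// ltr1n.
by rewrite dcubeE => i; rewrite !mxE lexx andbT ltr_pM2l// ltr_int ltrDl.
Qed.

Lemma nbdP k m y : nbd k m y <-> 0 < height y /\ exists2 z,
  (dcube k m (rV_init z) /\ side k < height z <= 2 * side k) & enorm (y - z) < side k / 4.
Proof.
rewrite /nbd /whitney_nbhd/= side_z mulrC; split => [[h0]|[h0 [z /whitneyP zW H]]].
  by move=> /(edist_ltP _ _ (whitney_nonempty _ _))[z /whitneyP zW H]; split => //; exists z.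
by split => //; apply/(edist_ltP _ _ (whitney_nonempty _ _)); exists z.
Qed.

Lemma nbd_near k m y : nbd k m y -> exists z, [/\ dcube k m (rV_init z),
  side k < height z <= 2 * side k, forall i, `|y ord0 i - z ord0 i| < side k / 4,
  (forall i, `|rV_init y ord0 i - rV_init z ord0 i| < side k / 4) &
  `|height y - height z| < side k / 4].
Proof.
move=> /nbdP[_ [z [zQ zh] yz]]; exists z; have H i : `|y ord0 i - z ord0 i| < side k / 4.
  by apply: le_lt_trans yz; have := enorm_ge_coord (y - z) i; rewrite !mxE.
split => //; last exact: H.
by move=> i; rewrite !mxE; exact: H.
Qed.

Lemma nbd_open k m : open (nbd k m).
Proof.
have -> : nbd k m = \bigcup_(z in whitney (Posz k) (dcube k m))
   ([set y | 0 < height y] `&` [set y | enorm (y - z) < side k / 4]).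
  apply/seteqP; split => y.
    by move=> /nbdP[h0 [z zW yz]]; exists z => //; apply/whitneyP.
  by move=> [z /whitneyP zW [h0 yz]]; apply/nbdP; split => //; exists z.
apply: bigcup_open => z _; apply: openI.
  apply: (@open_comp _ _ (@height R d) [set t | 0 < t]); last exact: open_gt.
  by move=> x _; exact: coord_continuous.
apply: (@open_comp _ _ (fun y : 'rV[R]_d.+1 => enorm (y - z)) [set t | t < side k / 4]); last exact: open_lt.
by move=> x _; exact: enorm_continuous.
Qed.

Lemma whitney_sub_nbd k m : whitney (Posz k) (dcube k m) `<=` nbd k m.
Proof.
have s0 := side_gt0 (R := R) k.
move=> y /whitneyP yW; apply/nbdP; split; last first.
  by exists y => //; rewrite subrr enorm0; lra.
by case: yW => _ /andP[+ _]; apply: lt_trans.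
Qed.

(** Products of a dyadic cube with an interval; being boxes, their measures are known. *)
Definition slab k m (l u : R) : set 'rV[R]_d.+1 :=
  [set y | dcube k m (rV_init y) /\ l < height y <= u].

Lemma slabE k m l u : slab k m l u = rbox
   (rV_rcons (\row_i (side k * (m ord0 i)%:~R), l))
   (rV_rcons (\row_i (side k * (m ord0 i + 1)%:~R), u)).
Proof.
apply/seteqP; split => y /=.
  rewrite /slab/= dcubeE => -[H1 H2] i; rewrite !mxE; case: unliftP => [j ->|->] //=.
  by have := H1 j; rewrite !mxE.
move=> H; split; last by have := H ord_max; rewrite !mxE unlift_none.
by rewrite dcubeE => j; have := H (lift ord_max j); rewrite !mxE liftK/= !mxE.
Qed.

Lemma leb_slab k m l u : l <= u -> @leb R d.+1 (slab k m l u) = (side k ^+ d * (u - l))%:E.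
Proof.
move=> lu; rewrite slabE leb_rbox => [|i]; last first.
  rewrite !mxE; case: unliftP => [j _|_]//=.
  by rewrite !mxE ler_pM2l ?side_gt0// ler_int lerDl.
rewrite big_ord_recr/=; congr (_ * _)%:E; last by rewrite !mxE unlift_none.
rewrite (eq_bigr (fun=> side k)) => [|i _]; first by rewrite prodr_const card_ord.
have -> : widen_ord (leqnSn d) i = lift ord_max i by apply/val_inj/esym; exact: lift_max.
by rewrite !mxE liftK/= !mxE -mulrBr -intrB addrAC subrr add0r mulr1.
Qed.

Lemma measurable_slab k m l u : measurable (slab k m l u : set (lebesgueType R d.+1)).
Proof. by rewrite slabE; apply: borel_measurable_lebesgue; exact: measurable_rbox. Qed.

Lemma measurable_nbd k m : measurable (nbd k m : set (lebesgueType R d.+1)).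
Proof. exact: borel_measurable_lebesgue (open_measurable_rV (@nbd_open k m)). Qed.

Lemma leb_nbd_ge k m : ((side k ^+ d.+1)%:E <= @leb R d.+1 (nbd k m))%E.
Proof.
have s0 := side_gt0 (R := R) k.
have -> : (side k ^+ d.+1)%:E = @leb R d.+1 (slab k m (side k) (2 * side k)).
  by rewrite leb_slab ?exprSr; [congr (_ * _)%:E; ring|lra].
apply: le_measure; rewrite ?inE.
- exact: measurable_slab.
- exact: measurable_nbd.
- by move=> y yW; apply: whitney_sub_nbd; apply/whitneyP.
Qed.

(** A box around the Whitney cube large enough to contain the Whitney neighbourhoods
    of the neighbours of the cube ([nbd_sub_same]) and of its children
    ([nbd_sub_child]), but still at a height comparable to its size. *)
Definition refbox_lo k m : 'rV[R]_d.+1 :=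
  rV_rcons (\row_i (side k * ((m ord0 i)%:~R - 2)), side k / 4).
Definition refbox_len k : 'rV[R]_d.+1 := rV_rcons (\row_i (5 * side k), 11 / 4 * side k).
Definition refbox k m : set 'rV[R]_d.+1 := cbox (refbox_lo k m) (refbox_lo k m + refbox_len k).

Lemma refbox_len_gt0 k i : 0 < refbox_len k ord0 i.
Proof.
have s0 := side_gt0 (R := R) k.
by rewrite mxE; case: unliftP => [j _|_] /=; rewrite ?mxE; lra.
Qed.

Lemma refboxP k m y : refbox k m y <->
  (forall i, side k * ((m ord0 i)%:~R - 2) <= rV_init y ord0 i <= side k * ((m ord0 i)%:~R + 3)) /\
  side k / 4 <= height y <= 3 * side k.
Proof.
split=> [H|[H1 H2] i].
  split => [i|].
    have := H (lift ord_max i); rewrite !mxE liftK/= !mxE => /andP[-> h2]/=.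
    by apply: le_trans h2 _; rewrite !mulrDr; lra.
  have := H ord_max; rewrite /height !mxE unlift_none/= => /andP[-> h2]/=.
  by apply: le_trans h2 _; lra.
rewrite !mxE; case: unliftP => [j ->|->]/=; rewrite ?mxE.
  by have := H1 j; rewrite !mxE => /andP[-> h2]/=; apply: le_trans h2 _; rewrite !mulrDr; lra.
by move: H2; rewrite /height => /andP[-> h2]/=; apply: le_trans h2 _; lra.
Qed.

Lemma oboxP k m y :
  (forall i, side k * ((m ord0 i)%:~R - 2) < rV_init y ord0 i < side k * ((m ord0 i)%:~R + 3)) ->
  side k / 4 < height y < 3 * side k -> obox (refbox_lo k m) (refbox_lo k m + refbox_len k) y.
Proof.
move=> H1 H2 i.
rewrite !mxE; case: unliftP => [j ->|->]/=; rewrite ?mxE.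
  by have := H1 j; rewrite !mxE => /andP[-> h2]/=; apply: lt_le_trans h2 _; rewrite !mulrDr; lra.
by move: H2; rewrite /height => /andP[-> h2]/=; apply: lt_le_trans h2 _; lra.
Qed.

Definition unit_shift e := forall i, (-1 <= e ord0 i <= 1)%R.

Lemma nbd_sub_same k m e : unit_shift e ->
  nbd k (m + e) `<=` obox (refbox_lo k m) (refbox_lo k m + refbox_len k).
Proof.
have s0 := side_gt0 (R := R) k.
move=> He y /nbd_near[z [zQ zh _ yz yh]]; apply: oboxP.
  move=> i; have := yz i; rewrite ltr_norml => /andP[h1 h2].
  move: zQ; rewrite dcubeE => /(_ i); rewrite !mxE !intrD !mulrDr mulr1 => /andP[h3 h4].
  have /andP[e1 e2] := He i.
  have e1' : - side k <= side k * (e ord0 i)%:~R.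
    by rewrite -mulrN1 ler_pM2l// -[-1]/((-1)%:~R) ler_int.
  have e2' : side k * (e ord0 i)%:~R <= side k.
    by rewrite -[leRHS]mulr1 ler_pM2l// -[1]/(1%:~R) ler_int.
  by move: h1 h2; rewrite !mxE => h1 h2; rewrite ?mulrDr; apply/andP; split; lra.
by move: yh zh; rewrite ltr_norml => /andP[h1 h2] /andP[h3 h4]; apply/andP; split; lra.
Qed.

Lemma nbd_sub_child k m m' : @dcube R d k.+1 m' `<=` dcube k m ->
  nbd k.+1 m' `<=` obox (refbox_lo k m) (refbox_lo k m + refbox_len k).
Proof.
have s0 := side_gt0 (R := R) k.
move=> sub y /nbd_near[z [zQ zh _ yz yh]]; rewrite !side_S in zh yz yh.
apply: oboxP.
  move=> i; have := yz i; rewrite ltr_norml => /andP[h1 h2].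
  move: zQ => /sub; rewrite dcubeE => /(_ i); rewrite !mxE !intrD !mulrDr mulr1 => /andP[h3 h4].
  by move: h1 h2; rewrite !mxE => h1 h2; rewrite ?mulrDr; apply/andP; split; lra.
by move: yh zh; rewrite ltr_norml => /andP[h1 h2] /andP[h3 h4]; apply/andP; split; lra.
Qed.

Lemma refbox_halfspace k m : refbox k m `<=` @halfspace R d.
Proof.
have s0 := side_gt0 (R := R) k.
by move=> y /refboxP[_ /andP[h _]]; rewrite /halfspace/=; apply: lt_le_trans h; lra.
Qed.

(** The box is closed; it is enclosed in a half-open one of horizontal edge [6 * side k]
    rather than [5 * side k], whence the constant. *)
Lemma leb_refbox k m : (@leb R d.+1 (refbox k m) <= ((6 ^+ d * 3) * side k ^+ d.+1)%:E)%E.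
Proof.
have s0 := side_gt0 (R := R) k.
have le (i : 'I_d) : side k * ((m ord0 i)%:~R - 3) <= side k * ((m ord0 i)%:~R + 3).
  by rewrite ler_pM2l//; lra.
apply: (@le_trans _ _ (@leb R d.+1 (rbox
   (rV_rcons (\row_i (side k * ((m ord0 i)%:~R - 3)), 0))
   (rV_rcons (\row_i (side k * ((m ord0 i)%:~R + 3)), 3 * side k))))).
  apply: le_measure; rewrite ?inE.
  - exact: borel_measurable_lebesgue (measurable_cbox _ _).
  - exact: borel_measurable_lebesgue (measurable_rbox _ _).
  move=> y /refboxP[H1 /andP[h2 h3]] i; rewrite !mxE; case: unliftP => [j ->|->]/=; rewrite ?mxE.
    have := H1 j; rewrite !mxE => /andP[h4 ->]; rewrite andbT; apply: lt_le_trans h4.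
    by rewrite ltr_pM2l//; lra.
  by move: h2 h3; rewrite /height => h2 ->; rewrite andbT; apply: lt_le_trans h2; lra.
rewrite leb_rbox => [|i]; last first.
  by rewrite !mxE; case: unliftP => [j _|_]//=; rewrite ?mxE//; lra.
rewrite lee_fin big_ord_recr/= !mxE unlift_none/= (eq_bigr (fun=> 6 * side k)) => [|i _].
  by rewrite prodr_const card_ord exprMn exprSr le_eqVlt; apply/orP; left; apply/eqP; ring.
have -> : widen_ord (leqnSn d) i = lift ord_max i by apply/val_inj/esym; exact: lift_max.
by rewrite !mxE liftK/= !mxE; ring.
Qed.

End geometry.

Arguments refbox_len {R d} k.

(** * Step functions on dyadic cubes and bounded overlap *)

Section step_functions.
Context {R : realType} {d : nat}.
Local Notation side := (@side R).
Implicit Types (k : nat) (m e : 'rV[int]_d).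

Lemma esum_shift (F : 'rV[int]_d -> \bar R) e :
  (\esum_(m in [set: 'rV[int]_d]) F (m + e)%R = \esum_(m in [set: 'rV[int]_d]) F m)%E.
Proof.
rewrite [RHS](reindex_esum [set: 'rV[int]_d] _ (fun m => m + e))//; split => //.
- by move=> m m' _ _ /addIr.
- by move=> m _; exists (m - e) => //; rewrite subrK.
Qed.

Lemma esumZl (I : countType) (a : I -> \bar R) (c : R) : (forall i, 0 <= a i)%E -> 0 <= c ->
  (\esum_(i in [set: I]) (c%:E * a i) = c%:E * \esum_(i in [set: I]) a i)%E.
Proof.
move=> a0 c0; rewrite !esum_countable//; last by move=> i; rewrite mule_ge0.
rewrite -nneseriesZl//; last by move=> n _; case: (pickle_inv n) => /=.
by apply: eq_eseriesr => n _; case: (pickle_inv n) => //=; rewrite mule0.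
Qed.

Lemma preimage_idx k m : @idx R d k @^-1` [set m] = dcube k m.
Proof. by apply/seteqP; split => x /dcubeP. Qed.

Lemma measurable_step k d' (T : measurableType d') (F : 'rV[int]_d -> T) :
  measurable_fun setT (fun x : lebesgueType R d => F (idx k x)).
Proof.
move=> _ A mA; rewrite setTI.
have -> : (fun x : lebesgueType R d => F (idx k x)) @^-1` A =
    \bigcup_(m in [set m | A (F m)]) dcube k m.
  apply/seteqP; split => [x /= Ax|x [m /= Am /dcubeP E]]; last by rewrite E.
  by exists (idx k x) => //; exact: dcube_idx.
apply: bigcup_countType_measurable => m _.
exact: borel_measurable_lebesgue (measurable_dcube k m).
Qed.

Lemma int_cubes k (f : 'rV[R]_d -> \bar R) :
  measurable_fun setT (f : lebesgueType R d -> \bar R) -> (forall x, 0 <= f x)%E ->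
  (\int[@leb R d]_x f x = \esum_(m in [set: 'rV[int]_d]) \int[@leb R d]_(x in dcube k m) f x)%E.
Proof.
move=> mf f0.
rewrite (@fiber_integral R _ _ (@leb R d) 'rV[int]_d setT (@idx R d k))//; last first.
  by move=> m; rewrite preimage_idx; exact: borel_measurable_lebesgue (measurable_dcube k m).
by apply: eq_esum => m _; rewrite setTI preimage_idx.
Qed.

Lemma int_step k (F : 'rV[int]_d -> \bar R) : (forall m, 0 <= F m)%E ->
  (\int[@leb R d]_x F (idx k x) =
   \esum_(m in [set: 'rV[int]_d]) ((side k ^+ d)%:E * F m))%E.
Proof.
move=> F0; rewrite (int_cubes k)//; last exact: measurable_step.
apply: eq_esum => m _.
rewrite (eq_integral (fun=> F m)); last by move=> x /set_mem /dcubeP ->.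
rewrite integral_cst; last exact: borel_measurable_lebesgue (measurable_dcube k m).
by rewrite [X in (_ * X)%E](leb_dcube k m) muleC.
Qed.

Lemma fsbig_dyadic k (F : set 'rV[R]_d -> R) (x : 'rV[R]_d) :
  \sum_(Q \in dyadic (Posz k)) (F Q * \1_Q x) = F (dcube k (idx k x)).
Proof.
rewrite -(fsbig_widen [set dcube k (idx k x)])/=.
- by rewrite fsbig_set1 indicE mem_set ?mulr1//; exact: dcube_idx.
- by move=> _ ->; exact: dcube_dyadic.
- move=> Q [/dyadicP[m ->] /= ne]; rewrite indicE memNset ?mulr0//.
  by move=> /dcubeP E; apply: ne; rewrite E.
Qed.

(** Only the cube containing [x] contributes to the sum over all cubes. *)
Lemma trace_approxE k (f : 'rV[R]_d.+1 -> R) x :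
  trace_approx k f x = average (nbd k (idx k x)) f.
Proof. by rewrite /trace_approx fsbig_dyadic. Qed.

Lemma esum_dyadic k (F : set 'rV[R]_d -> \bar R) :
  (\esum_(Q in dyadic (Posz k)) F Q = \esum_(m in [set: 'rV[int]_d]) F (dcube k m))%E.
Proof.
have -> : dyadic (Posz k) = [set @dcube R d k m | m in [set: 'rV[int]_d]].
  apply/seteqP; split => [Q /dyadicP[m ->]|_ [m _ <-]]; first by exists m.
  exact: dcube_dyadic.
by rewrite esum_image// => m m' _ _; exact: dcube_inj.
Qed.

(** The heights that occur in the reference boxes of level [k]. *)
Definition strip k : set 'rV[R]_d.+1 := [set y | side k / 4 <= height y <= 3 * side k].

Lemma measurable_strip k : measurable (strip k : set (lebesgueType R d.+1)).
Proof.
have := @measurable_height R d measurableT _ (measurable_itv `[(side k / 4), (3 * side k)]).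
by rewrite setTI; congr measurable; apply/seteqP; split => x; rewrite /strip/= in_itv.
Qed.

Lemma strip_halfspace k : strip k `<=` @halfspace R d.
Proof.
by move=> y /andP[h _]; rewrite /halfspace/=; apply: lt_le_trans h; rewrite divr_gt0// side_gt0.
Qed.

Lemma measurable_refbox k m : measurable (refbox k m : set (lebesgueType R d.+1)).
Proof. exact: borel_measurable_lebesgue (measurable_cbox _ _). Qed.

(** If [y] lies in the box of [m], each coordinate of [m] differs by at most 3 from
    that of the cube below [y]. *)
Lemma refbox_count k (y : 'rV[R]_d.+1) : (\esum_(m in [set: 'rV[int]_d]) ((\1_(refbox k m) y : R)%:E) <= ((7 ^+ d : R)%:E))%E.
Proof.
pose sh (a : {ffun 'I_d -> 'I_7}) : 'rV[int]_d := \row_i ((a i)%:Z - 3).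
have H m : ((\1_(refbox k m) y : R)%:E <= \sum_(a : {ffun 'I_d -> 'I_7})
    (if m == (idx k (rV_init y) - sh a)%R then 1 else 0))%E.
  rewrite indicE; have [yB|_] := boolP (y \in _); last first.
    by apply: sume_ge0 => a _; case: ifP.
  have [H _] := (refboxP k m y).1 (set_mem yB).
  have K i : (0 <= idx k (rV_init y) ord0 i - m ord0 i + 3 < 7)%R.
    have := H i; set t := rV_init y ord0 i => /andP[h1 h2].
    have k0 : 0 < 2 ^+ k :> R by rewrite exprn_gt0.
    have h3 : (m ord0 i)%:~R - 2 <= 2 ^+ k * t.
      by move: h1; rewrite /side mulrC ler_pdivrMr// mulrC.
    have h4 : 2 ^+ k * t <= (m ord0 i)%:~R + 3.
      by move: h2; rewrite /side [leRHS]mulrC ler_pdivlMr// mulrC.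
    have c1 : (Num.ceil (2 ^+ k * t) <= m ord0 i + 3)%R by rewrite ceil_le_int intrD.
    have c2 : (m ord0 i - 3 < Num.ceil (2 ^+ k * t))%R.
      by rewrite ceil_gt_int intrB; apply: lt_le_trans h3; lra.
    have -> : idx k (rV_init y) ord0 i = Num.ceil (2 ^+ k * t) - 1 by rewrite mxE.
    by move: (Num.ceil _) c1 c2 => c; lia.
  have Kn i : (absz (idx k (rV_init y) ord0 i - m ord0 i + 3)%R < 7)%N.
    by have := K i; move: (idx _ _ _ _) => c; lia.
  pose a0 : {ffun 'I_d -> 'I_7} := [ffun i => Ordinal (Kn i)].
  have E : m = idx k (rV_init y) - sh a0.
    have E0 (p q : 'rV[int]_d) i : (p - q) ord0 i = p ord0 i - q ord0 i by rewrite !mxE.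
    apply/rowP => i; have := K i; rewrite E0 [sh a0 _ _]mxE ffunE/=.
    by rewrite -[m 0 i]/(m ord0 i); move: (m ord0 i) (idx _ _ _ _) => b c; lia.
  rewrite (bigD1 a0)//= {1}E eqxx leeDl//.
  by apply: sume_ge0 => a _; case: ifP.
apply: (@le_trans _ _ (\esum_(m in [set: 'rV[int]_d]) \sum_(a : {ffun 'I_d -> 'I_7})
    (if m == (idx k (rV_init y) - sh a)%R then 1 else 0))%E).
  by apply: le_esum.
rewrite esum_sum; last by move=> m a _ _; case: ifP.
rewrite (eq_bigr (fun=> 1%E)) => [|a _].
  by rewrite sumEFin sumr_const card_ffun !card_ord natrX.
rewrite (esum_single (i0 := idx k (rV_init y) - sh a)) ?eqxx//.
by move=> m /negbTE ->.
Qed.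

Lemma esum_refbox k (H : 'rV[R]_d.+1 -> R) :
  measurable_fun (strip k : set (lebesgueType R d.+1)) H -> (forall y, 0 <= H y) ->
  (\esum_(m in [set: 'rV[int]_d]) \int[@leb R d.+1]_(y in refbox k m) (H y)%:E <=
    (7 ^+ d)%:E * \int[@leb R d.+1]_(y in strip k) (H y)%:E)%E.
Proof.
move=> mH H0.
have E m : (\int[@leb R d.+1]_(y in refbox k m) (H y)%:E =
    \int[@leb R d.+1]_(y in strip k) (H y * \1_(refbox k m) y)%:E)%E.
  have -> : refbox k m = strip k `&` refbox k m.
    by apply/esym/setIidPr => y /refboxP[].
  by rewrite integral_mkcondr epatch_indic; apply: eq_integral => y ys;
     rewrite /= !indicE in_setI ys.
under eq_esum do rewrite E.
have mS := measurable_strip k.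
have mHi m : measurable_fun (strip k : set (lebesgueType R d.+1))
   (fun y => (H y * \1_(refbox k m) y)%:E%E).
  apply/measurable_EFinP; apply: measurable_funM => //; apply: measurable_funTS.
  apply: measurable_indic; exact: measurable_refbox.
rewrite -integral_esum//; last by move=> m y _; rewrite lee_fin mulr_ge0.
rewrite -ge0_integralZl//; last 2 first.
- exact/measurable_EFinP.
- by move=> y _; rewrite lee_fin.
apply: ge0_le_integral; first exact: mS.
- by move=> y _; apply: esum_ge0 => m _; rewrite lee_fin mulr_ge0.
- by apply: measurable_esum => // m y _; rewrite lee_fin mulr_ge0.
- by apply: measurable_funeM; exact/measurable_EFinP.
- move=> y _; under eq_esum do rewrite EFinM.
  rewrite esumZl// muleC lee_wpmul2r ?lee_fin//; exact: refbox_count.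
Qed.

End step_functions.

(** * Averages over neighbouring Whitney neighbourhoods *)

Section whitney_estimate.
Context {R : realType} {d : nat}.
Local Notation side := (@side R).
Local Notation refbox_lo := (@refbox_lo R d).
Local Notation refbox_len := (@refbox_len R d).
Variables (f : 'rV[R]_d.+1 -> R) (g : 'rV[R]_d.+1 -> 'rV[R]_d.+1).
Local Notation H := (@halfspace R d).
Hypothesis lf : L1loc H f.
Hypothesis lg : forall i, L1loc H (fun y => g y ord0 i) /\ weak_partial H i f (fun y => g y ord0 i).

Definition gnorm y : R := enorm (g y).

Lemma measurable_gnorm : measurable_fun (H : set (lebesgueType R d.+1)) gnorm.
Proof.
apply: (@measurableT_comp _ _ _ _ _ _ (@Num.sqrt R)).
  exact: (continuous_measurable_fun (@sqrt_continuous R)).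
apply: (@measurable_sum _ (lebesgueType R d.+1) R H _ _ (fun (i : 'I_d.+1) (y : lebesgueType R d.+1) => g y ord0 i ^+ 2)) => i.
by apply: measurable_funX; have [[]] := lg i.
Qed.

Let fB k m : (@leb R d.+1).-integrable (refbox k m) (EFin \o f).
Proof. by apply: lf.2; [exact: compact_cbox|exact: refbox_halfspace]. Qed.

Let gB k m i : (@leb R d.+1).-integrable (refbox k m) (EFin \o (fun y => g y ord0 i)).
Proof. by apply: (lg i).1.2; [exact: compact_cbox|exact: refbox_halfspace]. Qed.

Lemma gnormB k m : (@leb R d.+1).-integrable (refbox k m) (EFin \o gnorm).
Proof.
have mB := @measurable_refbox R d k m.
apply: (@le_integrable _ _ _ _ _ mB _ (EFin \o (fun y => \sum_i `|g y ord0 i|))).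
- apply/measurable_EFinP; apply: measurable_funS measurable_gnorm => //.
    exact: measurable_halfspace.
  exact: refbox_halfspace.
- move=> y _ /=; rewrite lee_fin ger0_norm ?enorm_ge0// ger0_norm ?enorm_le_sum//.
  by apply: sumr_ge0.
- apply: (@integrable_Rsum _ _ _ _ _ mB _ _ _ (fun i y => `|g y ord0 i|)) => i _.
  by have := integrable_norm (gB k m i); apply: eq_integrable.
Qed.

Definition nbd_average k m : R := average (nbd k m) f.

(** The factors come from the volume of the box, its largest edge, the number of
    directions, and the two volumes by which the averages are divided. *)
Definition poincare_const : R := 6 ^+ d * 3 * 5 * (d.+1)%:R * 4 ^+ d.+1.

Lemma poincare_const_ge0 : 0 <= poincare_const.
Proof. by rewrite /poincare_const !mulr_ge0. Qed.

(** Divide [poincare_box] by the measures of the two neighbourhoods, which are at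
    least [(side k / 2) ^ (d + 1)]. *)
Lemma avg_diff k m k1 m1 k2 m2 :
  nbd k1 m1 `<=` obox (refbox_lo k m) (refbox_lo k m + refbox_len k) ->
  nbd k2 m2 `<=` obox (refbox_lo k m) (refbox_lo k m + refbox_len k) ->
  (side k / 2 <= side k1) -> side k / 2 <= side k2 ->
  side k ^+ d * `|nbd_average k1 m1 - nbd_average k2 m2| <= poincare_const * \int[@leb R d.+1]_(y in refbox k m) gnorm y.
Proof.
move=> s1 s2 le1 le2; have s0 := side_gt0 (R := R) k.
have fin k' m' : nbd k' m' `<=` obox (refbox_lo k m) (refbox_lo k m + refbox_len k) -> side k / 2 <= side k' ->
    exists2 al, (side k / 2) ^+ d.+1 <= al & @leb R d.+1 (nbd k' m') = al%:E.
  move=> sub le; have le_box : (@leb R d.+1 (nbd k' m') <= ((6 ^+ d * 3) * side k ^+ d.+1)%:E)%E.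
    apply: le_trans (leb_refbox k m); apply: le_measure; rewrite ?inE.
    - exact: measurable_nbd.
    - exact: measurable_refbox.
    - by move=> y /sub yb i; have /andP[/ltW -> /ltW ->] := yb i.
  have ge_cube := leb_nbd_ge (R := R) k' m'.
  have fn : @leb R d.+1 (nbd k' m') \is a fin_num.
    by rewrite ge0_fin_numE ?measure_ge0//; apply: le_lt_trans le_box _; exact: ltry.
  exists (fine (@leb R d.+1 (nbd k' m'))); last by rewrite fineK.
  rewrite -lee_fin fineK//; apply: le_trans ge_cube.
  by rewrite lee_fin lerXn2r// ?nnegrE ?ltW ?side_gt0// divr_gt0.
have [al1 al1s E1] := fin _ _ s1 le1; have [al2 al2s E2] := fin _ _ s2 le2.
have P := poincare_box (@refbox_len_gt0 R d k) (@refbox_halfspace R d k m) (fB k m) (gB k m)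
  (fun i => (lg i).2) (@nbd_open R d k1 m1) s1 (@nbd_open R d k2 m2) s2.
pose Ga := \int[@leb R d.+1]_(y in refbox k m) gnorm y; rewrite -/Ga.
have Ga0 : 0 <= Ga by apply: Rintegral_ge0 => y _; exact: enorm_ge0.
have hs : 0 < (side k / 2) ^+ d.+1 by rewrite exprn_gt0// divr_gt0.
have a1 : 0 < al1 by exact: lt_le_trans al1s.
have a2 : 0 < al2 by exact: lt_le_trans al2s.
have {}P : `|al2 * al1 * (nbd_average k1 m1 - nbd_average k2 m2)| <=
    (6 ^+ d * 3 * side k ^+ d.+1) * ((d.+1)%:R * (5 * side k * Ga)).
  have -> : al2 * al1 * (nbd_average k1 m1 - nbd_average k2 m2) =
    al2 * \int[@leb R d.+1]_(y in nbd k1 m1) f y - al1 * \int[@leb R d.+1]_(y in nbd k2 m2) f y.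
    rewrite /nbd_average /average E1 E2/= mulrBr mulrA mulfK ?gt_eqF//.
    by rewrite [al2 * al1]mulrC mulrA mulfK ?gt_eqF.
  move: P; rewrite E1 E2 => /le_trans; apply.
  apply: ler_pM.
  - by rewrite fine_ge0.
  - apply: sumr_ge0 => i _; rewrite mulr_ge0//; first exact/ltW/refbox_len_gt0.
    exact: Rintegral_ge0.
  - rewrite -lee_fin fineK; first exact: leb_refbox.
    rewrite ge0_fin_numE ?measure_ge0//; apply: le_lt_trans (leb_refbox k m) _; exact: ltry.
  - rewrite mulr_natl -[X in _ *+ X](card_ord d.+1) -sumr_const; apply: ler_sum => i _.
    apply: ler_pM.
    + exact/ltW/refbox_len_gt0.
    + exact: Rintegral_ge0.
    + by rewrite mxE; case: unliftP => [j _|_] /=; rewrite ?mxE; lra.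
    + apply: le_Rintegral.
      * exact: measurable_refbox.
      * by have := integrable_norm (gB k m i); apply: eq_integrable => //; exact: measurable_refbox.
      * exact: gnormB.
      * by move=> y _; exact: enorm_ge_coord.
move: P; rewrite normrM ger0_norm; last by rewrite ltW// mulr_gt0.
set D := `|_|; have D0 : 0 <= D by exact: normr_ge0.
move=> P.
have {}P : (side k / 2) ^+ d.+1 * (side k / 2) ^+ d.+1 * D <=
    (6 ^+ d * 3 * side k ^+ d.+1) * ((d.+1)%:R * (5 * side k * Ga)).
  apply: le_trans P; rewrite ler_wpM2r// ler_pM// ltW//.
have E : (side k / 2) ^+ d.+1 * (side k / 2) ^+ d.+1 * D =
   (side k ^+ d.+1 * side k) * (4 ^- d.+1 * (side k ^+ d * D)).
  rewrite -exprMn (_ : side k / 2 * (side k / 2) = side k * side k / 4); last by field.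
  by rewrite -exprVn !exprMn; move: (4^-1 ^+ d.+1) => q; rewrite exprS; ring.
rewrite E in P.
rewrite -(ler_pM2l (_ : 0 < (side k ^+ d.+1 * side k) * 4 ^- d.+1)); last first.
  by rewrite !mulr_gt0// ?invr_gt0 ?exprn_gt0.
rewrite -[leLHS]mulrA; apply: (le_trans P).
rewrite /poincare_const le_eqVlt; apply/orP; left; apply/eqP.
have f4 : (4 : R) ^+ d.+1 != 0 by rewrite expf_neq0.
by field.
Qed.

Lemma avg_diff_E k m k1 m1 k2 m2 :
  nbd k1 m1 `<=` obox (refbox_lo k m) (refbox_lo k m + refbox_len k) ->
  nbd k2 m2 `<=` obox (refbox_lo k m) (refbox_lo k m + refbox_len k) ->
  (side k / 2 <= side k1) -> side k / 2 <= side k2 ->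
  ((side k ^+ d * `|nbd_average k1 m1 - nbd_average k2 m2|)%:E <=
   poincare_const%:E * \int[@leb R d.+1]_(y in refbox k m) (gnorm y)%:E)%E.
Proof.
move=> s1 s2 l1 l2.
rewrite -(fineK (integrable_fin_num (measurable_refbox k m) (gnormB k m))) -EFinM lee_fin.
exact: avg_diff.
Qed.

Definition stripint k : \bar R := \int[@leb R d.+1]_(y in strip k) (gnorm y)%:E.

Lemma stripint_ge0 k : (0 <= stripint k)%E.
Proof. by apply: integral_ge0 => y _; rewrite lee_fin enorm_ge0. Qed.

Lemma esum_gnorm k :
  (\esum_(m in [set: 'rV[int]_d]) \int[@leb R d.+1]_(y in refbox k m) (gnorm y)%:E <=
    (7 ^+ d)%:E * stripint k)%E.
Proof.
apply: esum_refbox; last by move=> y; exact: enorm_ge0.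
apply: measurable_funS measurable_gnorm; last exact: strip_halfspace.
exact: measurable_halfspace.
Qed.

Definition strip_const : R := poincare_const * 7 ^+ d.
Lemma strip_const_ge0 : 0 <= strip_const. Proof. by rewrite mulr_ge0 ?poincare_const_ge0 ?exprn_ge0. Qed.

Lemma esum_poincare k :
  (\esum_(m in [set: 'rV[int]_d]) (poincare_const%:E * \int[@leb R d.+1]_(y in refbox k m) (gnorm y)%:E) <=
    strip_const%:E * stripint k)%E.
Proof.
rewrite esumZl ?poincare_const_ge0//; last first.
  by move=> m; apply: integral_ge0 => y _; rewrite lee_fin enorm_ge0.
have -> : strip_const%:E = (poincare_const%:E * (7 ^+ d)%:E)%E by rewrite -EFinM.
rewrite -muleA; apply: lee_wpmul2l; first by rewrite lee_fin poincare_const_ge0.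
exact: esum_gnorm.
Qed.

Lemma esum_same_scale k e : unit_shift e ->
  (\esum_(m in [set: 'rV[int]_d]) (side k ^+ d * `|nbd_average k (m + e) - nbd_average k m|)%:E <=
   strip_const%:E * stripint k)%E.
Proof.
move=> ue; apply: le_trans (esum_poincare k); apply: le_esum => m _.
have s0 := side_gt0 (R := R) k.
apply: avg_diff_E; try lra; first exact: nbd_sub_same.
by rewrite -[X in nbd _ X]addr0; apply: nbd_sub_same => i; rewrite mxE.
Qed.

Definition Tk k (x : 'rV[R]_d) : R := nbd_average k (idx k x).

Lemma measurable_Tk k : measurable_fun setT (Tk k : lebesgueType R d -> R).
Proof. exact: (@measurable_step R d k _ R (nbd_average k)). Qed.

(** The cube of level [k.+1] containing [x] is a child of the one of level [k]. *)
Lemma int_Tk_step k :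
  (\int[@leb R d]_x `|Tk k.+1 x - Tk k x|%:E <= strip_const%:E * stripint k)%E.
Proof.
have s0 := side_gt0 (R := R) k.
pose F m : \bar R := (((side k ^+ d)^-1)%:E *
   (poincare_const%:E * \int[@leb R d.+1]_(y in refbox k m) (gnorm y)%:E))%E.
have F0 m : (0 <= F m)%E.
  rewrite /F mule_ge0 ?lee_fin ?invr_ge0 ?exprn_ge0 ?(ltW s0)//.
  by rewrite mule_ge0 ?lee_fin ?poincare_const_ge0//; apply: integral_ge0 => y _; rewrite lee_fin enorm_ge0.
apply: (@le_trans _ _ (\int[@leb R d]_x F (idx k x))%E).
  apply: ge0_le_integral.
  - exact: measurableT.
  - by move=> x _; rewrite lee_fin.
  - apply/measurable_EFinP; apply: (measurableT_comp (@normr_measurable R setT)).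
    by apply: measurable_funB; exact: measurable_Tk.
  - exact: measurable_step.
  - move=> x _; rewrite /F.
    have -> : `|Tk k.+1 x - Tk k x|%:E =
        ((side k ^- d)%:E * (side k ^+ d * `|Tk k.+1 x - Tk k x|)%:E)%E.
      by rewrite -EFinM mulrA mulVf ?mul1r// expf_neq0// gt_eqF.
    apply: lee_wpmul2l; first by rewrite lee_fin invr_ge0 exprn_ge0// ltW.
    apply: avg_diff_E.
    + apply: nbd_sub_child; apply: (@dcube_nest R d k k.+1 _ _ x) => //; exact: dcube_idx.
    + by rewrite -[X in nbd _ X]addr0; apply: nbd_sub_same => i; rewrite mxE.
    + by rewrite side_S.
    + lra.
rewrite int_step//; apply: le_trans (esum_poincare k); apply: le_esum => m _.
by rewrite /F muleA -EFinM mulfV ?mul1e// expf_neq0// gt_eqF.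
Qed.

End whitney_estimate.

(** * Series, their tails, and the size of the weight *)

Section tails.
Context {R : realType}.

(** The sum of [u l] over [l >= k], as a sum over all [l], so that tails are exchanged
    with other sums and with integrals without change of range. *)
Definition tail (k : nat) (u : nat -> \bar R) : \bar R :=
  (\sum_(0 <= l <oo) (if (k <= l)%N then u l else 0))%E.

Lemma tail_ge0 k u : (forall l, 0 <= u l)%E -> (0 <= tail k u)%E.
Proof. by move=> u0; apply: nneseries_ge0 => l _ _; case: ifP. Qed.

Lemma tail_le k k' u : (forall l, 0 <= u l)%E -> (k <= k')%N -> (tail k' u <= tail k u)%E.
Proof.
move=> u0 kk; apply: lee_nneseries => l _; first by case: ifP.
by case: ifP => // kl; [rewrite (leq_trans kk kl)|case: ifP].
Qed.

Lemma tail_term k u : (forall l, 0 <= u l)%E -> (u k <= tail k u)%E.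
Proof.
move=> u0; apply: (@le_trans _ _ (\sum_(0 <= l < k.+1) (if (k <= l)%N then u l else 0))%E).
  rewrite big_nat_recr//= leqnn leeDr// sume_ge0// => l _; by case: ifP.
by apply: nneseries_lim_ge => l _; case: ifP.
Qed.

Lemma tail_partial k n (u : nat -> R) : (forall l, 0 <= u l) ->
  ((\sum_(k <= l < n) u l)%:E <= tail k (fun l => (u l)%:E))%E.
Proof.
move=> u0; have [nk|kn] := leqP n k.
  by rewrite big_geq//; apply: tail_ge0 => l; rewrite lee_fin.
apply: (@le_trans _ _ (\sum_(0 <= l < n) (if (k <= l)%N then (u l)%:E else 0))%E); last first.
  by apply: nneseries_lim_ge => l _; case: ifP => _; rewrite ?lee_fin.
rewrite (@big_cat_nat _ _ _ k 0 n)/= ?(ltnW kn)// [X in (_ <= X + _)%E]big_nat_cond.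
rewrite [X in (_ <= X + _)%E]big1 ?add0e; last first.
  by move=> l /andP[/andP[_ lk] _]; rewrite leqNgt lk.
rewrite -sumEFin le_eqVlt; apply/orP; left; apply/eqP; apply: eq_big_nat => l /andP[kl _]; by rewrite kl.
Qed.

Lemma tail_split k (u : nat -> R) : (forall l, 0 <= u l) ->
  (tail k (fun l => (u l)%:E) < +oo)%E -> (\sum_(0 <= l <oo) (u l)%:E < +oo)%E.
Proof.
move=> u0 H.
have -> : (\sum_(0 <= l <oo) (u l)%:E =
   \sum_(0 <= l <oo) (if (l < k)%N then (u l)%:E else 0) + tail k (fun l => (u l)%:E))%E.
  rewrite -nneseriesD; last 2 first.
  - by move=> l _; case: ifP; rewrite ?lee_fin.
  - by move=> l _; case: ifP; rewrite ?lee_fin.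
  by apply: eq_eseriesr => l _; case: (ltnP l k) => _; rewrite ?adde0 ?add0e.
apply: lte_add_pinfty => //.
rewrite (nneseries_split 0 k); last by move=> l _; case: ifP; rewrite ?lee_fin.
rewrite add0n eseries0 ?adde0; last by move=> l /[!ltnNge] ->.
apply: lte_sum_pinfty => l _; case: ifP => _; exact: ltry.
Qed.

Lemma bounded_variation (a : nat -> R) :
  (\sum_(0 <= l <oo) (`|a l.+1 - a l|)%:E < +oo)%E -> cvgn a.
Proof.
move=> H; pose u l := a l.+1 - a l.
have cs : cvgn (fun n => \sum_(0 <= i < n) `|u i| : R).
  apply: nondecreasing_is_cvgn.
    by apply/nondecreasing_seqP => n; rewrite big_nat_recr//= lerDl.
  exists (fine (\sum_(0 <= l <oo) (`|a l.+1 - a l|)%:E)) => _ [n _ <-].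
  rewrite -lee_fin fineK; last by rewrite ge0_fin_numE ?H//; apply: nneseries_ge0 => l _ _; rewrite lee_fin.
  by rewrite -sumEFin; apply: nneseries_lim_ge => l _; rewrite lee_fin.
have /cvg_ex[l ul] := normed_cvg cs.
have -> : a = (fun n => series u n + a 0%N).
  by apply/funext => n; rewrite /series/= telescope_sumr// subrK.
by apply/cvg_ex; exists (l + a 0%N); apply: cvgD => //; exact: cvg_cst.
Qed.

(** The value 0 where the variation is infinite makes the limit a measurable function
    of parameters, and leaves [bvlim_tail] true everywhere. *)
Definition bvlim (a : nat -> R) : R :=
  if (\sum_(0 <= l <oo) (`|a l.+1 - a l|)%:E < +oo)%E then limn a else 0.

Lemma bvlim_tail (a : nat -> R) k :
  (`|bvlim a - a k|%:E <= tail k (fun l => (`|a l.+1 - a l|)%:E))%E.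
Proof.
set T := tail _ _.
have [->|Tlt] := eqVneq T +oo%E; first exact: leey.
have {}Tlt : (T < +oo)%E by rewrite ltey.
have V := tail_split (fun l => normr_ge0 _) Tlt.
rewrite /bvlim V; have ca := bounded_variation V.
have T0 : T \is a fin_num by rewrite ge0_fin_numE// tail_ge0// => l; rewrite lee_fin.
rewrite -(fineK T0) lee_fin.
have H : `|a n - a k| @[n --> \oo] --> `|limn a - a k|.
  by apply: cvg_norm; apply: cvgB => //; exact: cvg_cst.
apply: (cvgr_to_le H); near=> n.
rewrite -lee_fin fineK//; apply: le_trans (tail_partial k n (fun l => normr_ge0 _)).
have kn : (k <= n)%N by near: n; exact: nbhs_infty_ge.
by rewrite lee_fin -(telescope_sumr _ kn) ler_norm_sum.
Unshelve. all: by end_near. Qed.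

Lemma tail_exchange (c : nat -> R) (K : nat -> nat) (u : nat -> \bar R) :
  (forall j, 0 <= c j) -> (forall l, 0 <= u l)%E ->
  (\sum_(0 <= j <oo) ((c j)%:E * tail (K j) u) =
   \sum_(0 <= l <oo) (\sum_(0 <= j <oo) (if (K j <= l)%N then c j else 0)%:E * u l))%E.
Proof.
move=> c0 u0.
transitivity (\sum_(0 <= j <oo) \sum_(0 <= l <oo) ((if (K j <= l)%N then c j else 0)%:E * u l))%E.
  apply: eq_eseriesr => j _; rewrite /tail -nneseriesZl; last by move=> l _; case: ifP.
  by apply: eq_eseriesr => l _; case: ifP => _; rewrite ?mule0 ?mul0e.
rewrite nneseries_interchange; last first.
  by move=> j l; rewrite mule_ge0// lee_fin; case: ifP.
by [].
Qed.

End tails.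

Section weights.
Context {R : realType} {d : nat}.
Local Notation side := (@side R).
Local Notation H := (@halfspace R d).
Variable lambda : R.
Hypothesis l0 : 0 < lambda.

Lemma wmeasure_integral (F : 'rV[R]_d.+1 -> R) :
  measurable_fun (H : set (lebesgueType R d.+1)) F -> (forall y, 0 <= F y) ->
  (\int[@wmeasure R d lambda]_(y in H) (F y)%:E =
   \int[@leb R d.+1]_(y in H) (F y * ((ln 4 `^ lambda)^-1 * weight lambda y))%:E)%E.
Proof.
move=> mF F0.
have mH := @measurable_halfspace R d.
have mw := @measurable_weight R d lambda.
have c0 : 0 <= (ln 4 `^ lambda)^-1 :> R by rewrite invr_ge0 powR_ge0.
rewrite (@density_integral R _ _ (@leb R d.+1) (@wmeasure R d lambda) H
  (fun y => (ln 4 `^ lambda)^-1 * weight lambda y) mH).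
- by apply: eq_integral => y _; rewrite EFinM.
- by apply: measurable_funM => //; exact: measurable_cst.
- by move=> y; rewrite mulr_ge0// weight_ge0.
- move=> A mA; rewrite -[LHS]/(_ * _)%E; under eq_integral do rewrite EFinM; rewrite ge0_integralZl//.
  + exact: measurableI.
  + apply/measurable_EFinP; apply: measurable_funS mw => //; exact: subIsetr.
  + by move=> y _; rewrite lee_fin weight_ge0.
- exact/measurable_EFinP.
- by move=> y _; rewrite lee_fin.
Qed.

Lemma ln2_gt0 : 0 < ln 2 :> R. Proof. by rewrite ln_gt0// ltr1n. Qed.
Lemma ln4E : ln 4 = 2 * ln 2 :> R.
Proof.
have -> : (4 : R) = 2 * 2 by lra.
by rewrite lnM ?posrE//; lra.
Qed.

(** The logarithm whose power is the weight. *)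
Definition wbase (y : 'rV[R]_d.+1) : R := if height y <= 1 then ln (4 / height y) else ln 4.

Lemma weightE y : H y -> weight lambda y = wbase y `^ lambda.
Proof. by rewrite /halfspace/= => y0; rewrite /weight /wbase gtr0_norm//; case: ifP. Qed.

Lemma wbase_ge y : H y -> ln 4 <= wbase y.
Proof.
rewrite /halfspace/= => y0; rewrite /wbase; case: ifP => // y1.
by rewrite ler_ln ?posrE ?divr_gt0// ler_pdivlMr// ger_pMr.
Qed.

Lemma weight_ge y : H y -> ln 4 `^ lambda <= weight lambda y.
Proof.
move=> Hy; have L4 : 0 <= ln 4 :> R by rewrite ln4E mulr_ge0// ltW// ln2_gt0.
rewrite weightE//; apply: ge0_ler_powR; rewrite ?nnegrE//.
- exact: ltW.
- exact: le_trans (wbase_ge Hy).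
- exact: wbase_ge.
Qed.

(** On the strip the height is at most [3 * 2 ^- l], so the logarithm grows linearly
    in [l]; small [l] are covered by the lower bound [ln 4]. *)
Lemma strip_wbase l (y : 'rV[R]_d.+1) : strip l y -> l.+1%:R * (ln 2 / 2) <= wbase y.
Proof.
move=> ys; have Hy := strip_halfspace ys.
have L := ln2_gt0; have W := wbase_ge Hy; rewrite ln4E in W.
move: ys => /andP[_ h3].
have y0 : 0 < height y by [].
have [l3|l3] := leqP l 3.
  apply: le_trans W; have : (l.+1)%:R <= 4 :> R by rewrite ler_nat.
  nra.
have hl : height y * 2 ^+ l <= 3.
  by move: h3; rewrite /side ler_pdivlMr ?exprn_gt0.
have p16 : 16 <= 2 ^+ l :> R.
  rewrite -[16]/((2 ^ 4)%N%:R) -natrX ler_nat leq_exp2l//.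
have y1 : height y <= 1 by nra.
rewrite /wbase y1.
apply: (@le_trans _ _ (ln (2 ^+ l))); last first.
  rewrite ler_ln ?posrE ?divr_gt0 ?exprn_gt0// ler_pdivlMr//; lra.
rewrite lnXn// -mulr_natl -natr1.
have : 1 <= l%:R :> R by rewrite ler1n; lia.
nra.
Qed.

Definition wconst : R := (2 / ln 2) `^ lambda.

Lemma strip_weight l (y : 'rV[R]_d.+1) : strip l y -> l.+1%:R `^ lambda <= wconst * weight lambda y.
Proof.
move=> ys; have Hy := strip_halfspace ys; have L := ln2_gt0.
have W0 : 0 <= wbase y by apply: le_trans (wbase_ge Hy); rewrite ln4E mulr_ge0// ltW.
rewrite weightE// /wconst -powRM//; last by rewrite divr_ge0// ltW.
apply: ge0_ler_powR; rewrite ?nnegrE//.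
- exact: ltW.
- by rewrite mulr_ge0// divr_ge0// ltW.
have := strip_wbase ys; rewrite mulrAC ler_pdivlMr//; lra.
Qed.

(** Two strips more than three levels apart are disjoint, since
    [3 * 2 ^- (m + 4) < 2 ^- m / 4]. *)
Lemma strip_count (y : 'rV[R]_d.+1) : (\sum_(0 <= l <oo) ((\1_(strip l) y : R)%:E) <= 4%:E)%E.
Proof.
apply: lime_le; first by apply: is_cvg_nneseries => l _ _; rewrite lee_fin.
apply: nearW => n.
have -> : (\sum_(0 <= l < n) ((\1_(strip l) y : R)%:E) =
    (count (fun l => y \in @strip R d l) (iota 0 n))%:R%:E)%E.
  rewrite sumEFin; congr EFin; rewrite /index_iota subn0.
  elim: (iota 0 n) => [|l s IH]; first by rewrite big_nil.
  by rewrite big_cons /= IH indicE natrD.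
rewrite lee_fin ler_nat -size_filter.
have [E|] := eqVneq ([seq l <- iota 0 n | y \in @strip R d l]) [::]; first by rewrite E.
rewrite -has_filter => /hasP[l1 l1n yl1].
have ex : exists l, y \in @strip R d l by exists l1.
(* lm is the first strip containing y; the others are among the next three *)
pose lm := ex_minn ex.
suff sub : {subset [seq l <- iota 0 n | y \in @strip R d l] <= iota lm 4}.
  by rewrite -(size_iota lm 4); apply: uniq_leq_size => //; apply: filter_uniq; exact: iota_uniq.
move=> l; rewrite mem_filter => /andP[yl _]; rewrite mem_iota /lm.
case: ex_minnP => m ym minm; rewrite minm//= ltnNge; apply/negP => ml.
have /andP[h1 _] := set_mem yl; have /andP[_ h2] := set_mem ym.
have sm := side_gt0 (R := R) m.
suff : 3 * side l < side m / 4 by have := set_mem yl; have := set_mem ym => /andP[a1 a2] /andP[b1 b2]; lra.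
have -> : side l = side m / 2 ^+ (l - m).
  by rewrite /side -invfM -exprD subnKC//; apply: leq_trans ml; exact: leq_addr.
have p16 : 16 <= 2 ^+ (l - m) :> R.
  rewrite -[16]/((2 ^ 4)%N%:R) -natrX ler_nat leq_exp2l//; lia.
rewrite mulrA ltr_pdivrMr ?exprn_gt0//; nra.
Qed.

End weights.

(** * The trace of a Sobolev function *)

Section real_integrals.
Context {R : realType} {d0 : measure_display} {T : measurableType d0}.
Variables (mu : {measure set T -> \bar R}) (D : set T).
Hypothesis mD : measurable D.
Implicit Types F G K : T -> R.

Lemma nn_int_le F G : measurable_fun D F -> measurable_fun D G ->
  (forall x, D x -> 0 <= F x) -> (forall x, D x -> F x <= G x) ->
  (\int[mu]_(x in D) (F x)%:E <= \int[mu]_(x in D) (G x)%:E)%E.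
Proof.
move=> mF mG F0 FG; apply: ge0_le_integral => //.
- exact/measurable_EFinP.
- exact/measurable_EFinP.
Qed.

Lemma nn_int_scale c F : measurable_fun D F -> (forall x, D x -> 0 <= F x) -> 0 <= c ->
  (\int[mu]_(x in D) (c * F x)%:E = c%:E * \int[mu]_(x in D) (F x)%:E)%E.
Proof.
move=> mF F0 c0; rewrite -ge0_integralZl//; exact/measurable_EFinP.
Qed.

Lemma nn_int_add F G : measurable_fun D F -> measurable_fun D G ->
  (forall x, D x -> 0 <= F x) -> (forall x, D x -> 0 <= G x) ->
  (\int[mu]_(x in D) (F x + G x)%:E = \int[mu]_(x in D) (F x)%:E + \int[mu]_(x in D) (G x)%:E)%E.
Proof.
move=> mF mG F0 G0; rewrite -ge0_integralD//; exact/measurable_EFinP.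
Qed.

Lemma measurable_dist F G : measurable_fun D F -> measurable_fun D G ->
  measurable_fun D (fun x => `|F x - G x|).
Proof. by move=> mF mG; apply: measurableT_comp => //; exact: measurable_funB. Qed.

Lemma int_triangle F G K : measurable_fun D F -> measurable_fun D G -> measurable_fun D K ->
  (\int[mu]_(x in D) `|F x - K x|%:E <=
   \int[mu]_(x in D) `|F x - G x|%:E + \int[mu]_(x in D) `|G x - K x|%:E)%E.
Proof.
move=> mF mG mK.
have m1 := measurable_dist mF mG; have m2 := measurable_dist mG mK.
rewrite -nn_int_add//; apply: nn_int_le => //; first exact: measurable_dist.
- exact: measurable_funD.
- by move=> x _; exact: ler_distD.
Qed.

Lemma int_dist_sym F G :
  (\int[mu]_(x in D) `|F x - G x|%:E = \int[mu]_(x in D) `|G x - F x|%:E)%E.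
Proof. by apply: eq_integral => x _; rewrite distrC. Qed.

Lemma measurable_lt_pinfty (V : T -> \bar R) : measurable_fun D V ->
  measurable_fun D (fun x => (V x < +oo)%E).
Proof. by move=> mV; apply: measurable_fun_lte => //; exact: measurable_cst. Qed.

End real_integrals.

Section trace_limit.
Context {R : realType} {d : nat}.
Local Notation side := (@side R).
Variables (f : 'rV[R]_d.+1 -> R) (g : 'rV[R]_d.+1 -> 'rV[R]_d.+1) (lambda : R).
Local Notation H := (@halfspace R d).
Hypothesis l0 : 0 < lambda.
Hypothesis lf : L1loc H f.
Hypothesis lg : forall i, L1loc H (fun y => g y ord0 i) /\ weak_partial H i f (fun y => g y ord0 i).
Hypothesis fin : (\int[wmeasure lambda]_(y in H) `|f y|%:E +
   \int[wmeasure lambda]_(y in H) (enorm (g y))%:E < +oo)%E.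

Local Notation w := (weight lambda).
Local Notation S := (stripint g).

(** Sum over the strips: the weight is at least a constant times [(l+1) ^ lambda] on the
    [l]-th one, and a point lies in at most four of them. *)
Lemma stripint_wsum :
  (\sum_(0 <= l <oo) ((l.+1%:R `^ lambda)%:E * S l) <=
   (4 * wconst lambda)%:E * \int[@leb R d.+1]_(y in H) (gnorm g y * w y)%:E)%E.
Proof.
have mH := @measurable_halfspace R d.
have mg := measurable_gnorm lg.
have mw := @measurable_weight R d lambda.
have wc0 : 0 <= wconst lambda :> R by exact: powR_ge0.
have g0 y : 0 <= gnorm g y by exact: enorm_ge0.
pose W (y : 'rV[R]_d.+1) := gnorm g y * w y.
have W0 y : 0 <= W y by rewrite mulr_ge0// weight_ge0.
have mW : measurable_fun (H : set (lebesgueType R d.+1)) W by exact: measurable_funM mg mw.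
have mstr l : measurable_fun (H : set (lebesgueType R d.+1)) (\1_(strip l) : 'rV[R]_d.+1 -> R).
  by apply: measurable_funTS; apply: measurable_indic; exact: measurable_strip.
apply: (@le_trans _ _ (\sum_(0 <= l <oo)
   \int[@leb R d.+1]_(y in H) ((wconst lambda * W y)%:E * (\1_(strip l) y)%:E))%E).
  apply: lee_nneseries => [l _ _|l _].
    by rewrite mule_ge0 ?lee_fin ?powR_ge0//; exact: stripint_ge0.
  have mS := measurable_strip (R := R) (d := d) l.
  have SH := @strip_halfspace R d l.
  have mgS : measurable_fun (strip l : set (lebesgueType R d.+1)) (gnorm g) by exact: measurable_funS mg.
  rewrite /stripint -(nn_int_scale _ mS mgS (fun y _ => g0 y) (powR_ge0 _ _)).
  have -> : (strip l : set 'rV[R]_d.+1) = H `&` strip l by apply/esym/setIidPr.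
  have mHS : measurable (H `&` strip l : set (lebesgueType R d.+1)) by exact: measurableI.
  apply: (@le_trans _ _ (\int[@leb R d.+1]_(y in H `&` strip l) (wconst lambda * W y)%:E)%E).
    apply: nn_int_le.
    - exact: mHS.
    - apply: measurable_funM; [exact: measurable_cst|].
      by apply: measurable_funS mg; [exact: mH|exact: subIsetl].
    - apply: measurable_funM; first exact: measurable_cst.
      by apply: measurable_funS mW; [exact: mH|exact: subIsetl].
    - by move=> y _; rewrite mulr_ge0// powR_ge0.
    - move=> y [_ ys]; rewrite /W mulrC.
      by rewrite mulrCA; apply: ler_wpM2l => //; exact: strip_weight.
  rewrite integral_mkcondr epatch_indic [X in (_ <= X)%E](eq_integral
    (fun y : lebesgueType R d.+1 => (wconst lambda * W y)%:E * (\1_(strip l) y)%:E)%E)//.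
  by move=> y yH; rewrite !indicE in_setI yH.
rewrite -integral_nneseries; first last.
- by move=> l y _; rewrite mule_ge0// lee_fin// mulr_ge0.
- move=> l; apply: emeasurable_funM; apply/measurable_EFinP; last exact: mstr.
  by apply: measurable_funM; [exact: measurable_cst|exact: mW].
- exact: mH.
rewrite -(nn_int_scale _ mH mW (fun y _ => W0 y) (mulr_ge0 (ler0n _ 4) wc0)).
apply: ge0_le_integral.
- exact: mH.
- by move=> y _; apply: nneseries_ge0 => l _ _; rewrite mule_ge0// lee_fin// mulr_ge0.
- apply: ge0_emeasurable_sum => l; first by move=> y _ _; rewrite mule_ge0// lee_fin// mulr_ge0.
  move=> _; apply: emeasurable_funM; apply/measurable_EFinP; last exact: mstr.
  by apply: measurable_funM; [exact: measurable_cst|exact: mW].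
- apply/measurable_EFinP; apply: measurable_funM; [exact: measurable_cst|exact: mW].
- move=> y _; rewrite nneseriesZl; last by move=> l _; rewrite lee_fin.
  have -> : 4 * wconst lambda * (gnorm g y * w y) = wconst lambda * W y * 4 by rewrite /W; ring.
  rewrite [(_ * 4)%:E]EFinM.
  by apply: lee_wpmul2l; [rewrite lee_fin mulr_ge0//; exact: W0|exact: strip_count].
Qed.

Lemma sobolev_int_lt (F : 'rV[R]_d.+1 -> R) :
  measurable_fun (H : set (lebesgueType R d.+1)) F -> (forall y, 0 <= F y) ->
  (\int[wmeasure lambda]_(y in H) (F y)%:E < +oo)%E ->
  (\int[@leb R d.+1]_(y in H) (F y * w y)%:E < +oo)%E.
Proof.
move=> mF F0; rewrite wmeasure_integral//.
have mH := @measurable_halfspace R d.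
have mw := @measurable_weight R d lambda.
have L : 0 < ln 4 `^ lambda :> R by rewrite powR_gt0// ln4E mulr_gt0// ln2_gt0.
have -> : (\int[@leb R d.+1]_(y in H) (F y * w y)%:E =
  (ln 4 `^ lambda)%:E * \int[@leb R d.+1]_(y in H) (F y * ((ln 4 `^ lambda)^-1 * w y))%:E)%E.
  rewrite -ge0_integralZl; first last.
  - by rewrite lee_fin ltW.
  - by move=> y _; rewrite lee_fin mulr_ge0// mulr_ge0 ?weight_ge0// invr_ge0 ltW.
  - apply/measurable_EFinP; apply: measurable_funM; first exact: mF.
    by apply: measurable_funM; [exact: measurable_cst|exact: mw].
  - exact: mH.
  - by apply: eq_integral => y _; rewrite -EFinM mulrCA mulVKf ?gt_eqF.
by move=> h; apply: lte_mul_pinfty => //; rewrite lee_fin ltW.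
Qed.

Lemma fin_f : (\int[wmeasure lambda]_(y in H) `|f y|%:E < +oo)%E.
Proof.
apply: le_lt_trans fin; apply: leeDl; apply: integral_ge0 => y _; rewrite lee_fin; exact: enorm_ge0.
Qed.

Lemma fin_g : (\int[wmeasure lambda]_(y in H) (enorm (g y))%:E < +oo)%E.
Proof. by apply: le_lt_trans fin; apply: leeDr; apply: integral_ge0 => y _; rewrite lee_fin. Qed.

Lemma stripint_wsum_fin : (\sum_(0 <= l <oo) ((l.+1%:R `^ lambda)%:E * S l) < +oo)%E.
Proof.
apply: le_lt_trans stripint_wsum _.
apply: lte_mul_pinfty => //; first by rewrite lee_fin mulr_ge0// powR_ge0.
apply: sobolev_int_lt fin_g; first exact: measurable_gnorm.
by move=> y; exact: enorm_ge0.
Qed.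

Lemma stripint_sum_fin : (\sum_(0 <= l <oo) S l < +oo)%E.
Proof.
apply: le_lt_trans stripint_wsum_fin.
apply: lee_nneseries => [l _ _|l _].
  exact: stripint_ge0.
apply: lee_pemull; first exact: stripint_ge0.
rewrite lee_fin -[X in X <= _](_ : 1 `^ lambda = 1); last by rewrite powR1.
apply: ge0_ler_powR; rewrite ?nnegrE//.
  exact: ltW.
by rewrite ler1n.
Qed.

Lemma f_int_fin : (\int[@leb R d.+1]_(y in H) `|f y|%:E < +oo)%E.
Proof.
have mH := @measurable_halfspace R d.
have mf : measurable_fun (H : set (lebesgueType R d.+1)) (fun y => `|f y|).
  by apply: measurableT_comp => //; exact: lf.1.
have L : 0 < ln 4 `^ lambda :> R by rewrite powR_gt0// ln4E mulr_gt0// ln2_gt0.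
apply: le_lt_trans fin_f; rewrite wmeasure_integral; [|exact: mf|by []].
apply: nn_int_le.
- exact: mH.
- exact: mf.
- apply: measurable_funM; first exact: mf.
  by apply: measurable_funM; [exact: measurable_cst|exact: measurable_weight].
- by [].
- move=> y Hy; rewrite ler_peMr// mulrC ler_pdivlMr// mul1r; exact: weight_ge.
Qed.

(** Defined at every point; it is the trace wherever the approximations have bounded
    variation, which is almost everywhere. *)
Definition btrace (x : 'rV[R]_d) : R := bvlim (fun k => Tk f k x).

Let V (x : 'rV[R]_d) : \bar R := (\sum_(0 <= l <oo) `|Tk f l.+1 x - Tk f l x|%:E)%E.

Let mdiff l : measurable_fun setT (fun x : lebesgueType R d => `|Tk f l.+1 x - Tk f l x|%:E).
Proof.
apply/measurable_EFinP; apply: (measurableT_comp (@normr_measurable R setT)).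
by apply: measurable_funB; exact: measurable_Tk.
Qed.

Let mV : measurable_fun setT (V : lebesgueType R d -> \bar R).
Proof. by apply: ge0_emeasurable_sum => // l x _ _; rewrite lee_fin. Qed.

Let V_fin : (\int[@leb R d]_x V x < +oo)%E.
Proof.
rewrite integral_nneseries//.
apply: (@le_lt_trans _ _ (\sum_(0 <= l <oo) ((@strip_const R d)%:E * S l))%E).
  apply: lee_nneseries => [l _ _|l _].
    by apply: integral_ge0 => x _; rewrite lee_fin.
  exact: int_Tk_step.
rewrite nneseriesZl; last by move=> l _; exact: stripint_ge0.
by apply: lte_mul_pinfty; rewrite ?lee_fin ?strip_const_ge0//; exact: stripint_sum_fin.
Qed.

Lemma btrace_cvg x : (V x < +oo)%E -> Tk f k x @[k --> \oo] --> btrace x.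
Proof.
by move=> Vx; rewrite /btrace /bvlim -/(V x) Vx; exact: (bounded_variation (a := fun k => Tk f k x)).
Qed.

Lemma measurable_btrace : measurable_fun setT (btrace : lebesgueType R d -> R).
Proof.
apply: (@measurable_fun_cvg _ (lebesgueType R d) R setT
   (fun n x => if (V x < +oo)%E then Tk f n x else 0)) => [n|x _].
  apply: measurable_fun_ifT.
  - exact: measurable_lt_pinfty.
  - exact: measurable_Tk.
  - exact: measurable_cst.
have [Vx|Vx] := boolP (V x < +oo)%E; first exact: btrace_cvg.
rewrite /btrace /bvlim -/(V x) (negbTE Vx); exact: cvg_cst.
Qed.

Lemma btrace_is_trace : is_trace f btrace.
Proof.
have : (@leb R d).-integrable setT V.
  apply/integrableP; split => //.
  rewrite (eq_integral (V : lebesgueType R d -> _)) => [|x _]; first exact: V_fin.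
  rewrite gee0_abs//; by apply: nneseries_ge0 => l _ _; rewrite lee_fin.
move=> /integrable_ae -/(_ measurableT); apply: filterS => x /(_ I) Vx.
have Vlt : (V x < +oo)%E by rewrite ltey_eq Vx.
rewrite (_ : (fun k => trace_approx k f x) = (fun k => Tk f k x)); first exact: btrace_cvg.
by apply/funext => k; rewrite trace_approxE.
Qed.

Lemma int_btrace_Tk k :
  (\int[@leb R d]_x `|btrace x - Tk f k x|%:E <= (@strip_const R d)%:E * tail k S)%E.
Proof.
apply: (@le_trans _ _ (\int[@leb R d]_x tail k (fun l => `|Tk f l.+1 x - Tk f l x|%:E))%E).
  apply: ge0_le_integral.
  - exact: measurableT.
  - by move=> x _; rewrite lee_fin.
  - apply/measurable_EFinP; exact: measurable_dist measurable_btrace (measurable_Tk f k).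
  - apply: ge0_emeasurable_sum => l; first by move=> x _ _; case: ifP => // _; rewrite lee_fin.
    by move=> _; case: (k <= l)%N; [exact: mdiff|exact: measurable_cst].
  - by move=> x _; exact: bvlim_tail.
rewrite /tail integral_nneseries; first last.
- by move=> l x _; case: ifP => // _; rewrite lee_fin.
- move=> l; case: (k <= l)%N; [exact: mdiff|exact: measurable_cst].
- exact: measurableT.
rewrite -nneseriesZl; last by move=> l _; case: ifP => // _; exact: stripint_ge0.
apply: lee_nneseries => [l _ _|l _].
  by apply: integral_ge0 => x _; case: ifP => // _; rewrite lee_fin.
by case: ifP => _; [exact: int_Tk_step|rewrite integral0 mule0].
Qed.

(** At level 0 the neighbourhoods have measure at least 1, so the averages are bounded
    by integrals of [|f|] over boundedly overlapping boxes. *)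
Lemma int_T0 : (\int[@leb R d]_x `|Tk f 0 x|%:E < +oo)%E.
Proof.
have mH := @measurable_halfspace R d.
have mf : measurable_fun (H : set (lebesgueType R d.+1)) (fun y => `|f y|).
  by apply: measurableT_comp => //; exact: lf.1.
rewrite (@int_step R d 0 (fun m => `|nbd_average f 0 m|%:E)); last by move=> m; rewrite lee_fin.
apply: (@le_lt_trans _ _ (\esum_(m in [set: 'rV[int]_d]) \int[@leb R d.+1]_(y in refbox 0 m) `|f y|%:E)%E).
  apply: le_esum => m _.
  have mB := measurable_refbox (R := R) 0 m.
  have mN := measurable_nbd (R := R) 0 m.
  have NB : nbd 0 m `<=` @refbox R d 0 m.
    have := @nbd_sub_same R d 0 m 0; rewrite addr0 => /(_ _)/subset_trans; apply.
      by move=> i; rewrite mxE.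
    by move=> y yb i; have /andP[/ltW -> /ltW ->] := yb i.
  have iB : (@leb R d.+1).-integrable (refbox 0 m) (EFin \o f).
    by apply: lf.2; [exact: compact_cbox|exact: refbox_halfspace].
  have iN : (@leb R d.+1).-integrable (nbd 0 m) (EFin \o f).
    exact: integrableS mB mN NB iB.
  have N1 : 1 <= fine (@leb R d.+1 (nbd 0 m)).
    have := leb_nbd_ge (R := R) 0 m; rewrite /side expr0 invr1 expr1n => N1.
    rewrite -lee_fin fineK//.
    rewrite ge0_fin_numE ?measure_ge0//; apply: le_lt_trans (ltry (6 ^+ d * 3 * side 0 ^+ d.+1)).
    apply: le_trans (leb_refbox 0 m); apply: le_measure; rewrite ?inE//.
  rewrite /side expr0 invr1 expr1n mul1e.
  apply: (@le_trans _ _ (\int[@leb R d.+1]_(y in nbd 0 m) `|f y|%:E)%E); last first.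
    apply: ge0_subset_integral => //.
    by apply/measurable_EFinP; apply: measurable_funS mf => //; exact: refbox_halfspace.
  rewrite -(fineK (integrable_fin_num mN (integrable_norm iN))) lee_fin.
  have N0 : 0 <= (fine (@leb R d.+1 (nbd 0 m)))^-1 by rewrite invr_ge0; exact: le_trans N1.
  rewrite /nbd_average /average normrM (ger0_norm N0).
  rewrite mulrC ler_pdivrMr; last exact: lt_le_trans N1.
  apply: (@le_trans _ _ (\int[@leb R d.+1]_(y in nbd 0 m) `|f y|)); first exact: le_normr_Rintegral.
  rewrite ler_peMr//; exact: Rintegral_ge0.
have mfs : measurable_fun (strip 0 : set (lebesgueType R d.+1)) (fun y => `|f y|).
  by apply: measurable_funS mf; [exact: mH|exact: strip_halfspace].
apply: le_lt_trans (esum_refbox mfs (fun y => normr_ge0 _)) _.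
apply: lte_mul_pinfty; rewrite ?lee_fin ?exprn_ge0//.
apply: le_lt_trans f_int_fin; apply: ge0_subset_integral.
- exact: measurable_strip.
- exact: mH.
- exact/measurable_EFinP.
- by move=> y _; rewrite lee_fin.
- exact: strip_halfspace.
Qed.

Lemma integrable_btrace : (@leb R d).-integrable setT (EFin \o btrace).
Proof.
apply/integrableP; split; first exact/measurable_EFinP/measurable_btrace.
have mT := @measurable_Tk R d f 0.
have mb := measurable_btrace.
have mz : measurable_fun setT (cst 0 : lebesgueType R d -> R) by exact: measurable_cst.
rewrite (eq_integral (fun x : lebesgueType R d => `|btrace x - cst 0 x|%:E)); last by move=> x _; rewrite subr0.
apply: le_lt_trans (int_triangle (@leb R d) measurableT mb mT mz) _.
apply: lte_add_pinfty; last by under eq_integral do rewrite subr0; exact: int_T0.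
apply: le_lt_trans (int_btrace_Tk 0) _; apply: lte_mul_pinfty; rewrite ?lee_fin ?strip_const_ge0//.
exact: stripint_sum_fin.
Qed.

End trace_limit.

(** * The trace belongs to the Besov-type space *)

Section besov_of_trace.
Context {R : realType} {d : nat}.
Local Notation side := (@side R).

Lemma side_le k j : (k <= j)%N -> side j <= side k.
Proof.
by move=> kj; rewrite /side lef_pV2 ?posrE ?exprn_gt0// ler_eXn2l// ltr1n.
Qed.

(** Each cube contains its upper corner, which serves as a canonical point: the cube
    of a coarser level above a given one is found by taking [idx] at the corner. *)
Definition corner k (m : 'rV[int]_d) : 'rV[R]_d := \row_i (side k * (m ord0 i + 1)%:~R).

Lemma corner_dcube k m : dcube k m (corner k m).
Proof.
rewrite dcubeE => i; rewrite !mxE lexx andbT ltr_pM2l ?side_gt0//.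
by rewrite ltr_int ltrDl.
Qed.

Lemma idx_corner k j (x : 'rV[R]_d) : (k <= j)%N -> idx k (corner j (idx j x)) = idx k x.
Proof.
move=> kj; apply/dcubeP.
exact: (dcube_nest kj (dcube_idx k x) (dcube_idx j x) (corner_dcube j (idx j x))).
Qed.

(** The [3 ^ d] translations to the cubes touching a given one. *)
Definition nshift (a : {ffun 'I_d -> 'I_3}) : 'rV[int]_d := \row_i ((a i)%:Z - 1).

Lemma nshift_unit a : unit_shift (nshift a).
Proof. by move=> i; rewrite mxE; have := ltn_ord (a i); move: (nat_of_ord _) => n; lia. Qed.

Lemma closed_cbox n (a b : 'rV[R]_n) : closed (cbox a b).
Proof. apply: compact_closed; last exact: compact_cbox; exact: norm_hausdorff. Qed.

Lemma closure_dcube k m (z : 'rV[R]_d) : closure (dcube k m) z ->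
  forall i, side k * (m ord0 i)%:~R <= z ord0 i <= side k * (m ord0 i + 1)%:~R.
Proof.
pose B := cbox (\row_i (side k * (m ord0 i)%:~R) : 'rV[R]_d) (\row_i (side k * (m ord0 i + 1)%:~R)).
have sub : dcube k m `<=` B.
  by move=> x; rewrite dcubeE => xm i; have /andP[/ltW -> ->] := xm i.
have := closed_cbox (a := \row_i (side k * (m ord0 i)%:~R) : 'rV[R]_d) (b := \row_i (side k * (m ord0 i + 1)%:~R)).
move=> /closure_id E /(closure_subset sub); rewrite /B -E => zB i.
by have := zB i; rewrite !mxE.
Qed.

(** A cube touching a smaller one touches its ancestor on the same level. *)
Lemma touching_nshift k j (m m' : 'rV[int]_d) : (k <= j)%N ->
  closure (@dcube R d j m) `&` closure (@dcube R d k m') !=set0 ->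
  exists a, m' = idx k (corner j m) + nshift a.
Proof.
move=> kj [z [zj zk]]; pose p := idx k (corner j m).
have sub : @dcube R d j m `<=` dcube k p.
  exact: (dcube_nest kj (dcube_idx k (corner j m)) (corner_dcube j m)).
have s0 := side_gt0 (R := R) k.
have K i : (0 <= m' ord0 i - p ord0 i + 1 < 3)%R.
  have /andP[a1 a2] := closure_dcube (closure_subset sub zj) i.
  have /andP[b1 b2] := closure_dcube zk i.
  have h1 := le_trans a1 b2; have h2 := le_trans b1 a2.
  rewrite ler_pM2l// ler_int in h1; rewrite ler_pM2l// ler_int in h2.
  by move: (m' _ _) (p _ _) h1 h2 => b c; lia.
have Kn i : (absz (m' ord0 i - p ord0 i + 1)%R < 3)%N.
  by have := K i; move: (m' _ _) (p _ _) => b c; lia.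
exists [ffun i => Ordinal (Kn i)]; apply/rowP => i; have := K i.
rewrite [RHS]mxE [nshift _ _ _]mxE ffunE -[m' 0 i]/(m' ord0 i) -/p -[p 0 i]/(p ord0 i)/=.
by move: (m' ord0 i) (p ord0 i) => b c; lia.
Qed.

(** The two levels on which selected neighbours of a cube of generation [j] live. *)
Definition level j (b : bool) : nat := if b then (2 ^ j)%N else (2 ^ j.-1)%N.

Lemma level_le j b : (level j b <= 2 ^ j)%N.
Proof. by rewrite /level; case: b => //; rewrite leq_exp2l// leq_pred. Qed.

Lemma level_ge j b : (2 ^ j.-1 <= level j b)%N.
Proof. by rewrite /level; case: b => //; rewrite leq_exp2l// leq_pred. Qed.

(** Finitely many candidates, given by translations that do not depend on the cube,
    contain all the selected neighbours. *)
Lemma selected_nshift j m Q : selected j (@dcube R d (2 ^ j)%N m) Q ->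
  exists ba : bool * {ffun 'I_d -> 'I_3},
    Q = dcube (level j ba.1) (idx (level j ba.1) (corner (2 ^ j)%N m) + nshift ba.2).
Proof.
move=> [[/dyadicP[m' ->]|/dyadicP[m' ->]] tch].
  by have [a ->] := touching_nshift (leqnn _) tch; exists (true, a).
have le : (2 ^ j.-1 <= 2 ^ j)%N by rewrite leq_exp2l// leq_pred.
by have [a ->] := touching_nshift le tch; exists (false, a).
Qed.

Lemma esum_finite_cover (T : choiceType) (I : finType) (A : set T) (F : T -> \bar R) (h : I -> T) :
  (forall t, 0 <= F t)%E -> (forall t, A t -> exists i, t = h i) ->
  (\esum_(t in A) F t <= \sum_i F (h i))%E.
Proof.
move=> F0 Ah; rewrite esum_mkcond.
apply: (@le_trans _ _ (\esum_(t in [set: T]) \sum_i (if t == h i then F (h i) else 0))%E).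
  apply: le_esum => t _; case: ifPn => [/set_mem/Ah[i ->]|_]; last first.
    by apply: sume_ge0 => i _; case: ifP.
  by rewrite (bigD1 i)//= eqxx leeDl// sume_ge0// => l _; case: ifP.
rewrite esum_sum; last by move=> t i _ _; case: ifP.
apply: lee_sum => i _; rewrite (esum_single (i0 := h i)) ?eqxx//.
by move=> t /negbTE ->.
Qed.

(** Averaging over cubes is a contraction of [L^1] that fixes functions constant on the
    cubes. *)
Lemma int_cube_average k (h : 'rV[R]_d -> R) (c : 'rV[int]_d -> R) :
  (@leb R d).-integrable setT (EFin \o h) ->
  (\int[@leb R d]_x `|average (dcube k (idx k x)) h - c (idx k x)|%:E <=
   \int[@leb R d]_x `|h x - c (idx k x)|%:E)%E.
Proof.
move=> ih; have mh : measurable_fun setT (h : lebesgueType R d -> R).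
  by apply/measurable_EFinP; exact: measurable_int ih.
have s0 := side_gt0 (R := R) k.
rewrite (@int_step R d k (fun m => `|average (dcube k m) h - c m|%:E)); last by move=> m; rewrite lee_fin.
rewrite (int_cubes k); last 2 first.
- by apply/measurable_EFinP; apply: measurable_dist mh (@measurable_step R d k _ R c).
- by move=> x; rewrite lee_fin.
apply: le_esum => m _.
have mQ : measurable (dcube k m : set (lebesgueType R d)).
  exact: borel_measurable_lebesgue (measurable_dcube k m).
rewrite [leRHS](eq_integral (fun x : lebesgueType R d => `|h x - c m|%:E)); last first.
  by move=> x /set_mem /dcubeP ->.
have iQ : (@leb R d).-integrable (dcube k m) (EFin \o h).
  by apply: integrableS ih; [exact: measurableT|exact: mQ|].
have ic : (@leb R d).-integrable (dcube k m) (EFin \o cst (c m)).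
  apply: measurable_bounded_integrable; [exact: mQ| |exact: measurable_cst|].
    by rewrite [X in (X < _)%E](leb_dcube k m) ltry.
  exists `|c m|; split; first exact: num_real.
  by move=> M cM x _ /=; exact: ltW.
have ihc : (@leb R d).-integrable (dcube k m) (EFin \o (fun x => h x - c m)).
  by have := integrableB mQ iQ ic; apply: eq_integrable.
have inhc : (@leb R d).-integrable (dcube k m) (EFin \o (fun x => `|h x - c m|)).
  by have := integrable_norm ihc; apply: eq_integrable.
rewrite -(fineK (integrable_fin_num mQ inhc)) -EFinM lee_fin.
apply: le_trans (le_normr_Rintegral mQ ihc).
rewrite RintegralB// Rintegral_cst// /average [@leb R d (dcube k m)](leb_dcube k m)/=.
have S0 : 0 < side k ^+ d by rewrite exprn_gt0.
rewrite -[X in X * `|_|](ger0_norm (ltW S0)) -normrM mulrBr mulrA mulfV ?gt_eqF// mul1r.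
by rewrite [X in fine X](leb_dcube k m) [c m * _]mulrC.
Qed.

Variables (f : 'rV[R]_d.+1 -> R) (g : 'rV[R]_d.+1 -> 'rV[R]_d.+1) (lambda : R).
Local Notation H := (@halfspace R d).
Hypothesis l0 : 0 < lambda.
Hypothesis lf : L1loc H f.
Hypothesis lg : forall i, L1loc H (fun y => g y ord0 i) /\ weak_partial H i f (fun y => g y ord0 i).
Hypothesis fin : (\int[wmeasure lambda]_(y in H) `|f y|%:E +
   \int[wmeasure lambda]_(y in H) (enorm (g y))%:E < +oo)%E.

Local Notation S := (stripint g).
Let q k m := average (@dcube R d k m) (btrace f).
Let S0 l : (0 <= S l)%E := stripint_ge0 g l.

Let wtail k l : (k <= l)%N -> ((@strip_const R d)%:E * tail l S <= (@strip_const R d)%:E * tail k S)%E.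
Proof.
by move=> kl; apply: lee_wpmul2l; [rewrite lee_fin strip_const_ge0|exact: tail_le].
Qed.

Let wterm k : ((@strip_const R d)%:E * S k <= (@strip_const R d)%:E * tail k S)%E.
Proof.
by apply: lee_wpmul2l; [rewrite lee_fin strip_const_ge0|exact: tail_term].
Qed.

Lemma int_average_Tk k :
  (\int[@leb R d]_x `|q k (idx k x) - Tk f k x|%:E <= (@strip_const R d)%:E * tail k S)%E.
Proof.
apply: le_trans (int_btrace_Tk lf lg k).
exact: (int_cube_average k (nbd_average f k) (integrable_btrace l0 lf lg fin)).
Qed.

(** Pass from the average of the trace over a cube of level [j] to [T_j f], to the
    trace, to [T_k f], to the average of [f] over a translated neighbourhood, and to
    the average of the trace over the translated cube: five steps, each of which costs
    at most a constant times the tail of the strip integrals from [k] on. *)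
Lemma int_average_pair j k e : (k <= j)%N -> unit_shift e ->
  (\int[@leb R d]_x `|q j (idx j x) - q k (idx k x + e)|%:E <=
   (5 * @strip_const R d)%:E * tail k S)%E.
Proof.
move=> kj ue.
have mq : measurable_fun setT (fun x : lebesgueType R d => q j (idx j x)).
  exact: (@measurable_step R d j _ R (q j)).
have mqe : measurable_fun setT (fun x : lebesgueType R d => q k (idx k x + e)).
  exact: (@measurable_step R d k _ R (fun m => q k (m + e))).
have mae : measurable_fun setT (fun x : lebesgueType R d => nbd_average f k (idx k x + e)).
  exact: (@measurable_step R d k _ R (fun m => nbd_average f k (m + e))).
have mT l := @measurable_Tk R d f l.
have mb := @measurable_btrace R d f.
have -> : ((5 * @strip_const R d)%:E * tail k S = (@strip_const R d)%:E * tail k S + ((@strip_const R d)%:E * tail k S +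
   (@strip_const R d)%:E * tail k S + ((@strip_const R d)%:E * tail k S + (@strip_const R d)%:E * tail k S)))%E.
  rewrite -!ge0_muleDl ?lee_fin ?addr_ge0 ?strip_const_ge0//; congr (_%:E * _)%E; ring.
apply: le_trans (int_triangle (@leb R d) measurableT mq (mT j) mqe) _.
apply: leeD; first exact: le_trans (int_average_Tk j) (wtail kj).
apply: le_trans (int_triangle (@leb R d) measurableT (mT j) (mT k) mqe) _.
apply: leeD.
  apply: le_trans (int_triangle (@leb R d) measurableT (mT j) mb (mT k)) _.
  apply: leeD; last exact: int_btrace_Tk.
  by rewrite int_dist_sym; apply: le_trans (int_btrace_Tk lf lg j) (wtail kj).
apply: le_trans (int_triangle (@leb R d) measurableT (mT k) mae mqe) _.
apply: leeD.
  rewrite int_dist_sym (@int_step R d k (fun m => `|nbd_average f k (m + e) - nbd_average f k m|%:E)); last first.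
    by move=> m; rewrite lee_fin.
  by apply: le_trans (esum_same_scale lf lg k ue) (wterm k).
rewrite int_dist_sym (@int_step R d k (fun m => `|q k (m + e) - nbd_average f k (m + e)|%:E)); last first.
  by move=> m; rewrite lee_fin.
rewrite (esum_shift (fun m => (side k ^+ d)%:E * `|q k m - nbd_average f k m|%:E)%E).
rewrite -(@int_step R d k (fun m => `|q k m - nbd_average f k m|%:E)); last first.
  by move=> m; rewrite lee_fin.
exact: int_average_Tk.
Qed.

(** There are [2 * 3 ^ d] candidates for a selected neighbour, each of them covered by
    [int_average_pair]. *)
Lemma besov_level j :
  (\esum_(Q in dyadic (2 ^ j)%N) (@leb R d Q *
       \esum_(Q' in selected j Q) `|average Q (btrace f) - average Q' (btrace f)|%R%:E) <=
   (#|{: bool * {ffun 'I_d -> 'I_3}}|%:R * (5 * @strip_const R d))%:E * tail (2 ^ j.-1) S)%E.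
Proof.
pose J := (2 ^ j)%N.
rewrite (@esum_dyadic R d J).
pose F (ba : bool * {ffun 'I_d -> 'I_3}) m : R :=
  `|q J m - q (level j ba.1) (idx (level j ba.1) (corner J m) + nshift ba.2)|.
apply: (@le_trans _ _ (\esum_(m in [set: 'rV[int]_d]) \sum_ba ((side J ^+ d)%:E * (F ba m)%:E))%E).
  apply: le_esum => m _; rewrite -ge0_sume_distrr; last first.
    by move=> ba _; rewrite lee_fin normr_ge0.
  rewrite [@leb R d (dcube _ _)](leb_dcube _ _); apply: lee_wpmul2l; first by rewrite lee_fin exprn_ge0// ltW// side_gt0.
  apply: (esum_finite_cover (h := fun ba : bool * {ffun 'I_d -> 'I_3} =>
    dcube (level j ba.1) (idx (level j ba.1) (corner J m) + nshift ba.2))).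
    by move=> Q; rewrite lee_fin.
  by move=> Q; exact: selected_nshift.
rewrite esum_sum; last first.
  by move=> m ba _ _; rewrite mule_ge0 ?lee_fin ?normr_ge0 ?exprn_ge0// ltW// side_gt0.
have -> : ((#|{: bool * {ffun 'I_d -> 'I_3}}|%:R * (5 * @strip_const R d))%:E * tail (2 ^ j.-1) S =
   \sum_(ba : bool * {ffun 'I_d -> 'I_3}) ((5 * @strip_const R d)%:E * tail (2 ^ j.-1) S))%E.
  rewrite -ge0_sume_distrl; last by move=> ba _; rewrite lee_fin mulr_ge0// strip_const_ge0.
  by rewrite sumEFin sumr_const mulr_natl.
apply: lee_sum => ba _.
rewrite -(@int_step R d J (fun m => (F ba m)%:E)); last by move=> m; rewrite lee_fin normr_ge0.
rewrite (eq_integral (fun x : lebesgueType R d => `|q J (idx J x) -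
   q (level j ba.1) (idx (level j ba.1) x + nshift ba.2)|%:E)); last first.
  by move=> x _; rewrite /F idx_corner// level_le.
apply: le_trans (int_average_pair (level_le j ba.1) (nshift_unit ba.2)) _.
apply: lee_wpmul2l; first by rewrite lee_fin mulr_ge0// strip_const_ge0.
by apply: tail_le => //; exact: level_ge.
Qed.

(** The largest term kept is at most [Y], and the terms below it form a geometric
    series. *)
Lemma geometric_cut (r Y : R) N : 1 < r -> 0 <= Y ->
  \sum_(0 <= j < N) (if r ^+ j <= Y then r ^+ j else 0) <= r * Y / (r - 1).
Proof.
move=> r1 Y0; have r0 : 0 < r - 1 by rewrite subr_gt0.
have G n : \sum_(0 <= j < n) (if r ^+ j <= Y then r ^+ j else 0) <= r ^+ n / (r - 1).
  rewrite ler_pdivlMr//; elim: n => [|n IH]; first by rewrite big_geq// mul0r expr0.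
  rewrite big_nat_recr//= mulrDl exprS.
  have p : 0 < r ^+ n by rewrite exprn_gt0//; apply: lt_trans r1.
  by case: ifP => _; nra.
elim: N => [|n IH]; first by rewrite big_geq// divr_ge0 ?mulr_ge0// ltW// (lt_trans _ r1).
have [rY|rY] := leP (r ^+ n) Y; last by rewrite big_nat_recr//= (lt_geF rY) addr0.
apply: le_trans (G n.+1) _; rewrite ler_pM2r ?invr_gt0// exprS ler_pM2l//.
exact: lt_trans r1.
Qed.

Definition bconst : R := 3 `^ lambda * (2 `^ lambda * 2 `^ lambda / (2 `^ lambda - 1)).

(** The condition [2 ^ j.-1 <= l] implies [2 ^ j <= 2 * (l + 1)], so the sum is geometric
    and dominated by its last term. *)
Lemma besov_weight_sum l :
  (\sum_(0 <= j <oo) (if (2 ^ j.-1 <= l)%N then (2 ^+ j + 2) `^ lambda else 0)%:E <=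
   (bconst * l.+1%:R `^ lambda)%:E)%E.
Proof.
have r1 : 1 < 2 `^ lambda :> R.
  rewrite -[ltLHS](_ : 1 `^ lambda = 1); last by rewrite powR1.
  by apply: gt0_ltr_powR; rewrite ?nnegrE// ltr1n.
apply: lime_le.
  by apply: is_cvg_nneseries => j _ _; rewrite lee_fin; case: ifP => // _; exact: powR_ge0.
apply: nearW => N; rewrite sumEFin lee_fin.
pose Y : R := (2 * l.+1%:R) `^ lambda.
apply: (@le_trans _ _ (\sum_(0 <= j < N) (3 `^ lambda * (if (2 `^ lambda) ^+ j <= Y then (2 `^ lambda) ^+ j else 0)))).
  apply: ler_sum => j _.
  have E : (2 `^ lambda) ^+ j = (2 ^+ j) `^ lambda :> R.
    by rewrite -(powR_mulrn _ (powR_ge0 _ _)) -(powR_mulrn _ (ler0n _ 2)) -!powRrM mulrC.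
  case: ifP => jl; last by rewrite mulr_ge0 ?powR_ge0//; case: ifP => // _; rewrite exprn_ge0// powR_ge0.
  (* for j = 0 the condition reads 1 <= l *)
  have h2 : 2 ^+ j <= 2 * l.+1%:R :> R.
    rewrite -natrX -natrM ler_nat; case: j {E} jl => [|j] /= jl; first by rewrite expn0; lia.
    by rewrite expnS; lia.
  have -> : (2 `^ lambda) ^+ j <= Y.
    by rewrite E; apply: ge0_ler_powR; rewrite ?nnegrE ?exprn_ge0 ?mulr_ge0//; exact: ltW.
  rewrite E -powRM ?exprn_ge0//; apply: ge0_ler_powR; rewrite ?nnegrE ?mulr_ge0 ?addr_ge0 ?exprn_ge0//.
    exact: ltW.
  have : 1 <= 2 ^+ j :> R by rewrite exprn_ege1// ler1n.
  by lra.
rewrite -mulr_sumr /bconst -mulrA; apply: ler_wpM2l; first exact: powR_ge0.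
apply: le_trans (geometric_cut N r1 (powR_ge0 _ _)) _.
by rewrite /Y powRM// le_eqVlt; apply/orP; left; apply/eqP; ring.
Qed.

(** Exchange the sum over the generations [j] with the sum over the strips [l] in the
    tails. *)
Lemma besov_btrace : besov d lambda (btrace f).
Proof.
have ib := integrable_btrace l0 lf lg fin.
split.
  split; first exact: measurable_btrace.
  move=> K cK _; apply: integrableS ib => //.
  have cl : closed K by apply: compact_closed => //; exact: norm_hausdorff.
  apply: borel_measurable_lebesgue; rewrite -[K]setCK.
  have := open_measurable_rV (closed_openC cl); exact: measurableC.
rewrite /besov_norm; apply: lte_add_pinfty; first by move/integrableP : ib => [].
pose C : R := #|{: bool * {ffun 'I_d -> 'I_3}}|%:R * (5 * @strip_const R d).
have C0 : 0 <= C by rewrite !mulr_ge0// strip_const_ge0.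
have r1 : 1 < 2 `^ lambda :> R.
  rewrite -[ltLHS](_ : 1 `^ lambda = 1); last by rewrite powR1.
  by apply: gt0_ltr_powR; rewrite ?nnegrE// ltr1n.
have b0 : 0 <= bconst.
  by rewrite /bconst !mulr_ge0 ?powR_ge0// invr_ge0 subr_ge0 ltW.
have c0 j : 0 <= (2 ^+ j + 2) `^ lambda :> R by exact: powR_ge0.
have t0 k : (0 <= tail k S)%E by exact: tail_ge0.
apply: (@le_lt_trans _ _ (C%:E * \sum_(0 <= j <oo) (((2 ^+ j + 2) `^ lambda)%:E * tail (2 ^ j.-1) S))%E).
  rewrite -nneseriesZl; last by move=> j _; rewrite mule_ge0.
  apply: lee_nneseries => [j _ _|j _].
    rewrite mule_ge0// esum_ge0// => Q _; rewrite mule_ge0// esum_ge0// => Q' _; by rewrite lee_fin.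
  rewrite muleCA; apply: lee_wpmul2l; [by rewrite lee_fin|exact: besov_level].
apply: lte_mul_pinfty => //.
rewrite (@tail_exchange R (fun j => (2 ^+ j + 2) `^ lambda) (fun j => 2 ^ j.-1)%N)//.
apply: (@le_lt_trans _ _ (bconst%:E * \sum_(0 <= l <oo) ((l.+1%:R `^ lambda)%:E * S l))%E); last first.
  by apply: lte_mul_pinfty; rewrite ?lee_fin//; exact: (stripint_wsum_fin l0 lg fin).
rewrite -nneseriesZl; last by move=> l _; rewrite mule_ge0// lee_fin powR_ge0.
apply: lee_nneseries => [l _ _|l _].
  by apply: nneseries_ge0 => j _ _; rewrite mule_ge0// lee_fin; case: ifP.
rewrite muleA -EFinM.
under eq_eseriesr do rewrite muleC.
have [Sf|] := boolP (S l \is a fin_num); last first.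
  move=> nf; exfalso.
  have : (S l < +oo)%E.
    apply: le_lt_trans (stripint_sum_fin l0 lg fin).
    apply: le_trans (nneseries_lim_ge l.+1 (fun j _ _ => S0 j)).
    by rewrite big_nat_recr//= leeDr// sume_ge0.
  by rewrite -ge0_fin_numE// (negbTE nf).
rewrite -(fineK Sf) nneseriesZl; last by move=> j _; rewrite lee_fin; case: ifP.
rewrite muleC; apply: lee_wpmul2r; last exact: besov_weight_sum.
by rewrite lee_fin fine_ge0.
Qed.

End besov_of_trace.

(** * Integration by parts for smooth functions *)

Section integration_by_parts.
Context {R : realType} {n : nat}.
Local Notation leb := (@leb R n).
Implicit Types (F G : 'rV[R]_n -> R) (a b : 'rV[R]_n).

Lemma leb_cbox_fin a b : (leb (cbox a b) < +oo)%E.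
Proof.
pose c : 'rV[R]_n := \row_i (a ord0 i - 1).
pose b' : 'rV[R]_n := \row_i (Num.max (c ord0 i) (b ord0 i)).
have cb i : c ord0 i <= b' ord0 i by rewrite !mxE le_max lexx.
apply: (@le_lt_trans _ _ (leb (rbox c b'))); last by rewrite leb_rbox// ltry.
apply: le_measure; rewrite ?inE.
- exact: borel_measurable_lebesgue (measurable_cbox _ _).
- exact: borel_measurable_lebesgue (measurable_rbox _ _).
- move=> y yb i; have /andP[h1 h2] := yb i; rewrite !mxE le_max h2 orbT andbT.
  by apply: lt_le_trans h1; rewrite ltrBlDr ltrDl.
Qed.

Lemma measurable_cont F : continuous F -> measurable_fun setT (F : lebesgueType R n -> R).
Proof. by move=> cF; apply: measurable_leb; exact: continuous_measurable_rV. Qed.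

Lemma bounded_on_cbox F a b : continuous F -> exists2 M, 0 <= M & forall y, cbox a b y -> `|F y| <= M.
Proof.
move=> cF.
have [M [_ H]] : [bounded F x | x in cbox a b].
  have cw : {within cbox a b, continuous F} by exact: continuous_subspaceT.
  have [M [Mr H]] := compact_bounded (continuous_compact cw (@compact_cbox _ _ a b)).
  by exists M; split => // x Mx y yb; apply: H => //; exists y.
exists (`|M| + 1); first by rewrite addr_ge0.
move=> y yb; apply: H => //.
by rewrite (le_lt_trans (ler_norm _))// ltrDl.
Qed.

Lemma integrable_cont_cbox F a b : continuous F -> leb.-integrable (cbox a b) (EFin \o F).
Proof.
move=> cF; apply: measurable_bounded_integrable.
- exact: borel_measurable_lebesgue (measurable_cbox _ _).
- exact: leb_cbox_fin.
- by apply: measurable_funTS; exact: measurable_cont.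
- have [M M0 H] := bounded_on_cbox a b cF.
  exists M; split; first exact: num_real.
  by move=> x Mx y yb; apply: le_trans (H _ yb) (ltW Mx).
Qed.

Lemma integrable_cont_supp F a b : continuous F -> (forall y, ~ cbox a b y -> F y = 0) ->
  leb.-integrable setT (EFin \o F).
Proof.
move=> cF F0.
have mB : measurable (cbox a b : set (lebesgueType R n)).
  exact: borel_measurable_lebesgue (measurable_cbox _ _).
have /(integrable_mkcond _ mB) := integrable_cont_cbox a b cF.
congr (integrable _ _ _); apply/funext => y; rewrite patchE.
by case: ifPn => // /negP yb; rewrite /= F0// => h; apply: yb; exact: mem_set.
Qed.

Lemma compact_sub_cbox (K : set 'rV[R]_n) : compact K ->
  exists2 M : R, 0 <= M & K `<=` cbox (const_mx (- M)) (const_mx M).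
Proof.
move=> cK; have [M [_ H]] := compact_bounded cK.
exists (`|M| + 1); first by rewrite addr_ge0.
move=> y Ky i; have := H (`|M| + 1) _ y Ky; rewrite !mxE => /(_ _)/le_trans-hy.
rewrite -ler_norml; apply: le_trans (_ : `|y ord0 i| <= `|y|) _.
  by rewrite [leRHS]mx_normrE; apply: le_trans (le_bigmax _ (fun ij : 'I_1 * 'I_n => `|y ij.1 ij.2|) (ord0, i)).
by apply: hy => //; rewrite (le_lt_trans (ler_norm _))// ltrDl.
Qed.

Lemma compact_closed_rV (K : set 'rV[R]_n) : compact K -> closed K.
Proof. by apply: compact_closed; exact: norm_hausdorff. Qed.

Lemma measurable_compact_leb (K : set 'rV[R]_n) : compact K ->
  measurable (K : set (lebesgueType R n)).
Proof.
move=> cK; apply: borel_measurable_lebesgue; rewrite -[K]setCK.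
have := open_measurable_rV (closed_openC (compact_closed_rV cK)); exact: measurableC.
Qed.

Lemma integrable_cont_compact F (K : set 'rV[R]_n) : compact K -> continuous F ->
  leb.-integrable K (EFin \o F).
Proof.
move=> cK cF; have [M M0 KM] := compact_sub_cbox cK.
have mB : measurable (cbox (const_mx (- M)) (const_mx M) : set (lebesgueType R n)).
  exact: borel_measurable_lebesgue (measurable_cbox _ _).
exact: integrableS mB (measurable_compact_leb cK) KM (integrable_cont_cbox _ _ cF).
Qed.

Lemma partial_out i F (K : set 'rV[R]_n) : closed K -> (forall y, ~ K y -> F y = 0) ->
  forall y, ~ K y -> partial i F y = 0.
Proof.
move=> cK F0 y Ky; rewrite /partial.
rewrite (@near_eq_derive _ _ _ F (cst 0)) ?derive_cst//.
have := open_nbhs_nbhs (conj (closed_openC cK) Ky); apply: filterS => z /F0 ->.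
by [].
Qed.

Lemma line_is_derive i F (x : 'rV[R]_n) (t : R) : (forall y, derivable F y (delta_mx ord0 i)) ->
  is_derive (t : R) (1 : R) (fun t : R => F (x + t *: delta_mx ord0 i))
    (partial i F (x + t *: delta_mx ord0 i)).
Proof.
move=> dF; set e := delta_mx ord0 i.
have E : (fun h : R => h^-1 *: (((fun t : R => F (x + t *: e)) \o shift t) (h *: (1 : R)) -
     F (x + t *: e))) =
   (fun h : R => h^-1 *: ((F \o shift (x + t *: e)) (h *: e) - F (x + t *: e))).
  apply/funext => h /=; congr (_ *: (F _ - _)).
  by rewrite scalerDl -[h *: (1 : R)]/(h * 1) mulr1 addrCA.
have H := dF (x + t *: e).
split; first by rewrite /derivable E.
by rewrite /partial /derive E.
Qed.

(** Difference quotients along the [i]-th axis have integral 0 because Lebesgue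
    measure is translation invariant; by the mean value theorem they are bounded by
    the supremum of the derivative on a box, so they pass to the limit. *)
Lemma int_partial_eq0 i F a b : continuous F -> continuous (partial i F) ->
  (forall y, derivable F y (delta_mx ord0 i)) -> (forall y, ~ cbox a b y -> F y = 0) ->
  \int[leb]_y partial i F y = 0.
Proof.
move=> cF cdF dF F0; set e : 'rV[R]_n := delta_mx ord0 i.
pose s (k : nat) : R := k.+1%:R^-1.
have s0 k : 0 < s k by rewrite invr_gt0.
have s1 k : s k <= 1 by rewrite invf_le1// ler1n.
(* difference quotients with increments 1 / (k + 1) *)
pose Q k y := (s k)^-1 * (F (y + s k *: e) - F y).
have cshift k : continuous (fun y : 'rV[R]_n => F (y + s k *: e)).
  move=> y; apply: continuous_comp; last exact: cF.
  by apply: continuousD; [exact: id|exact: cst_continuous].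
(* increments being at most 1, this box contains the supports of all quotients *)
pose a' := a - e; pose b' := b + e.
have e_itv j : 0 <= e ord0 j <= 1 by rewrite !mxE eqxx/=; case: eqP => _; rewrite ?lexx ?ler01.
have cdF0 y : ~ cbox a b y -> partial i F y = 0.
  by apply: partial_out => //; apply: compact_closed_rV; exact: compact_cbox.
have [M M0 HM] := bounded_on_cbox a b cdF.
have HM' y : `|partial i F y| <= M.
  have [yb|yb] := pselect (cbox a b y); first exact: HM.
  by rewrite cdF0// normr0.
have out k y : ~ cbox a' b' y -> ~ cbox a b y /\ ~ cbox a b (y + s k *: e).
  move=> yb; split => H; apply: yb => j; have := H j; have := e_itv j; have := s0 k; have := s1 k.
    rewrite !mxE => h1 h2 /andP[h3 h4] /andP[h5 h6]; apply/andP; split; lra.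
  rewrite !mxE => h1 h2 /andP[h3 h4] /andP[h5 h6]; apply/andP; split; nra.
have mB' : measurable (cbox a' b' : set (lebesgueType R n)).
  exact: borel_measurable_lebesgue (measurable_cbox _ _).
have Qb k y : `|Q k y| <= M * \1_(cbox a' b') y.
  rewrite indicE; have [yb|yb] := boolP (y \in _); last first.
    have [H1 H2] := out k y (fun h => negP yb (mem_set h)).
    by rewrite /Q !F0// subr0 mulr0 normr0 mulr0.
  rewrite mulr1 /Q.
  have [||c _ Ec] := @MVT_segment R (fun t : R => F (y + t *: e))
     (fun t : R => partial i F (y + t *: e)) 0 (s k) (ltW (s0 k)).
  - by move=> t _; exact: line_is_derive.
  - apply: continuous_subspaceT => t; apply/differentiable_continuous/derivable1_diffP.
    by have [] := line_is_derive y t dF.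
  have -> : F (y + s k *: e) - F y = partial i F (y + c *: e) * s k.
    by move: Ec; rewrite scale0r addr0 subr0.
  by rewrite mulrC mulfK ?gt_eqF.
have Qcvg y : Q ^~ y @ \oo --> partial i F y.
  have /cvg_ex[l Hl] := dF y.
  have El : l = partial i F y by rewrite /partial /derive; apply/esym/cvg_lim.
  rewrite -El.
  have sc : s k @[k --> \oo] --> (0 : R)^'.
    have sc0 : s @ \oo --> (0 : R) by exact: cvg_harmonic.
    move=> A A0; have : nbhs \oo (s @^-1` [set h : R | h != 0 -> A h]) := sc0 _ A0.
    by apply: filterS => k; apply; rewrite gt_eqF.
  have := cvg_comp _ _ sc Hl.
  by under eq_fun => k do rewrite /= [_ *: e + _]addrC.
have iF : leb.-integrable setT (EFin \o F) by exact: integrable_cont_supp F0.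
have iFs k : leb.-integrable setT (EFin \o (fun y : 'rV[R]_n => F (y + s k *: e))).
  by apply: (integrable_cont_supp (a := a') (b := b')) => // y /(out k)[_ /F0].
have Q0 k : \int[leb]_y Q k y = 0.
  rewrite /Q RintegralZl//; last by have := integrableB measurableT (iFs k) iF; apply: eq_integrable.
  rewrite RintegralB// (_ : \int[leb]_x F (x + s k *: e) = \int[leb]_x F x) ?subrr ?mulr0//.
  rewrite /Rintegral; congr fine.
  apply: (@leb_integral_shift R n (s k *: e) (EFin \o F)).
  by apply/measurable_EFinP; exact: continuous_measurable_rV.
have ig : leb.-integrable setT (EFin \o (fun y => M * \1_(cbox a' b') y)).
  have iM : leb.-integrable (cbox a' b') (EFin \o cst M).
    by apply: integrable_cont_cbox; exact: cst_continuous.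
  have /(integrable_mkcond _ mB') := iM.
  congr (integrable _ _ _); apply/funext => y; rewrite patchE /= indicE.
  by case: ifPn => _; rewrite ?mulr1 ?mulr0.
have mQ k : measurable_fun setT (Q k : lebesgueType R n -> R).
  apply: measurable_funM; first exact: measurable_cst.
  by apply: measurable_funB; exact: measurable_cont.
have := Rint_dominated measurableT mQ (fun y _ => Qcvg y) ig (fun k y _ => Qb k y).
under eq_fun do rewrite Q0.
by move=> H; apply: cvg_unique H (cvg_cst 0).
Qed.

(** Apply [int_partial_eq0] to the product with the test function. *)
Lemma weak_partial_smooth (U : set 'rV[R]_n) i F : open U -> smooth F ->
  weak_partial U i F (partial i F).
Proof.
move=> oU sF phi [sphi [K [cK KU phi0]]].
have [M M0 KM] := compact_sub_cbox cK.
set a := const_mx (- M) in KM; set b := const_mx M in KM.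
have cl := compact_closed_rV cK.
have cF := smooth_continuous sF; have cphi := smooth_continuous sphi.
have cdF := @smooth_partial_continuous _ _ _ i sF; have cdphi := @smooth_partial_continuous _ _ _ i sphi.
have dphi0 := partial_out i cl phi0.
pose G y := F y * phi y.
have dG y : derivable G y (delta_mx ord0 i).
  by apply: derivableM; [have [] := smooth_is_derive i y sF|have [] := smooth_is_derive i y sphi].
have EG y : partial i G y = F y * partial i phi y + partial i F y * phi y.
  rewrite /partial deriveM; [|by have [] := smooth_is_derive i y sF|by have [] := smooth_is_derive i y sphi].
  by rewrite [X in _ + X]/( _ * _) [X in _ + X]mulrC.
have cont2 (A B : 'rV[R]_n -> R) : continuous A -> continuous B -> continuous (fun y => A y * B y).
  by move=> cA cB y; apply: continuousM; [exact: cA|exact: cB].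
have cdG : continuous (partial i G).
  have -> : partial i G = (fun y => F y * partial i phi y + partial i F y * phi y) by apply/funext.
  by move=> y; apply: (@cvgD _ _ _ (nbhs y)); [exact: (cont2 _ _ cF cdphi)|exact: (cont2 _ _ cdF cphi)].
have out (A B : 'rV[R]_n -> R) : (forall y, ~ K y -> B y = 0) ->
   forall y, ~ cbox a b y -> A y * B y = 0.
  by move=> B0 y yb; rewrite B0 ?mulr0// => /KM.
have restr (A B : 'rV[R]_n -> R) : (forall y, ~ K y -> B y = 0) ->
   \int[leb]_(y in U) (A y * B y) = \int[leb]_y (A y * B y).
  move=> B0; apply/esym/Rint_restrict => // y _ Uy; rewrite B0 ?mulr0// => /KU.
  exact: Uy.
rewrite restr// restr//.
have i1 := integrable_cont_supp (cont2 _ _ cF cdphi) (out F _ dphi0).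
have i2 := integrable_cont_supp (cont2 _ _ cdF cphi) (out (partial i F) _ phi0).
have := int_partial_eq0 (cont2 _ _ cF cphi) cdG dG (out F _ phi0).
have -> : \int[leb]_y partial i G y = \int[leb]_y (F y * partial i phi y + partial i F y * phi y).
  by apply: eq_Rintegral => y _; exact: EG.
by rewrite RintegralD// => /eqP; rewrite addr_eq0 => /eqP.
Qed.

End integration_by_parts.

(** * Locally finite sums of smooth functions *)

Section finite_support.
Context {R : realType} {I : choiceType}.

(** The sum of a family indexed by an infinite type, meaningful when only finitely many
    terms are nonzero. *)
Definition fsum (F : I -> R) : R := \sum_(i \in [set: I]) F i.

Lemma fsumE (s : seq I) (F : I -> R) : uniq s -> (forall i, i \notin s -> F i = 0) ->
  fsum F = \sum_(i <- s) F i.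
Proof.
move=> us F0; rewrite fsbig_seq// /fsum; apply/esym/fsbig_widen => //.
by move=> i /= [_ /negP]; exact: F0.
Qed.

End finite_support.

Section locally_finite.
Context {R : realType} {n : nat} {I : countType}.
Local Notation leb := (@leb R n).
Variable U : set 'rV[R]_n.
Hypothesis oU : open U.

(** On a given compact set a single finite family of indices accounts for all nonzero
    terms, which is what integration over the compact set needs. *)
Definition locally_finite (T : I -> 'rV[R]_n -> R) := forall K : set 'rV[R]_n,
  compact K -> K `<=` U -> exists2 s : seq I, uniq s &
    forall y i, K y -> i \notin s -> T i y = 0.

Lemma measurable_fsum (T : I -> 'rV[R]_n -> R) : (forall i, continuous (T i)) ->
  locally_finite T ->
  measurable_fun (U : set (lebesgueType R n)) (fun y => fsum (T ^~ y)).
Proof.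
move=> cT lT.
pose V N (y : 'rV[R]_n) := \sum_(k < N) oapp (fun i => T i y) 0 (@pickle_inv I k).
have mV N : measurable_fun (U : set (lebesgueType R n)) (V N : lebesgueType R n -> R).
  apply: (@measurable_sum _ (lebesgueType R n) R U _ _ (fun (k : 'I_N) (y : lebesgueType R n) =>
     oapp (fun i => T i y) 0 (@pickle_inv I k))) => k.
  case: (pickle_inv _) => [i|] /=; last exact: measurable_cst.
  by apply: measurable_funTS; exact: measurable_cont.
apply: (measurable_fun_cvg mV) => y Uy.
have [s us Hs] := lT [set y] (@compact_set1 _ y) (fun z zy => eq_ind_r U Uy zy).
apply: cvg_near_cst.
near=> N.
pose s' := pmap (@pickle_inv I) (iota 0 N).
rewrite /V (@fsumE _ _ s').
- rewrite /s'; rewrite -(big_mkord xpredT (fun k => oapp (fun i => T i y) 0 (@pickle_inv I k))).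
  rewrite /index_iota subn0; elim: (iota 0 N) => [|k t IH]; first by rewrite !big_nil.
  by rewrite big_cons IH /=; case: (pickle_inv k) => [i|]/=; rewrite ?big_cons ?add0r.
- rewrite /s'; apply: (pmap_uniq (@pickle_invK I)); exact: iota_uniq.
- move=> i is'; apply: Hs => //; apply: contra is' => si.
  rewrite mem_pmap; apply/mapP; exists (pickle i); last by rewrite pickleK_inv.
  rewrite mem_iota/= add0n.
  have : (pickle i <= \max_(i <- s) pickle i)%N by exact: leq_bigmax_seq.
  move=> /leq_ltn_trans; apply; near: N; exact: nbhs_infty_gt.
Unshelve. all: by end_near. Qed.

Lemma L1loc_fsum (T : I -> 'rV[R]_n -> R) : (forall i, continuous (T i)) ->
  locally_finite T -> L1loc U (fun y => fsum (T ^~ y)).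
Proof.
move=> cT lT; split; first exact: measurable_fsum.
move=> K cK KU; have [s us Hs] := lT K cK KU.
have mK := measurable_compact_leb cK.
apply: (eq_integrable mK (EFin \o (fun y => \sum_(i <- s) T i y))).
  by move=> y /set_mem Ky; rewrite /= (fsumE us)// => i; exact: Hs.
apply: (@integrable_Rsum _ _ _ _ _ mK _ s xpredT (fun i y => T i y)) => i _.
exact: integrable_cont_compact (cT i).
Qed.

(** On the support of a test function the sum is a finite sum of smooth functions. *)
Lemma weak_partial_fsum (T : I -> 'rV[R]_n -> R) i : (forall a, smooth (T a)) ->
  locally_finite T -> locally_finite (fun a => partial i (T a)) ->
  weak_partial U i (fun y => fsum (T ^~ y)) (fun y => fsum (fun a => partial i (T a) y)).
Proof.
move=> sT lT ldT phi tphi; have [sphi [K [cK KU phi0]]] := tphi.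
have cl := compact_closed_rV cK.
have mK := measurable_compact_leb cK.
have dphi0 := partial_out i cl phi0.
have iK (A B : 'rV[R]_n -> R) : continuous A -> continuous B ->
    leb.-integrable K (EFin \o (fun y => A y * B y)).
  move=> cA cB; apply: integrable_cont_compact => // y.
  by apply: continuousM; [exact: cA|exact: cB].
have restr (A B : 'rV[R]_n -> R) : (forall y, ~ K y -> B y = 0) ->
   \int[leb]_(y in U) (A y * B y) = \int[leb]_(y in K) (A y * B y).
  by move=> B0; apply: Rint_restrict => // y _ Ky; rewrite B0 ?mulr0.
have main (S : I -> 'rV[R]_n -> R) (B : 'rV[R]_n -> R) (s : seq I) : uniq s ->
   (forall y a, K y -> a \notin s -> S a y = 0) -> (forall y, ~ K y -> B y = 0) ->
   (forall a, continuous (S a)) -> continuous B ->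
   \int[leb]_(y in U) (fsum (S ^~ y) * B y) = \sum_(a <- s) \int[leb]_(y in U) (S a y * B y).
  move=> us S0 B0 cS cB; rewrite restr//.
  transitivity (\int[leb]_(y in K) (\sum_(a <- s) S a y * B y)).
    apply: eq_Rintegral => y /set_mem Ky; rewrite (fsumE us) ?mulr_suml// => a; exact: S0.
  rewrite (@Rint_sum _ _ _ _ _ mK _ s xpredT (fun a y => S a y * B y)); last by move=> a _; exact: iK.
  by apply: eq_bigr => a _; rewrite restr.
have [s us Hs] := lT K cK KU; have [s' us' Hs'] := ldT K cK KU.
pose t := undup (s ++ s').
have ts a : a \notin t -> a \notin s /\ a \notin s'.
  by rewrite mem_undup mem_cat => /norP.
have cT a := smooth_continuous (sT a).
have cdT a := @smooth_partial_continuous R n (T a) i (sT a).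
have cphi := smooth_continuous sphi.
have cdphi := @smooth_partial_continuous R n phi i sphi.
rewrite (main T (partial i phi) t) ?undup_uniq//; last by move=> y a Ky /ts[as_ _]; exact: Hs.
rewrite (main (fun a => partial i (T a)) phi t) ?undup_uniq//; last first.
  by move=> y a Ky /ts[_ as_]; exact: Hs'.
rewrite -sumrN; apply: eq_bigr => a _; exact: (weak_partial_smooth i oU (sT a)).
Qed.

End locally_finite.

(** * Profiles of the extension *)

Section profiles.
Context {R : realType}.
Local Notation side := (@side R).

(** A smooth step all of whose variation takes place between 1/4 and 3/4, so that its
    derivative vanishes near 0 and 1. *)
Definition ramp (s : R) : R := step (2 * s - 1 / 2).

Lemma ramp_smooth : smooth1 ramp.
Proof. exact: (smooth1_aff 2 (- (1 / 2)) (@step_smooth R)). Qed.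

Lemma ramp_le s : s <= 1 / 4 -> ramp s = 0.
Proof. by move=> h; apply: step_le0; lra. Qed.

Lemma ramp_ge s : 3 / 4 <= s -> ramp s = 1.
Proof. by move=> h; apply: step_ge1; lra. Qed.

Lemma ramp_itv s : 0 <= ramp s <= 1.
Proof. exact: step_itv. Qed.

Lemma dramp_lt s : s < 1 / 4 -> derive1 ramp s = 0.
Proof. by apply: (@derive1_cst_near R ramp 0) => y /ltW; exact: ramp_le. Qed.

Lemma dramp_gt s : 3 / 4 < s -> derive1 ramp s = 0.
Proof.
move=> h; rewrite derive1E.
have [_ ->] : is_derive (s : R) (1 : R) ramp 0 => //.
apply: (@near_eq_is_derive _ _ _ (cst (1 : R))).
near=> y; apply/esym/ramp_ge/ltW; near: y; exact: lt_nbhsr.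
Unshelve. all: by end_near. Qed.

Lemma dramp_bounded : exists M : R, 0 <= M /\ forall s, `|derive1 ramp s| <= M.
Proof.
have c : continuous (derive1 ramp) by apply: smooth1_continuous; apply: smooth1_derive1; exact: ramp_smooth.
have cw : {within `[0, 1], continuous (derive1 ramp)} by exact: continuous_subspaceT.
have [M [Mr H]] := compact_bounded (continuous_compact cw (@segment_compact R 0 1)).
exists (`|M| + 1); split; first by rewrite addr_ge0.
move=> s; have [h|h] := boolP (0 <= s <= 1).
  apply: H; last by exists s => //; rewrite /= in_itv.
  by rewrite (le_lt_trans (ler_norm _))// ltrDl.
have -> : derive1 ramp s = 0; last by rewrite normr0 addr_ge0.
move: h; rewrite negb_and -!ltNge => /orP[h|h]; first by apply: dramp_lt; lra.
by apply: dramp_gt; lra.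
Qed.

Definition rampM : R := projT1 (cid dramp_bounded).
Lemma rampM_ge0 : 0 <= rampM.
Proof. by have [] := projT2 (cid dramp_bounded). Qed.
Lemma dramp_le s : `|derive1 ramp s| <= rampM.
Proof. by have [_ H] := projT2 (cid dramp_bounded); exact: H. Qed.

(** On consecutive unit intervals [rhat] is a ramp and one minus a ramp, so its integer
    translates sum to 1. *)
Definition rhat (s : R) : R := ramp s - ramp (s - 1).

Lemma rhat_smooth : smooth1 rhat.
Proof.
apply: smooth1B; first exact: ramp_smooth.
exact: (shift_smooth 1 ramp_smooth).
Qed.

Lemma drhat s : derive1 rhat s = derive1 ramp s - derive1 ramp (s - 1).
Proof.
have D y : is_derive (y : R) (1 : R) ramp (derive1 ramp y) by apply: smooth1_is_derive; exact: ramp_smooth.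
have E y : is_derive (y : R) (1 : R) rhat (derive1 ramp y - derive1 ramp (y - 1)).
  by apply: is_deriveB; exact: (is_derive_shiftB 1 y D).
by rewrite (derive1_eq E).
Qed.

Lemma rhat_out s : ~~ (0 < s < 2) -> rhat s = 0.
Proof.
rewrite negb_and -!leNgt => /orP[h|h]; rewrite /rhat.
  by rewrite !ramp_le ?subrr//; lra.
by rewrite !ramp_ge ?subrr//; lra.
Qed.

Lemma drhat_out s : ~~ (0 < s < 2) -> derive1 rhat s = 0.
Proof.
rewrite negb_and -!leNgt drhat => /orP[h|h].
  by rewrite !dramp_lt ?subrr//; lra.
by rewrite !dramp_gt ?subrr//; lra.
Qed.

Lemma rhat0 s : s <= 1 -> rhat s = ramp s.
Proof. by move=> h; rewrite /rhat [ramp (s - 1)]ramp_le ?subr0//; lra. Qed.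
Lemma rhat1 s : 0 < s -> rhat (s + 1) = 1 - ramp s.
Proof. by move=> h; rewrite /rhat addrK ramp_ge//; lra. Qed.
Lemma drhat0 s : s <= 1 -> derive1 rhat s = derive1 ramp s.
Proof. by move=> h; rewrite drhat (dramp_lt (s := s - 1)) ?subr0//; lra. Qed.
Lemma drhat1 s : 0 < s -> derive1 rhat (s + 1) = - derive1 ramp s.
Proof. by move=> h; rewrite drhat addrK dramp_gt ?sub0r//; lra. Qed.

(** The edge of the cubes of generation [j], that is, of level [2 ^ j]. *)
Definition gside (j : nat) : R := side (2 ^ j).

Lemma gside_gt0 j : 0 < gside j. Proof. exact: side_gt0. Qed.
Lemma gsideS j : gside j.+1 = gside j ^+ 2.
Proof. by rewrite /gside /side expnS mulnC exprM exprVn. Qed.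
Lemma gside0 : gside 0 = 1 / 2.
Proof. by rewrite /gside /side expn0 expr1 div1r. Qed.
Lemma gside_le j : gside j <= 1 / 2.
Proof.
elim: j => [|j IH]; first by rewrite gside0.
by rewrite gsideS; have := gside_gt0 j; nra.
Qed.
Lemma gside_le_pow j : gside j <= (1 / 2) ^+ j.
Proof.
elim: j => [|j IH]; first by rewrite expr0; apply: le_trans (gside_le 0) _; lra.
rewrite gsideS expr2 exprS; apply: ler_pM => //; [exact/ltW/gside_gt0|exact/ltW/gside_gt0|exact: gside_le].
Qed.

(** Switches on between the arguments 5 and 7.  These thresholds keep the heights
    between [3/4] and [9/4] of a cube, which its Whitney neighbourhood occupies, clear of
    any transition. *)
Definition chi (s : R) : R := ramp (4^-1 * s + - 1).

Lemma chi_smooth : smooth1 chi.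
Proof. exact: (smooth1_aff _ _ ramp_smooth). Qed.
Lemma chi_le s : s <= 5 -> chi s = 0.
Proof. by move=> ?; apply: ramp_le; lra. Qed.
Lemma chi_ge s : 7 <= s -> chi s = 1.
Proof. by move=> ?; apply: ramp_ge; lra. Qed.
Lemma dchi s : derive1 chi s = 4^-1 * derive1 ramp (4^-1 * s + - 1).
Proof. exact: derive1_aff ramp_smooth. Qed.
Lemma dchi_out s : ~~ (4 < s < 8) -> derive1 chi s = 0.
Proof.
rewrite dchi negb_and -!leNgt => /orP[?|?].
  by rewrite dramp_lt ?mulr0//; lra.
by rewrite dramp_gt ?mulr0//; lra.
Qed.
Lemma dchi_le s : `|derive1 chi s| <= rampM.
Proof.
rewrite dchi normrM ger0_norm//; have := dramp_le (4^-1 * s + - 1).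
by have := normr_ge0 (derive1 ramp (4^-1 * s + - 1)); lra.
Qed.

(** The vertical partition of unity.  The terms [+ 0] match the form [a * t + b] of the
    lemmas on affine changes of variable. *)
Definition vprof j (t : R) : R := chi ((gside j.+1)^-1 * t + 0) - chi ((gside j)^-1 * t + 0).
(** The derivative of [t -> chi (t / gside j)]; the derivative of [vprof j] is a
    difference of two of these. *)
Definition dlayer j (t : R) : R := (gside j)^-1 * derive1 chi ((gside j)^-1 * t + 0).

Lemma vprof_smooth j : smooth1 (vprof j).
Proof. by apply: smooth1B; exact: (smooth1_aff _ _ chi_smooth). Qed.

Lemma dvprof j t : derive1 (vprof j) t = dlayer j.+1 t - dlayer j t.
Proof.
have D a b y : is_derive (y : R) (1 : R) (fun t => chi (a * t + b)) (a * derive1 chi (a * y + b)).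
  rewrite -derive1_aff; last exact: chi_smooth.
  by apply: smooth1_is_derive; exact: (smooth1_aff _ _ chi_smooth).
have E y : is_derive (y : R) (1 : R) (vprof j) (dlayer j.+1 y - dlayer j y).
  by apply: is_deriveB; exact: D.
by rewrite (derive1_eq E).
Qed.

Lemma gside_lt j : gside j.+1 < gside j.
Proof. by rewrite gsideS; have := gside_gt0 j; have := gside_le j; nra. Qed.

Lemma scale_gt j (c t : R) : (c < (gside j)^-1 * t + 0) = (c * gside j < t).
Proof. by rewrite addr0 mulrC ltr_pdivlMr ?gside_gt0. Qed.
Lemma scale_lt j (c t : R) : ((gside j)^-1 * t + 0 < c) = (t < c * gside j).
Proof. by rewrite addr0 mulrC ltr_pdivrMr ?gside_gt0. Qed.

Definition layer j : set R := [set t | 4 * gside j.+1 < t < 8 * gside j].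

Lemma vprof_itv j t : 0 <= vprof j t <= 1.
Proof.
rewrite /vprof; set a := (gside j.+1)^-1 * t + 0; set b := (gside j)^-1 * t + 0.
have [ca cb] : (0 <= chi a <= 1) /\ (0 <= chi b <= 1) by split; exact: ramp_itv.
have [b5|b5] := leP b 5; first by rewrite (chi_le b5) subr0.
have : 5 * gside j < t by rewrite -scale_gt.
move=> tb; have a7 : 7 < a.
  by rewrite scale_gt gsideS; have := gside_gt0 j; have := gside_le j; nra.
by rewrite (chi_ge (ltW a7)); lra.
Qed.

Lemma vprof_out j t : ~ layer j t -> vprof j t = 0.
Proof.
rewrite /layer /= => /negP; rewrite negb_and -!leNgt => /orP[h1|h1]; rewrite /vprof.
  have h2 := gside_lt j; have h3 := gside_gt0 j.+1.
  rewrite !chi_le ?subrr// leNgt scale_gt -leNgt; lra.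
have h2 := gside_lt j; have h3 := gside_gt0 j.
rewrite !chi_ge ?subrr// leNgt scale_lt -leNgt; lra.
Qed.

Lemma vprof1 j t : 7 * gside j.+1 <= t <= 5 * gside j -> vprof j t = 1.
Proof.
move=> /andP[h1 h2]; rewrite /vprof chi_ge ?chi_le ?subr0//.
- by rewrite leNgt scale_gt -leNgt.
- by rewrite leNgt scale_lt -leNgt.
Qed.

Lemma dlayer_out j t : ~~ (4 * gside j < t < 8 * gside j) -> dlayer j t = 0.
Proof.
by move=> H; rewrite /dlayer dchi_out ?mulr0// scale_gt scale_lt.
Qed.

Lemma dlayer_le j t : `|dlayer j t| <= (gside j)^-1 * rampM.
Proof.
rewrite /dlayer normrM ger0_norm ?invr_ge0 ?(ltW (gside_gt0 j))//.
by rewrite ler_wpM2l ?invr_ge0 ?(ltW (gside_gt0 j))//; exact: dchi_le.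
Qed.

Lemma dvprof_out j t : ~ layer j t -> derive1 (vprof j) t = 0.
Proof.
rewrite /layer /= => /negP H; rewrite dvprof !dlayer_out ?subrr//.
  by move: H; rewrite !negb_and -!leNgt; have := gside_lt j; have := gside_gt0 j.+1 => h1 h2 /orP[h3|h3]; apply/orP; [left|right]; lra.
by move: H; rewrite !negb_and -!leNgt; have := gside_lt j; have := gside_gt0 j.+1 => h1 h2 /orP[h3|h3]; apply/orP; [left|right]; lra.
Qed.

Lemma layer_bound (t : R) : 0 < t -> exists N, forall j, (N <= j)%N -> 8 * gside j < t.
Proof.
move=> t0; have [N HN] : exists N, (1 / 2) ^+ N < t / 8 :> R.
  have : (fun n => (1 / 2) ^+ n : R) @ \oo --> (0 : R).
    by apply: cvg_expr; rewrite ger0_norm//; lra.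
  move=> /cvgrPdist_lt/(_ (t / 8)) -[|N _ /(_ N (leqnn N))]; first by rewrite divr_gt0.
  by rewrite /= sub0r normrN ger0_norm ?exprn_ge0// => ?; exists N.
exists N => j Nj; have := gside_le_pow j.
have : (1 / 2) ^+ j <= (1 / 2) ^+ N :> R by rewrite ler_wiXn2l//; lra.
lra.
Qed.

Lemma layer_far (t : R) j : 8 * gside j < t -> ~ layer j t.
Proof. by rewrite /layer /= => H /andP[_ H2]; lra. Qed.

End profiles.

(** * Interpolation of coefficients attached to dyadic cubes *)

Section waves.
Context {R : realType} {d : nat}.
Local Notation gside := (@gside R).
Local Notation H := (@halfspace R d).
Implicit Types (c : nat -> 'rV[int]_d -> R) (A : nat -> R -> R) (W : 'I_d -> R -> R).
Implicit Types (jm : nat * 'rV[int]_d).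

(** A smooth function concentrated near the cube [jm.2] of generation [jm.1], with
    coefficient [c], vertical profile [A] and horizontal profiles [W].  The same form
    covers the terms of the extension and all their first derivatives. *)
Definition wave c A W jm (y : 'rV[R]_d.+1) : R :=
  c jm.1 jm.2 * A jm.1 (height y) *
  \prod_l W l ((gside jm.1)^-1 * rV_init y ord0 l + - (jm.2 ord0 l)%:~R).

Definition uprof c A W jm : 'I_d.+1 -> R -> R := fun i =>
  if unlift ord_max i is Some l then (fun t => W l ((gside jm.1)^-1 * t + - (jm.2 ord0 l)%:~R))
  else (fun t => c jm.1 jm.2 * A jm.1 t).

Lemma prod_lift (F : 'I_d.+1 -> R) : \prod_i F i = F ord_max * \prod_l F (lift ord_max l).
Proof.
rewrite big_ord_recr/= mulrC; congr (_ * _); apply: eq_bigr => l _; congr F.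
by apply/val_inj; rewrite /= /bump leqNgt ltn_ord.
Qed.

Lemma waveE c A W jm : wave c A W jm = tens (uprof c A W jm).
Proof.
apply/funext => y; rewrite /tens prod_lift /uprof unlift_none /wave; congr (_ * _).
by apply: eq_bigr => l _; rewrite liftK mxE.
Qed.

Lemma uprof_smooth c A W jm : (forall j, smooth1 (A j)) -> (forall l, smooth1 (W l)) ->
  forall i, smooth1 (uprof c A W jm i).
Proof.
move=> sA sW i; rewrite /uprof; case: unliftP => [l _|_].
  exact: (smooth1_aff _ _ (sW l)).
exact: smooth1Z.
Qed.

Lemma wave_smooth c A W jm : (forall j, smooth1 (A j)) -> (forall l, smooth1 (W l)) ->
  smooth (wave c A W jm).
Proof. by move=> sA sW; rewrite waveE; apply: tens_smooth; exact: uprof_smooth. Qed.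

Lemma derive1Z (a : R) (f : R -> R) t : smooth1 f -> derive1 (fun t => a * f t) t = a * derive1 f t.
Proof.
move=> sf; have E y : is_derive (y : R) (1 : R) (fun t => a * f t) (a * derive1 f y).
  by apply: is_deriveZ; exact: smooth1_is_derive.
by rewrite (derive1_eq E).
Qed.

Lemma wave_partial_height c A W jm : (forall j, smooth1 (A j)) -> (forall l, smooth1 (W l)) ->
  partial ord_max (wave c A W jm) = wave c (fun j => derive1 (A j)) W jm.
Proof.
move=> sA sW; apply/funext => y; rewrite waveE tens_derive; last exact: uprof_smooth.
rewrite waveE; apply: eq_bigr => i _; rewrite /upd /uprof unlift_none.
case: unliftP => [l ->|->]; last by rewrite eqxx derive1Z.
by rewrite eq_sym (negbTE (neq_lift _ _)).
Qed.

Definition updW W l : 'I_d -> R -> R := fun l' => if l' == l then derive1 (W l) else W l'.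

Lemma wave_partial_lift c A W jm l : (forall j, smooth1 (A j)) -> (forall l, smooth1 (W l)) ->
  partial (lift ord_max l) (wave c A W jm) = wave c (fun j t => (gside j)^-1 * A j t) (updW W l) jm.
Proof.
move=> sA sW; apply/funext => y; rewrite waveE tens_derive; last exact: uprof_smooth.
rewrite tens_upd {1}/uprof liftK derive1_aff//.
rewrite (bigD1 ord_max)/=; last exact: neq_lift.
rewrite /wave /uprof unlift_none (bigD1 l)//= /updW eqxx mxE.
set P1 := \prod_(i | _) _; set P2 := \prod_(i | _) _.
suff -> : P1 = P2 by rewrite /height; ring.
rewrite /P1 /P2 big_mkcond prod_lift/= eqxx andbF mul1r [RHS]big_mkcond/=.
apply: eq_bigr => l' _; rewrite liftK (inj_eq (lift_inj (h:=ord_max))) eq_sym.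
rewrite [lift _ _ == _]eq_sym neq_lift andbT eq_sym.
by case: eqP => //= _; rewrite mxE.
Qed.

(** The coordinates of [x], in units of the cubes of generation [j], relative to the
    lower corner of its cube. *)
Definition frac j (x : 'rV[R]_d) l : R := (gside j)^-1 * x ord0 l + - (idx (2 ^ j) x ord0 l)%:~R.

Lemma frac_itv j x l : 0 < frac j x l <= 1.
Proof.
have := dcube_idx (2 ^ j) x; rewrite dcubeE => /(_ l); rewrite [X in X < _]mxE [X in _ <= X]mxE.
have gj0 := @gside_gt0 R j; rewrite -/(gside j) intrD /frac => /andP[h1 h2].
have E : (gside j)^-1 * x ord0 l = x ord0 l / gside j by rewrite mulrC.
rewrite E subr_gt0 ltr_pdivlMr// mulrC h1/= lerBlDr ler_pdivrMr//.
by rewrite mulrC addrC.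
Qed.

(** The waves that do not vanish at [x] are those of the cube of [x] and of its
    [2 ^ d - 1] neighbours on the lower side in some coordinates. *)
Definition bshift (a : {ffun 'I_d -> bool}) : 'rV[int]_d := \row_l (a l : nat)%:Z.

(** The sum of the waves of generation [j] that are active at [x], without the
    vertical profile. *)
Definition interp c W j (x : 'rV[R]_d) : R :=
  \sum_(a : {ffun 'I_d -> bool}) c j (idx (2 ^ j) x - bshift a) *
    \prod_l W l (frac j x l + (a l)%:R).

Lemma subE (p q : 'rV[int]_d) i : (p - q) ord0 i = p ord0 i - q ord0 i.
Proof. by rewrite !mxE. Qed.

Lemma wave_shift c A W j y a : let x := rV_init y in
  wave c A W (j, idx (2 ^ j) x - bshift a) y =
  A j (height y) * (c j (idx (2 ^ j) x - bshift a) * \prod_l W l (frac j x l + (a l)%:R)).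
Proof.
move=> x; rewrite /wave/= -/x mulrA [c _ _ * A _ _]mulrC; congr (_ * _).
apply: eq_bigr => l _; congr (W l _); rewrite /frac subE [bshift _ _ _]mxE intrB opprB -pmulrn; ring.
Qed.

Lemma wave_neq0 c A W j m y : (forall l s, ~~ (0 < s < 2) -> W l s = 0) ->
  wave c A W (j, m) y != 0 -> A j (height y) != 0 /\
    exists a, m = idx (2 ^ j) (rV_init y) - bshift a.
Proof.
move=> W0; set x := rV_init y; rewrite /wave/= mulf_eq0 negb_or mulf_eq0 negb_or -/x.
move=> /andP[/andP[_ A0] /prodf_neq0 P0]; split => //.
have K l : m ord0 l = idx (2 ^ j) x ord0 l \/ m ord0 l = idx (2 ^ j) x ord0 l - 1.
  have := P0 l isT; apply: contraNP => nm; rewrite W0//; apply/negP => /andP[s0 s2].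
  have /andP[f0 f1] := frac_itv j x l; rewrite /frac in f0 f1.
  have a1 : (m ord0 l)%:~R < (idx (2 ^ j) x ord0 l)%:~R + 1 :> R by lra.
  have a2 : (idx (2 ^ j) x ord0 l)%:~R < (m ord0 l)%:~R + 2 :> R by lra.
  rewrite -[1]/(1%:~R) -intrD ltr_int in a1; rewrite -[2]/(2%:~R) -intrD ltr_int in a2.
  by apply: nm; move: (m ord0 l) (idx _ _ _ _) a1 a2 => b e; lia.
exists [ffun l => m ord0 l != idx (2 ^ j) x ord0 l].
apply/rowP => l; rewrite subE [bshift _ _ _]mxE ffunE -[m 0 l]/(m ord0 l).
by case: (K l) => E; case: eqP => /=; move: (m ord0 l) (idx _ _ _ _) E => b e; lia.
Qed.

Lemma bshift_inj : injective bshift.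
Proof.
move=> a b /rowP E; apply/ffunP => l; have := E l; rewrite !mxE.
by case: (a l); case: (b l).
Qed.

(** At a given point only finitely many generations, and in each of them [2 ^ d] cubes,
    contribute. *)
Lemma wave_sum c A W y N : (forall l s, ~~ (0 < s < 2) -> W l s = 0) ->
  (forall j, (N <= j)%N -> A j (height y) = 0) ->
  fsum (fun jm => wave c A W jm y) =
  \sum_(j < N) A j (height y) * interp c W j (rV_init y).
Proof.
move=> W0 A0; set x := rV_init y.
pose F (ja : 'I_N * {ffun 'I_d -> bool}) : nat * 'rV[int]_d :=
  (nat_of_ord ja.1, idx (2 ^ ja.1) x - bshift ja.2).
rewrite (@fsumE _ _ (map F (enum {: 'I_N * {ffun 'I_d -> bool}}))).
- rewrite big_map big_enum/= -(pair_big xpredT xpredT (fun (j : 'I_N) (a : {ffun 'I_d -> bool}) =>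
    wave c A W (nat_of_ord j, idx (2 ^ j) x - bshift a) y))/=.
  apply: eq_bigr => j _; rewrite /interp mulr_sumr; apply: eq_bigr => a _.
  exact: wave_shift.
- rewrite map_inj_uniq ?enum_uniq// => -[j a] [j' a'] [/= /val_inj jj]; subst j'.
  by move=> /addrI/oppr_inj/bshift_inj ->.
- move=> [j m]; apply: contraNeq => /(wave_neq0 W0)[Aj [a ->]].
  have jN : (j < N)%N by rewrite ltnNge; apply: contra Aj => /A0 ->.
  by apply/mapP; exists (Ordinal jN, a); rewrite ?mem_enum.
Qed.

Lemma halfspace_compact_height (K : set 'rV[R]_d.+1) : compact K -> K `<=` H ->
  exists2 e : R, 0 < e & forall y, K y -> e <= height y.
Proof.
move=> cK KH.
have ch : {within K, continuous (@height R d)}.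
  by apply: continuous_subspaceT => y; exact: coord_continuous.
have /compact_closed -/(_ (@norm_hausdorff _ _)) cl := continuous_compact ch cK.
have n0 : (~` (@height R d @` K)) 0.
  by move=> [y /KH]; rewrite /halfspace/= => y0 E; rewrite E ltxx in y0.
have /nbhs_ballP[e /= e0 be] := open_nbhs_nbhs (conj (closed_openC cl) n0).
exists e => // y Ky; rewrite leNgt; apply/negP => ye.
have := KH _ Ky; rewrite /halfspace/= => y0.
apply: (be (height y)); last by exists y.
by rewrite /ball/= sub0r normrN ger0_norm// ltW.
Qed.

(** A compact subset of the half-space stays at positive height, which bounds the
    generation, and is bounded, which bounds the indices of the cubes. *)
Lemma wave_locally_finite c A W : (forall l s, ~~ (0 < s < 2) -> W l s = 0) ->
  (forall j t, ~ layer j t -> A j t = 0) -> locally_finite H (wave c A W).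
Proof.
move=> W0 A0 K cK KH.
have [e e0 He] := halfspace_compact_height cK KH.
have [N HN] := layer_bound e0.
have [M M0 KM] := compact_sub_cbox cK.
(* bounds the indices of the cubes of generations below N that meet the compact set *)
pose L := (Num.truncn (M * 2 ^+ (2 ^ N)) + 3)%N.
pose F (ja : 'I_N * {ffun 'I_d -> 'I_(2 * L).+1}) : nat * 'rV[int]_d :=
  (nat_of_ord ja.1, \row_l ((ja.2 l)%:Z - L%:Z)).
exists (undup (map F (enum {: 'I_N * {ffun 'I_d -> 'I_(2 * L).+1}}))); first exact: undup_uniq.
move=> y [j m] Ky; apply: contraNeq => /(wave_neq0 W0)[Aj [a mE]].
have jN : (j < N)%N.
  rewrite ltnNge; apply: contra Aj => jN; rewrite A0//; apply: layer_far.
  by apply: lt_le_trans (HN j jN) (He y Ky).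
have K2 l : (0 <= m ord0 l + L%:Z < ((2 * L).+1)%:Z)%R.
  have /andP[f0 f1] := frac_itv j (rV_init y) l.
  have /andP[y1 y2] : - M <= y ord0 (lift ord_max l) <= M.
    by have := KM y Ky (lift ord_max l); rewrite ![const_mx _ _ _]mxE.
  rewrite /frac [rV_init _ _ _]mxE in f0 f1.
  have hp : 0 <= (gside j)^-1 by rewrite invr_ge0 ltW// gside_gt0.
  have hN : (gside j)^-1 <= 2 ^+ (2 ^ N).
    by rewrite /gside /side invrK ler_eXn2l ?ltr1n// leq_exp2l// ltnW.
  have b1 : (gside j)^-1 * y ord0 (lift ord_max l) <= M * 2 ^+ (2 ^ N) by nra.
  have b2 : - (M * 2 ^+ (2 ^ N)) <= (gside j)^-1 * y ord0 (lift ord_max l) by nra.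
  have tr : M * 2 ^+ (2 ^ N) < (Num.truncn (M * 2 ^+ (2 ^ N))).+1%:R by exact: truncnS_gt.
  have p1 : (idx (2 ^ j) (rV_init y) ord0 l)%:~R < ((Num.truncn (M * 2 ^+ (2 ^ N))).+1%:Z)%:~R :> R.
    by rewrite -pmulrn; lra.
  have p2 : - ((Num.truncn (M * 2 ^+ (2 ^ N))).+2%:Z)%:~R < (idx (2 ^ j) (rV_init y) ord0 l)%:~R :> R.
    by rewrite -pmulrn -[in X in X < _]natr1; lra.
  rewrite ltr_int in p1; rewrite -intrN ltr_int in p2.
  rewrite mE subE [bshift _ _ _]mxE /L; move: (Num.truncn _) p1 p2 => t p1 p2.
  move: (idx _ _ _ _) (a l : nat) (leq_b1 (a l)) p1 p2 => b a0 a1 p1 p2; clear -a1 p1 p2; lia.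
have Kn l : (absz (m ord0 l + L%:Z)%R < (2 * L).+1)%N.
  by have := K2 l; move: (m ord0 l) => b; lia.
rewrite mem_undup; apply/mapP; exists (Ordinal jN, [ffun l => Ordinal (Kn l)]).
  by rewrite mem_enum.
congr (_, _); apply/rowP => l; rewrite mxE ffunE/=; have := K2 l.
by rewrite -[m 0 l]/(m ord0 l); move: (m ord0 l) => b; lia.
Qed.

(** The differences of the coefficients that interpolation at [x] involves. *)
Definition osc c j (x : 'rV[R]_d) : R :=
  \sum_(a : {ffun 'I_d -> bool}) `|c j (idx (2 ^ j) x - bshift a) - c j (idx (2 ^ j) x)|.

Lemma osc_ge0 c j x : 0 <= osc c j x.
Proof. by apply: sumr_ge0. Qed.

(** Replacing all coefficients by that of the cube of [x] costs the oscillation. *)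
Lemma interp_osc c W j x K :
  (forall a : {ffun 'I_d -> bool}, `|\prod_l W l (frac j x l + (a l)%:R)| <= K) ->
  `|interp c W j x - c j (idx (2 ^ j) x) * \prod_l (W l (frac j x l) + W l (frac j x l + 1))| <=
  K * osc c j x.
Proof.
move=> HK.
have -> : \prod_l (W l (frac j x l) + W l (frac j x l + 1)) =
    \sum_(a : {ffun 'I_d -> bool}) \prod_l W l (frac j x l + (a l)%:R).
  rewrite -(bigA_distr_bigA (fun l (b : bool) => W l (frac j x l + b%:R))).
  by apply: eq_bigr => l _; rewrite big_bool/= addr0 addrC.
rewrite mulr_sumr /interp -sumrB; apply: le_trans (ler_norm_sum _ _ _) _.
rewrite /osc mulr_sumr; apply: ler_sum => a _.
by rewrite -mulrBl normrM mulrC ler_wpM2r.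
Qed.

Lemma rhat_pair j x l : rhat (frac j x l) + rhat (frac j x l + 1) = 1.
Proof.
by have /andP[f0 f1] := frac_itv j x l; rewrite rhat0// rhat1//; lra.
Qed.

Lemma rhat_frac j x l (b : bool) : 0 <= rhat (frac j x l + b%:R) <= 1.
Proof.
have /andP[f0 f1] := frac_itv j x l; have := ramp_itv (frac j x l).
case: b => /=; first by rewrite mulr1n rhat1//; lra.
by rewrite mulr0n addr0 rhat0.
Qed.

Lemma interp_rhat c j x : `|interp c (fun=> rhat) j x - c j (idx (2 ^ j) x)| <= osc c j x.
Proof.
have := @interp_osc c (fun=> rhat) j x 1; rewrite mul1r.
rewrite big1; last by move=> l _; exact: rhat_pair.
rewrite mulr1; apply => a; rewrite ger0_norm; last first.
  by apply: prodr_ge0 => l _; have /andP[] := rhat_frac j x l (a l).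
by apply: prodr_ile1 => l _; exact: rhat_frac.
Qed.

Lemma drhat_frac j x l (b : bool) : `|derive1 rhat (frac j x l + b%:R)| <= @rampM R.
Proof.
have /andP[f0 f1] := frac_itv j x l; have := dramp_le (frac j x l).
case: b => /=; first by rewrite mulr1n drhat1// normrN.
by rewrite mulr0n addr0 drhat0.
Qed.

(** The horizontal profiles sum to 1, so their derivatives sum to 0 and interpolation
    only sees differences of coefficients. *)
Lemma interp_drhat c j x l : `|interp c (updW (fun=> rhat) l) j x| <= @rampM R * osc c j x.
Proof.
have := @interp_osc c (updW (fun=> rhat) l) j x (@rampM R).
have /andP[f0 f1] := frac_itv j x l.
have E : \prod_l' (updW (fun=> rhat) l l' (frac j x l') + updW (fun=> rhat) l l' (frac j x l' + 1)) = 0.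
  by rewrite (bigD1 l)//= /updW eqxx drhat0// drhat1// subrr mul0r.
rewrite E mulr0 subr0; apply => a.
rewrite (bigD1 l)//= normrM /updW eqxx -[leRHS]mulr1; apply: ler_pM => //.
  exact: drhat_frac.
rewrite ger0_norm; last first.
  by apply: prodr_ge0 => l' /negbTE ->; have /andP[] := rhat_frac j x l' (a l').
by apply: prodr_ile1 => l' /negbTE ->; exact: rhat_frac.
Qed.

End waves.

(** * Averages over selected neighbours *)

Section neighbours.
Context {R : realType} {d : nat}.
Local Notation side := (@side R).

(** Move a point of the closed cube slightly towards the upper corner. *)
Lemma closed_cube_closure k (m : 'rV[int]_d) (z : 'rV[R]_d) :
  (forall i, side k * (m ord0 i)%:~R <= z ord0 i <= side k * (m ord0 i + 1)%:~R) ->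
  closure (dcube k m) z.
Proof.
move=> zm B /nbhs_ballP[r /= r0 rB]; have s0 := side_gt0 (R := R) k.
(* a proportion small enough to stay in the given ball *)
pose s := Num.min 1 (r / (2 * side k)).
have sp : 0 < s by rewrite lt_min ltr01 divr_gt0// mulr_gt0.
have s1 : s <= 1 by rewrite ge_min lexx.
have sr : s * side k < r.
  have : s <= r / (2 * side k) by rewrite ge_min lexx orbT.
  rewrite ler_pdivlMr ?mulr_gt0// => ?; nra.
pose z' : 'rV[R]_d := \row_i ((1 - s) * z ord0 i + s * (side k * (m ord0 i + 1)%:~R)).
exists z'; split.
  rewrite dcubeE => i; rewrite [X in X < _]mxE [X in _ <= X]mxE mxE.
  have /andP[h1 h2] := zm i; rewrite !intrD !mulrDr mulr1 in h1 h2 *.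
  by set A := side k * _ in h1 h2 *; apply/andP; split; nra.
apply: rB; split => // i0 i; rewrite ord1 /ball /= mxE.
have /andP[h1 h2] := zm i; rewrite !intrD !mulrDr mulr1 in h1 h2 *.
set A := side k * _ in h1 h2 *; rewrite -[z 0 i]/(z ord0 i).
by rewrite ltr_norml; apply/andP; split; nra.
Qed.

Lemma unit_shift_touching k (m e : 'rV[int]_d) : unit_shift e ->
  closure (@dcube R d k m) `&` closure (dcube k (m + e)) !=set0.
Proof.
move=> ue; have s0 := side_gt0 (R := R) k.
exists (\row_i (side k * (if (0 <= e ord0 i)%R then m ord0 i + 1 else m ord0 i)%:~R)).
split; apply: closed_cube_closure => i; rewrite [X in _ <= X <= _]mxE !ler_pM2l// !ler_int.
  by case: ifP => _; rewrite ?lexx ?andbT ?lerDl.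
rewrite [(m + e) _ _]mxE; have := ue i; case: ifPn; move: (e ord0 i) (m ord0 i) => b c; lia.
Qed.

Lemma selected_same j (m e : 'rV[int]_d) : unit_shift e ->
  selected j (@dcube R d (2 ^ j) m) (dcube (2 ^ j) (m + e)).
Proof.
move=> ue; split; last exact: unit_shift_touching.
by left; exact: dcube_dyadic.
Qed.

Lemma selected_parent j (m : 'rV[int]_d) :
  selected j (@dcube R d (2 ^ j) m) (dcube (2 ^ j.-1) (idx (2 ^ j.-1) (@corner R d (2 ^ j) m))).
Proof.
split; first by right; exact: dcube_dyadic.
exists (corner (2 ^ j) m); split; apply: subset_closure.
  exact: corner_dcube.
exact: dcube_idx.
Qed.

Lemma esum_ge_term (T : choiceType) (A : set T) (F : T -> \bar R) t :
  (forall t, 0 <= F t)%E -> A t -> (F t <= \esum_(t in A) F t)%E.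
Proof.
move=> F0 At; apply: esum_ge; exists [set t]; last by rewrite fsbig_set1.
by split => // _ ->.
Qed.

End neighbours.

Section besov_coefficients.
Context {R : realType} {d : nat}.
Variable g : 'rV[R]_d -> R.
Hypothesis ig : (@leb R d).-integrable setT (EFin \o g).

Definition coef (j : nat) (m : 'rV[int]_d) : R := average (@dcube R d (2 ^ j) m) g.

(** The [j]-th term of the Besov norm, without its weight. *)
Definition oscsum (j : nat) : \bar R :=
  (\esum_(Q in dyadic (2 ^ j)%N) (@leb R d Q *
       \esum_(Q' in selected j Q) `|average Q g - average Q' g|%R%:E))%E.

Lemma oscsum_ge0 j : (0 <= oscsum j)%E.
Proof.
apply: esum_ge0 => Q _; rewrite mule_ge0// esum_ge0// => Q' _; by rewrite lee_fin.
Qed.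

(** Retain a single selected neighbour for each cube. *)
Lemma int_selected j (P : 'rV[int]_d -> set 'rV[R]_d) :
  (forall m, selected j (@dcube R d (2 ^ j) m) (P m)) ->
  (\int[@leb R d]_x `|coef j (idx (2 ^ j) x) - average (P (idx (2 ^ j) x)) g|%:E <= oscsum j)%E.
Proof.
move=> HP; rewrite (@int_step R d (2 ^ j) (fun m => `|coef j m - average (P m) g|%:E)); last first.
  by move=> m; rewrite lee_fin.
rewrite /oscsum (@esum_dyadic R d (2 ^ j)); apply: le_esum => m _.
rewrite [@leb R d (dcube _ _)](leb_dcube _ _).
apply: lee_wpmul2l; first by rewrite lee_fin exprn_ge0// ltW// side_gt0.
apply: (esum_ge_term (F := fun Q' => `|average (dcube (2 ^ j) m) g - average Q' g|%:E)) => //.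
Qed.

Lemma int_same_level j e : unit_shift e ->
  (\int[@leb R d]_x `|coef j (idx (2 ^ j) x) - coef j (idx (2 ^ j) x + e)|%:E <= oscsum j)%E.
Proof.
by move=> ue; apply: (int_selected (P := fun m => dcube (2 ^ j) (m + e))) => m; exact: selected_same.
Qed.

Definition jump j (x : 'rV[R]_d) : R :=
  `|coef j (idx (2 ^ j) x) - coef j.-1 (idx (2 ^ j.-1) x)|.

Lemma jump_ge0 j x : 0 <= jump j x. Proof. exact: normr_ge0. Qed.

Lemma int_jump j : (\int[@leb R d]_x (jump j x)%:E <= oscsum j)%E.
Proof.
rewrite (eq_integral (fun x : lebesgueType R d => `|coef j (idx (2 ^ j) x) -
   average (dcube (2 ^ j.-1) (idx (2 ^ j.-1) (@corner R d (2 ^ j) (idx (2 ^ j) x)))) g|%:E)).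
  by apply: (int_selected (P := fun m => dcube (2 ^ j.-1) (idx (2 ^ j.-1) (@corner R d (2 ^ j) m)))) => m; exact: selected_parent.
by move=> x _; rewrite idx_corner// leq_exp2l// leq_pred.
Qed.

Lemma int_coef j : (\int[@leb R d]_x `|coef j (idx (2 ^ j) x)|%:E <= \int[@leb R d]_x `|g x|%:E)%E.
Proof.
have := @int_cube_average R d (2 ^ j) g (fun=> 0) ig.
by under eq_integral do rewrite subr0; under [X in (_ <= X)%E -> _]eq_integral do rewrite subr0.
Qed.

Lemma bshift_unit (a : {ffun 'I_d -> bool}) : unit_shift (- bshift a).
Proof. by move=> i; rewrite !mxE; case: (a i). Qed.

Lemma measurable_osc j : measurable_fun setT (osc coef j : lebesgueType R d -> R).
Proof.
exact: (@measurable_step R d (2 ^ j) _ R (fun m => \sum_(a : {ffun 'I_d -> bool})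
   `|coef j (m - bshift a) - coef j m|)).
Qed.

Lemma measurable_jump j : measurable_fun setT (jump j : lebesgueType R d -> R).
Proof.
apply: measurable_dist; first exact: (@measurable_step R d (2 ^ j) _ R (coef j)).
exact: (@measurable_step R d (2 ^ j.-1) _ R (coef j.-1)).
Qed.

Lemma int_osc j : (\int[@leb R d]_x (osc coef j x)%:E <= (2 ^+ d)%:E * oscsum j)%E.
Proof.
rewrite (eq_integral (fun x : lebesgueType R d => \sum_(a : {ffun 'I_d -> bool})
    `|coef j (idx (2 ^ j) x - bshift a) - coef j (idx (2 ^ j) x)|%:E)%E); last first.
  by move=> x _; rewrite sumEFin.
rewrite ge0_integral_sum; first last.
- by move=> a x _; rewrite lee_fin.
- move=> a; apply/measurable_EFinP.
  exact: (@measurable_step R d (2 ^ j) _ R (fun m => `|coef j (m - bshift a) - coef j m|)).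
- exact: measurableT.
have -> : ((2 ^+ d)%:E * oscsum j = \sum_(a : {ffun 'I_d -> bool}) oscsum j)%E.
  under [RHS]eq_bigr do rewrite -(mul1e (oscsum j)).
  rewrite -ge0_sume_distrl; last by move=> a _; rewrite lee_fin.
  by rewrite sumEFin sumr_const card_ffun card_bool card_ord natrX.
apply: lee_sum => a _; under eq_integral do rewrite distrC.
exact: (int_same_level j (bshift_unit a)).
Qed.

(** The differences of averages that control the gradient of the extension on the
    layer of generation [j].  In generation 0 nothing precedes, and the average itself
    is what the vertical profile cuts off. *)
Definition variation j (x : 'rV[R]_d) : R :=
  osc coef j x + (if j is 0 then `|coef 0 (idx (2 ^ 0) x)| else osc coef j.-1 x + jump j x).

Lemma variation_ge0 j x : 0 <= variation j x.
Proof. rewrite /variation; apply: addr_ge0; first exact: osc_ge0.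
by case: j => // j; apply: addr_ge0; [exact: osc_ge0|exact: jump_ge0]. Qed.

Lemma int_variation0 : (\int[@leb R d]_x (variation 0 x)%:E <=
  (2 ^+ d)%:E * oscsum 0 + \int[@leb R d]_x `|g x|%:E)%E.
Proof.
have m0 : measurable_fun setT (fun x : lebesgueType R d => `|coef 0 (idx (2 ^ 0) x)|).
  exact: (@measurable_step R d (2 ^ 0) _ R (fun m => `|coef 0 m|)).
rewrite /variation (nn_int_add _ measurableT (measurable_osc 0) m0)//; last by move=> x _; exact: osc_ge0.
by apply: leeD; [exact: int_osc|exact: int_coef].
Qed.

Lemma int_variationS j : (\int[@leb R d]_x (variation j.+1 x)%:E <=
  (2 ^+ d)%:E * oscsum j.+1 + ((2 ^+ d)%:E * oscsum j + oscsum j.+1))%E.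
Proof.
have m2 := measurable_funD (measurable_osc j) (measurable_jump j.+1).
rewrite /variation (nn_int_add _ measurableT (measurable_osc j.+1) m2); last 2 first.
- by move=> x _; exact: osc_ge0.
- by move=> x _; apply: addr_ge0; [exact: osc_ge0|exact: jump_ge0].
apply: leeD; first exact: int_osc.
rewrite (nn_int_add _ measurableT (measurable_osc j) (measurable_jump j.+1)); last 2 first.
- by move=> x _; exact: osc_ge0.
- by move=> x _; exact: jump_ge0.
by apply: leeD; [exact: int_osc|exact: int_jump].
Qed.

Lemma osc_corner j k x : (j <= k)%N -> osc coef j (corner (2 ^ k) (idx (2 ^ k) x)) = osc coef j x.
Proof. by move=> jk; rewrite /osc idx_corner// leq_exp2l. Qed.

Lemma variation_corner j x : variation j (corner (2 ^ j) (idx (2 ^ j) x)) = variation j x.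
Proof.
rewrite /variation (osc_corner x (leqnn j)); congr (_ + _); case: j => [|j].
  by rewrite idx_corner.
have le : (2 ^ j <= 2 ^ j.+1)%N by rewrite leq_exp2l.
by rewrite (osc_corner x (leqnSn j)) /jump (idx_corner x (leqnn _)) (idx_corner x le).
Qed.

End besov_coefficients.

(** * The weight on the layers of the extension *)

Section layers.
Context {R : realType} {d : nat}.
Local Notation side := (@side R).
Local Notation gside := (@gside R).
Local Notation H := (@halfspace R d).
Variable lambda : R.
Hypothesis l0 : 0 < lambda.

Definition band (l u : R) : set 'rV[R]_d.+1 := [set y | l < height y <= u].

Lemma measurable_band l u : measurable (band l u : set (lebesgueType R d.+1)).
Proof.
have := @measurable_height R d measurableT _ (measurable_itv `]l, u]).
by rewrite setTI; congr measurable; apply/seteqP; split => y; rewrite /band /= in_itv.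
Qed.

Lemma band_fiber k m l u : band l u `&` (fun y => idx k (rV_init y)) @^-1` [set m] = slab k m l u.
Proof. by apply/seteqP; split => y; rewrite /slab /band /= -?dcubeP => -[]; rewrite ?dcubeP. Qed.

Lemma measurable_init_fiber k m :
  measurable ((fun y : lebesgueType R d.+1 => idx k (rV_init y)) @^-1` [set m]).
Proof.
have mi : measurable_fun setT (fun y : lebesgueType R d.+1 => rV_init y : 'rV[R]_d).
  apply: measurable_leb; apply: measurable_fun_rV => i.
  under eq_fun do rewrite mxE; exact: measurable_coord.
have := mi measurableT _ (measurable_dcube k m); rewrite setTI; congr measurable.
by apply/seteqP; split => y /dcubeP.
Qed.

Lemma measurable_init_step k (V : 'rV[int]_d -> R) :
  measurable_fun setT (fun y : lebesgueType R d.+1 => V (idx k (rV_init y))).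
Proof.
move=> _ A mA; rewrite setTI.
have -> : (fun y : lebesgueType R d.+1 => V (idx k (rV_init y))) @^-1` A =
   \bigcup_(m in [set m | A (V m)]) (fun y : lebesgueType R d.+1 => idx k (rV_init y)) @^-1` [set m].
  by apply/seteqP; split => [y Ay|y [m Am /= ->]]//; exists (idx k (rV_init y)).
by apply: bigcup_countType_measurable => m _; exact: measurable_init_fiber.
Qed.

(** Fubini for functions of [x] that are constant on the cubes of one level. *)
Lemma int_band k (V : 'rV[int]_d -> R) l u : l <= u -> (forall m, 0 <= V m) ->
  (\int[@leb R d.+1]_(y in band l u) (V (idx k (rV_init y)))%:E =
   (u - l)%:E * \int[@leb R d]_x (V (idx k x))%:E)%E.
Proof.
move=> lu V0.
have mV : measurable_fun (band l u : set (lebesgueType R d.+1)) (fun y => (V (idx k (rV_init y)))%:E).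
  by apply/measurable_EFinP; apply: measurable_funTS; exact: measurable_init_step.
rewrite (fiber_integral (@leb R d.+1) (measurable_band l u) (measurable_init_fiber k) mV); last first.
  by move=> y _; rewrite lee_fin.
rewrite (@int_step R d k (fun m => (V m)%:E)); last by move=> m; rewrite lee_fin.
rewrite -esumZl; last 2 first.
- by move=> m; rewrite mule_ge0// lee_fin// exprn_ge0// ltW// side_gt0.
- by rewrite subr_ge0.
apply: eq_esum => m _.
transitivity (\int[@leb R d.+1]_(y in slab k m l u) (V m)%:E)%E.
  by rewrite band_fiber; apply: eq_integral => y /set_mem[/dcubeP <-].
rewrite integral_cst; last exact: measurable_slab.
by rewrite [X in (_ * X)%E](leb_slab k m lu) muleA -!EFinM; congr EFin; ring.
Qed.

(** On the layer of generation [j] the logarithm is at most [ln (1 / gside j.+1)], which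
    is [2 ^ j.+1 * ln 2]. *)
Definition lweight j : R := 2 `^ lambda * (2 ^+ j + 2) `^ lambda.

Lemma lweight_ge0 j : 0 <= lweight j.
Proof. by rewrite /lweight mulr_ge0// powR_ge0. Qed.

Lemma ln2_le1 : ln 2 <= 1 :> R.
Proof. by have := @le_ln1Dx R 1; rewrite (_ : 1 + 1 = 2); [apply; lra|lra]. Qed.

Lemma layer_weight j (y : 'rV[R]_d.+1) : 4 * gside j.+1 < height y -> weight lambda y <= lweight j.
Proof.
have hp := gside_gt0 (R := R) j.+1.
move=> ty; have y0 : 0 < height y by lra.
rewrite weightE// /lweight -powRM ?addr_ge0 ?exprn_ge0//; apply: ge0_ler_powR.
- exact: ltW.
- by rewrite nnegrE; apply: le_trans (wbase_ge _) => //; rewrite ln4E mulr_ge0// ltW// ln2_gt0.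
- by rewrite nnegrE mulr_ge0 ?addr_ge0 ?exprn_ge0.
have L0 := ln2_gt0 (R := R); have L1 := ln2_le1.
have p1 : 1 <= 2 ^+ j :> R by rewrite exprn_ege1// ler1n.
rewrite /wbase; case: ifP => _; last by rewrite ln4E; nra.
apply: (@le_trans _ _ (ln (2 ^+ (2 ^ j.+1)))).
  rewrite ler_ln ?posrE ?divr_gt0 ?exprn_gt0// ler_pdivrMr//.
  have : gside j.+1 * 2 ^+ (2 ^ j.+1) = 1 by rewrite /gside /side mulVf// expf_neq0.
  have : 0 < 2 ^+ (2 ^ j.+1) :> R by rewrite exprn_gt0.
  move: (2 ^+ (2 ^ j.+1)) => P P0 E; rewrite mulrC; nra.
rewrite lnXn// -[ln 2 *+ _]mulr_natl natrX exprS; nra.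
Qed.

Lemma int_layer j (V : 'rV[R]_d -> R) :
  (forall x, 0 <= V x) -> (forall x, V x = V (corner (2 ^ j) (idx (2 ^ j) x))) ->
  (\int[@leb R d.+1]_(y in H) (\1_(layer j) (height y) * V (rV_init y) * weight lambda y)%:E <=
   (lweight j * (8 * gside j))%:E * \int[@leb R d]_x (V x)%:E)%E.
Proof.
move=> V0 VE; have hp := gside_gt0 (R := R) j.+1; have hj := gside_gt0 (R := R) j; have hl := @gside_lt R j.
have W0 := lweight_ge0 j.
pose U m := V (corner (2 ^ j) m).
have mB := measurable_band (4 * gside j.+1) (8 * gside j).
have E1 : (\int[@leb R d.+1]_(y in band (4 * gside j.+1) (8 * gside j)) (lweight j * U (idx (2 ^ j) (rV_init y)))%:E =
   (8 * gside j - 4 * gside j.+1)%:E * \int[@leb R d]_x (lweight j * U (idx (2 ^ j) x))%:E)%E.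
  by apply: (@int_band (2 ^ j) (fun m => lweight j * U m)); [lra|move=> m; apply: mulr_ge0 => //; exact: V0].
have mU : measurable_fun setT (fun x : lebesgueType R d => U (idx (2 ^ j) x)).
  exact: (@measurable_step R d (2 ^ j) _ R U).
rewrite [X in (_ <= _ * X)%E](eq_integral (fun x : lebesgueType R d => (U (idx (2 ^ j) x))%:E)); last first.
  by move=> x _; rewrite VE.
have U0 : (0 <= \int[@leb R d]_x (U (idx (2 ^ j) x))%:E)%E.
  by apply: integral_ge0 => x _; rewrite lee_fin; exact: V0.
apply: (@le_trans _ _ ((8 * gside j - 4 * gside j.+1)%:E * \int[@leb R d]_x (lweight j * U (idx (2 ^ j) x))%:E)%E); last first.
  rewrite (nn_int_scale _ measurableT mU)//; last by move=> x _; exact: V0.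
  rewrite muleA -EFinM; apply: lee_wpmul2r => //; rewrite lee_fin mulrC ler_wpM2l//; lra.
rewrite -E1.
have BH : band (4 * gside j.+1) (8 * gside j) `<=` H.
  by move=> y /andP[y1 _]; rewrite /halfspace/=; lra.
rewrite (_ : band (4 * gside j.+1) (8 * gside j) = H `&` band (4 * gside j.+1) (8 * gside j)); last exact/esym/setIidPr.
set B := H `&` _.
have mH := @measurable_halfspace R d.
have mHB : measurable (B : set (lebesgueType R d.+1)) by exact: measurableI.
have mUi := @measurable_init_step (2 ^ j) U.
pose F (y : 'rV[R]_d.+1) := \1_(layer j) (height y) * V (rV_init y) * weight lambda y.
have FB y : H y -> ~ band (4 * gside j.+1) (8 * gside j) y -> F y = 0.
  move=> _ yB; rewrite /F indicE memNset ?mul0r// => /andP[y1 y2].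
  by apply: yB; rewrite /band /= y1 ltW.
have -> : (\int[@leb R d.+1]_(y in H) (F y)%:E = \int[@leb R d.+1]_(y in B) (F y)%:E)%E.
  rewrite [RHS]integral_mkcondr; apply: eq_integral => y /set_mem Hy.
  rewrite patchE; case: ifPn => // yB; rewrite FB//; by apply: contraNnot yB => ?; rewrite inE.
have mL : measurable (layer j : set R).
  rewrite (_ : layer j = `]4 * gside j.+1, 8 * gside j[%classic); first exact: measurable_itv.
  by apply/seteqP; split => t; rewrite /layer /= in_itv.
have mF : measurable_fun (H : set (lebesgueType R d.+1)) F.
  apply: measurable_funM; last exact: measurable_weight.
  apply: measurable_funM.
    apply: measurable_funTS.
    exact: (measurableT_comp (measurable_indic mL) (@measurable_height R d)).
  have -> : (fun y : lebesgueType R d.+1 => V (rV_init y)) = (fun y : lebesgueType R d.+1 => U (idx (2 ^ j) (rV_init y))).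
    by apply/funext => y; rewrite VE.
  exact: measurable_funTS.
apply: nn_int_le.
- exact: mHB.
- by apply: measurable_funS mF; [exact: mH|exact: subIsetl].
- apply: measurable_funM; first exact: measurable_cst.
  exact: measurable_funTS.
- by move=> y _; rewrite /F !mulr_ge0 ?weight_ge0.
- move=> y [Hy yB]; rewrite /F mulrC; apply: ler_pM => //.
  + exact: weight_ge0.
  + by rewrite mulr_ge0.
  + by apply: layer_weight; have /andP[] := yB.
  + by rewrite VE -/(U _) indicE; case: (_ \in _); rewrite ?mul1r// mul0r; exact: V0.
Qed.

(** Thickness times weight of each layer times the horizontal integral; the hypothesis
    is pointwise, with a number of layers depending on the point. *)
Lemma int_layers (F : 'rV[R]_d.+1 -> R) (K : nat -> R) (V : nat -> 'rV[R]_d -> R) :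
  measurable_fun (H : set (lebesgueType R d.+1)) F ->
  (forall j, 0 <= K j) -> (forall j x, 0 <= V j x) ->
  (forall j x, V j x = V j (corner (2 ^ j) (idx (2 ^ j) x))) ->
  (forall y, H y -> exists N, `|F y| <=
     \sum_(j < N) \1_(layer j) (height y) * (K j * V j (rV_init y))) ->
  (\int[@leb R d.+1]_(y in H) (`|F y| * weight lambda y)%:E <=
   \sum_(0 <= j <oo) ((K j * lweight j * (8 * gside j))%:E * \int[@leb R d]_x (V j x)%:E))%E.
Proof.
move=> mF K0 V0 VE FE; have mH := @measurable_halfspace R d.
have mw := @measurable_weight R d lambda.
pose G j (y : 'rV[R]_d.+1) := \1_(layer j) (height y) * (K j * V j (rV_init y)) * weight lambda y.
have G0 j y : 0 <= G j y by rewrite /G !mulr_ge0 ?weight_ge0.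
have mG j : measurable_fun (H : set (lebesgueType R d.+1)) (G j).
  apply: measurable_funM; last exact: mw.
  have mL : measurable (layer j : set R).
    rewrite (_ : layer j = `]4 * gside j.+1, 8 * gside j[%classic); first exact: measurable_itv.
    by apply/seteqP; split => t; rewrite /layer /= in_itv.
  apply: measurable_funM.
    apply: measurable_funTS.
    exact: (measurableT_comp (measurable_indic mL) (@measurable_height R d)).
  apply: measurable_funM; first exact: measurable_cst.
  have -> : (fun y : lebesgueType R d.+1 => V j (rV_init y)) =
     (fun y : lebesgueType R d.+1 => V j (corner (2 ^ j) (idx (2 ^ j) (rV_init y)))).
    by apply/funext => y; rewrite VE.
  apply: measurable_funTS; exact: (@measurable_init_step (2 ^ j) (fun m => V j (corner (2 ^ j) m))).
apply: (@le_trans _ _ (\int[@leb R d.+1]_(y in H) \sum_(0 <= j <oo) (G j y)%:E)%E).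
  apply: ge0_le_integral.
  - exact: mH.
  - by move=> y _; rewrite lee_fin mulr_ge0// weight_ge0.
  - apply/measurable_EFinP; apply: measurable_funM; last exact: mw.
    by apply: measurableT_comp => //; exact: mF.
  - apply: ge0_emeasurable_sum => j; first by move=> y _ _; rewrite lee_fin.
    by move=> _; apply/measurable_EFinP; exact: mG.
  - move=> y Hy; have [N HN] := FE y Hy.
    apply: (@le_trans _ _ (\sum_(0 <= j < N) (G j y)%:E)%E); last first.
      by apply: nneseries_lim_ge => j _ _; rewrite lee_fin.
    rewrite sumEFin lee_fin big_mkord /G -mulr_suml; apply: ler_wpM2r => //.
    exact: weight_ge0.
rewrite integral_nneseries; first last.
- by move=> j y _; rewrite lee_fin.
- by move=> j; apply/measurable_EFinP; exact: mG.
- exact: mH.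
apply: lee_nneseries => [j _ _|j _]; first by apply: integral_ge0 => y _; rewrite lee_fin.
have V0' x : 0 <= K j * V j x by rewrite mulr_ge0.
apply: le_trans (int_layer (V := fun x => K j * V j x) V0' _) _.
  by move=> x; rewrite -VE.
rewrite (nn_int_scale _ measurableT)//.
- by rewrite muleA -EFinM le_eqVlt; apply/orP; left; apply/eqP; congr (_%:E * _)%E; ring.
- have -> : (V j : lebesgueType R d -> R) = (fun x => V j (corner (2 ^ j) (idx (2 ^ j) x))).
    by apply/funext => x; rewrite -VE.
  exact: (@measurable_step R d (2 ^ j) _ R (fun m => V j (corner (2 ^ j) m))).
Qed.

End layers.

(** * The extension and its energy *)

Section summability.
Context {R : realType}.
Local Notation gside := (@gside R).

Lemma nneseries_lt_pinfty (u : nat -> \bar R) (M : \bar R) : (M < +oo)%E ->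
  (forall j, 0 <= u j)%E -> (forall n, (\sum_(0 <= j < n) u j <= M)%E) ->
  (\sum_(0 <= j <oo) u j < +oo)%E.
Proof.
move=> Moo u0 H; apply: le_lt_trans Moo; apply: lime_le.
  by apply: is_cvg_nneseries => j _ _; exact: u0.
exact: nearW.
Qed.

(** Powers are dominated by exponentials; read off from the term of degree [N] of the
    exponential series. *)
Lemma powR_le_exp2 (mu : R) : 0 < mu ->
  exists C : R, 0 <= C /\ forall n : nat, (n%:R + 2) `^ mu <= C * 2 ^+ n.
Proof.
move=> mu0; pose N := (Num.truncn mu).+1.
have muN : mu <= N%:R by apply/ltW; exact: truncnS_gt.
have L0 := ln2_gt0 (R := R).
exists (N`!%:R / ln 2 ^+ N * 2 ^+ 2); split.
  by rewrite mulr_ge0// divr_ge0// exprn_ge0// ltW.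
move=> n; have z1 : 1 <= n%:R + 2 :> R by have := ler0n R n; lra.
apply: (@le_trans _ _ ((n%:R + 2) `^ N%:R)); first exact: ler_powR.
rewrite powR_mulrn; last by apply: le_trans z1.
have := @expR_ge1Dxn R ((n%:R + 2) * ln 2) N.-1.
rewrite mulr_ge0 ?(ltW L0) ?(le_trans _ z1)// => /(_ isT); rewrite -/N.
have -> : expR ((n%:R + 2) * ln 2) = 2 ^+ (n + 2) :> R.
  by rewrite -(natrD _ n 2) mulrC expRM_natr lnK// posrE.
rewrite exprMn exprD => H.
have {}H : (n%:R + 2 : R) ^+ N * ln 2 ^+ N / N`!%:R <= 2 ^+ n * 2 ^+ 2.
  by apply: le_trans H; rewrite lerDr.
have F0 : 0 < N`!%:R :> R by rewrite ltr0n fact_gt0.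
have LN : 0 < ln 2 ^+ N :> R by rewrite exprn_gt0.
move: H; rewrite ler_pdivrMr// -ler_pdivlMr// => /le_trans; apply.
by rewrite le_eqVlt; apply/orP; left; apply/eqP; field; rewrite !gt_eqF.
Qed.

(** The edges [2 ^- (2 ^ j)] decay doubly exponentially, and by [powR_le_exp2] at
    [lambda + 1] beat [(2 ^ j + 2) ^ lambda] with a factor [2 ^- j] to spare. *)
Lemma weighted_sides_fin (lambda : R) : 0 < lambda ->
  (\sum_(0 <= j <oo) ((2 ^+ j + 2) `^ lambda * gside j)%:E < +oo)%E.
Proof.
move=> l0; have l1 : 0 < lambda + 1 by lra.
have [C [C0 HC]] := powR_le_exp2 l1.
have term j : (2 ^+ j + 2) `^ lambda * gside j <= C * (1 / 2) ^+ j :> R.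
  have := HC (2 ^ j)%N; rewrite natrX.
  have z0 : 0 < 2 ^+ j + 2 :> R by rewrite addr_gt0// exprn_gt0.
  rewrite powRD; last by rewrite gt_eqF ?implybT.
  rewrite powRr1; last exact: ltW.
  have P0 : 0 <= (2 ^+ j + 2) `^ lambda :> R by exact: powR_ge0.
  have q0 : 0 < 2 ^+ j :> R by rewrite exprn_gt0.
  have Q0 : 0 < 2 ^+ (2 ^ j) :> R by rewrite exprn_gt0.
  move=> H; rewrite /gside /side ler_pdivrMr// expr_div_n expr1n mulrA mulrAC ler_pdivlMr//.
  by rewrite mulr1; apply: le_trans H; nra.
apply: (@nneseries_lt_pinfty _ (C * 2)%:E); first exact: ltry.
  by move=> j; rewrite lee_fin mulr_ge0 ?powR_ge0// ltW// gside_gt0.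
move=> n; rewrite sumEFin lee_fin.
apply: (@le_trans _ _ (\sum_(0 <= j < n) C * (1 / 2) ^+ j)); first by apply: ler_sum.
rewrite -mulr_sumr ler_wpM2l//.
have E : \sum_(0 <= j < n) (1 / 2) ^+ j = 2 - 2 * (1 / 2) ^+ n :> R.
  elim: n => [|n IH]; first by rewrite big_geq// expr0; lra.
  by rewrite big_nat_recr//= IH exprS; lra.
by rewrite E gerBl mulr_ge0// exprn_ge0.
Qed.

End summability.

Section extension.
Context {R : realType} {d : nat}.
Local Notation gside := (@gside R).
Local Notation H := (@halfspace R d).
Variables (g : 'rV[R]_d -> R) (lambda : R).
Hypothesis l0 : 0 < lambda.
Hypothesis bg : besov d lambda g.

Local Notation coef := (coef g).
Local Notation oscsum := (oscsum g).

Lemma besov_integrable : (@leb R d).-integrable setT (EFin \o g).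
Proof.
have [[mg _] ng] := bg; apply/integrableP; split; first exact/measurable_EFinP.
apply: le_lt_trans ng; apply: leeDl; apply: nneseries_ge0 => j _ _.
by rewrite mule_ge0 ?lee_fin ?powR_ge0//; exact: oscsum_ge0.
Qed.

Lemma besov_oscsum_fin : (\sum_(0 <= j <oo) (((2 ^+ j + 2) `^ lambda)%:E * oscsum j) < +oo)%E.
Proof.
have [_ ng] := bg; apply: le_lt_trans ng; apply: leeDr.
by apply: integral_ge0 => x _; rewrite lee_fin.
Qed.

Let ig := besov_integrable.

Local Notation gmass := (\int[@leb R d]_x `|g x|%:E)%E.

Lemma gmass_fin : (gmass < +oo)%E. Proof. by move/integrableP : ig => []. Qed.
Lemma gmass_ge0 : (0 <= gmass)%E. Proof. by apply: integral_ge0 => x _; rewrite lee_fin. Qed.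

Definition hats : 'I_d -> R -> R := fun=> rhat.
Definition ewave := wave coef (@vprof R) hats.
Definition ext (y : 'rV[R]_d.+1) : R := fsum (ewave ^~ y).
Definition egrad (y : 'rV[R]_d.+1) : 'rV[R]_d.+1 := \row_i fsum (fun jm => partial i (ewave jm) y).

Lemma halfspace_open : open H.
Proof.
apply: (@open_comp _ _ (@height R d) [set t | 0 < t]); last exact: open_gt.
by move=> y _; exact: coord_continuous.
Qed.

Let hats0 : forall l s, ~~ (0 < s < 2) -> hats l s = 0.
Proof. by move=> l s; exact: rhat_out. Qed.
Let dhats0 : forall i l s, ~~ (0 < s < 2) -> updW hats i l s = 0.
Proof. by move=> i l s; rewrite /updW; case: eqP => _; [exact: drhat_out|exact: rhat_out]. Qed.
Let shats : forall l, smooth1 (hats l). Proof. by move=> l; exact: rhat_smooth. Qed.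

Lemma ewave_height jm : partial ord_max (ewave jm) = wave coef (fun j => derive1 (@vprof R j)) hats jm.
Proof. by apply: wave_partial_height => // j; exact: vprof_smooth. Qed.

Lemma ewave_lift l jm : partial (lift ord_max l) (ewave jm) =
  wave coef (fun j t => (gside j)^-1 * vprof j t) (updW hats l) jm.
Proof. by apply: wave_partial_lift => // j; exact: vprof_smooth. Qed.

Lemma smooth_ewave jm : smooth (ewave jm).
Proof. by apply: wave_smooth => // j; exact: vprof_smooth. Qed.

Lemma locally_finite_ewave : locally_finite H ewave.
Proof. by apply: wave_locally_finite => // j t; exact: vprof_out. Qed.

Lemma locally_finite_dewave i : locally_finite H (fun jm => partial i (ewave jm)).
Proof.
case: (unliftP ord_max i) => [l ->|->].
  rewrite (_ : (fun jm => _) = wave coef (fun j t => (gside j)^-1 * vprof j t) (updW hats l)).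
    apply: wave_locally_finite; first exact: dhats0.
    by move=> j t /vprof_out ->; rewrite mulr0.
  by apply/funext => jm; exact: ewave_lift.
rewrite (_ : (fun jm => _) = wave coef (fun j => derive1 (@vprof R j)) hats).
  by apply: wave_locally_finite => // j t; exact: dvprof_out.
by apply/funext => jm; exact: ewave_height.
Qed.

Lemma L1loc_ext : L1loc H ext.
Proof.
apply: L1loc_fsum; last exact: locally_finite_ewave.
by move=> jm; apply: smooth_continuous; exact: smooth_ewave.
Qed.

Lemma egrad_weak i : L1loc H (fun y => egrad y ord0 i) /\ weak_partial H i ext (fun y => egrad y ord0 i).
Proof.
have -> : (fun y => egrad y ord0 i) = (fun y => fsum (fun jm => partial i (ewave jm) y)).
  by apply/funext => y; rewrite mxE.
split.
  apply: L1loc_fsum; last exact: locally_finite_dewave.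
  by move=> jm; apply: smooth_partial_continuous; exact: smooth_ewave.
apply: weak_partial_fsum.
- exact: halfspace_open.
- exact: smooth_ewave.
- exact: locally_finite_ewave.
- exact: locally_finite_dewave.
Qed.

Lemma ext_sum y N : (forall j, (N <= j)%N -> 8 * gside j < height y) ->
  ext y = \sum_(j < N) vprof j (height y) * interp coef hats j (rV_init y).
Proof.
move=> HN; apply: wave_sum => // j Nj; apply: vprof_out; apply: layer_far; exact: HN.
Qed.

Definition base j (x : 'rV[R]_d) : R := `|coef j (idx (2 ^ j) x)| + osc coef j x.

Lemma interp_base j x : `|interp coef hats j x| <= base j x.
Proof.
have H1 := interp_rhat coef j x; rewrite -/hats in H1.
rewrite -[X in `|X|](subrK (coef j (idx (2 ^ j) x))).
by apply: le_trans (ler_normD _ _) _; rewrite /base [leRHS]addrC lerD2r.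
Qed.

Lemma ext_le y : H y -> exists N, `|ext y| <=
  \sum_(j < N) \1_(layer j) (height y) * (1 * base j (rV_init y)).
Proof.
move=> Hy; have [N HN] := layer_bound Hy; exists N; rewrite (ext_sum HN).
apply: le_trans (ler_norm_sum _ _ _) _; apply: ler_sum => j _.
rewrite normrM indicE; case: (boolP (height y \in _)) => [_|yl].
  have /andP[v0 v1] := vprof_itv j (height y).
  rewrite mul1r mul1r ger0_norm//; apply: le_trans (interp_base j _).
  by rewrite ler_piMl.
by rewrite vprof_out ?normr0 ?mul0r// => h; move: yl; rewrite mem_set.
Qed.

Definition dscale j : R := (gside j)^-1 * @rampM R.

Lemma dscale_ge0 j : 0 <= dscale j.
Proof. by rewrite /dscale mulr_ge0 ?rampM_ge0// invr_ge0 ltW// gside_gt0. Qed.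

Lemma egrad_lift_le l y : H y -> exists N, `|egrad y ord0 (lift ord_max l)| <=
  \sum_(j < N) \1_(layer j) (height y) * (dscale j * variation g j (rV_init y)).
Proof.
move=> Hy; have [N HN] := layer_bound Hy; exists N; rewrite mxE.
rewrite (_ : (fun jm => _) = (fun jm => wave coef (fun j t => (gside j)^-1 * vprof j t) (updW hats l) jm y)); last first.
  by apply/funext => jm; rewrite ewave_lift.
rewrite (wave_sum (N := N) _ (dhats0 l)); last first.
  by move=> j Nj; rewrite vprof_out ?mulr0//; apply: layer_far; exact: HN.
apply: le_trans (ler_norm_sum _ _ _) _; apply: ler_sum => j _.
have hj := gside_gt0 (R := R) j.
rewrite indicE; case: (boolP (height y \in _)) => [_|yl]; last first.
  by rewrite vprof_out ?mulr0 ?mul0r ?normr0// => h; move: yl; rewrite mem_set.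
have /andP[v0 v1] := vprof_itv j (height y).
rewrite mul1r normrM ger0_norm; last by rewrite mulr_ge0// invr_ge0 ltW.
have I := interp_drhat coef j (rV_init y) l; rewrite -/hats in I.
have V : osc coef j (rV_init y) <= variation g j (rV_init y).
  rewrite /variation lerDl; case: (j : nat) => // j'; apply: addr_ge0; [exact: osc_ge0|exact: jump_ge0].
rewrite /dscale -!mulrA; apply: ler_wpM2l; first by rewrite invr_ge0 ltW.
apply: (@le_trans _ _ (`|interp coef (updW hats l) j (rV_init y)|)).
  by rewrite ler_piMl.
by apply: le_trans I _; rewrite ler_wpM2l// rampM_ge0.
Qed.

Definition previous (G : nat -> R) j : R := if j is n.+1 then G n else 0.

Lemma summation_by_parts (X G : nat -> R) N :
  \sum_(j < N) (X j.+1 - X j) * G j =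
  X N * previous G N - \sum_(j < N) X j * (G j - previous G j).
Proof.
elim: N => [|N IH]; first by rewrite !big_ord0 mulr0 subr0.
by rewrite !big_ord_recr/= IH; ring.
Qed.

(** The vertical profiles are differences of consecutive cutoffs.  Summation by parts
    moves this difference to the interpolations of consecutive generations, so that the
    vertical derivative also sees only differences of averages. *)
Lemma egrad_height_le y : H y -> exists N, `|egrad y ord0 ord_max| <=
  \sum_(j < N) \1_(layer j) (height y) * (dscale j * variation g j (rV_init y)).
Proof.
move=> Hy; have [N HN] := layer_bound Hy; exists N; rewrite mxE.
set t := height y; set x := rV_init y.
rewrite (_ : (fun jm => _) = (fun jm => wave coef (fun j => derive1 (@vprof R j)) hats jm y)); last first.
  by apply/funext => jm; rewrite ewave_height.
rewrite (wave_sum (N := N) _ hats0); last first.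
  by move=> j Nj; rewrite dvprof_out//; apply: layer_far; exact: HN.
rewrite -/t -/x.
under eq_bigr do rewrite dvprof.
rewrite (summation_by_parts (fun j => dlayer j t) (fun j => interp coef hats j x)).
(* the boundary term vanishes because the point lies above the N-th transition *)
have -> : dlayer N t = 0.
  apply: dlayer_out; rewrite negb_and -!leNgt; apply/orP; right; apply/ltW; exact: HN.
rewrite mul0r sub0r normrN; apply: le_trans (ler_norm_sum _ _ _) _; apply: ler_sum => j _.
rewrite indicE; case: (boolP (t \in _)) => [_|yl]; last first.
  rewrite mul0r dlayer_out ?mul0r ?normr0//; apply: contra yl => /andP[t1 t2].
  by rewrite inE /layer /= t2 andbT; apply: lt_trans t1; rewrite ltr_pM2l// gside_lt.
rewrite mul1r normrM; apply: ler_pM => //; first exact: dlayer_le.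
rewrite /variation; case: (j : nat) => [|n].
  by rewrite /previous subr0; apply: le_trans (interp_base 0 x) _; rewrite addrC.
have I1 := interp_rhat coef n.+1 x; have I2 := interp_rhat coef n x; rewrite -/hats in I1 I2.
rewrite /jump /previous /=.
set a := interp _ _ _ _ in I1 *; set b := interp _ _ _ _ in I2 *.
set a' := coef n.+1 _ in I1 *; set b' := coef n _ in I2 *.
(* compare the interpolations with the averages they interpolate, on both generations *)
have -> : a - b = (a - a') + ((b' - b) + (a' - b')) by ring.
apply: le_trans (ler_normD _ _) _; apply: lerD => //.
by apply: le_trans (ler_normD _ _) _; apply: lerD => //; rewrite distrC.
Qed.

Lemma egrad_le i y : H y -> exists N, `|egrad y ord0 i| <=
  \sum_(j < N) \1_(layer j) (height y) * (dscale j * variation g j (rV_init y)).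
Proof.
by case: (unliftP ord_max i) => [l ->|->]; [exact: egrad_lift_le|exact: egrad_height_le].
Qed.

Lemma base_ge0 j x : 0 <= base j x.
Proof. by apply: addr_ge0 => //; exact: osc_ge0. Qed.

Lemma base_corner j x : base j x = base j (corner (2 ^ j) (idx (2 ^ j) x)).
Proof. by rewrite /base (osc_corner g x (leqnn j)) (idx_corner x (leqnn _)). Qed.

Lemma int_base j : (\int[@leb R d]_x (base j x)%:E <= gmass + (2 ^+ d)%:E * oscsum j)%E.
Proof.
have m0 : measurable_fun setT (fun x : lebesgueType R d => `|coef j (idx (2 ^ j) x)|).
  exact: (@measurable_step R d (2 ^ j) _ R (fun m => `|coef j m|)).
rewrite /base (nn_int_add _ measurableT m0 (measurable_osc g j))//; last by move=> x _; exact: osc_ge0.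
by apply: leeD; [exact: int_coef|exact: int_osc].
Qed.

(** The mass of [g] is the same on all layers, whose weighted thicknesses are summable. *)
Lemma int_ext_fin : (\int[@leb R d.+1]_(y in H) (`|ext y| * weight lambda y)%:E < +oo)%E.
Proof.
have c0 j : 0 <= (2 ^+ j + 2) `^ lambda :> R by exact: powR_ge0.
have hp j : 0 <= gside j by rewrite ltW// gside_gt0.
have p0 : 0 <= 2 `^ lambda :> R by exact: powR_ge0.
have os0 j : (0 <= oscsum j)%E by exact: oscsum_ge0.
apply: le_lt_trans (int_layers l0 L1loc_ext.1 (fun=> ler01) base_ge0 base_corner ext_le) _.
apply: (@le_lt_trans _ _ (\sum_(0 <= j <oo)
   ((8 * 2 `^ lambda)%:E * gmass * ((2 ^+ j + 2) `^ lambda * gside j)%:E +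
    (8 * 2 `^ lambda * 2 ^+ d)%:E * (((2 ^+ j + 2) `^ lambda)%:E * oscsum j)))%E).
  apply: lee_nneseries => [j _ _|j _].
    rewrite mule_ge0//; last by apply: integral_ge0 => x _; rewrite lee_fin base_ge0.
    by rewrite lee_fin mul1r !mulr_ge0// lweight_ge0.
  apply: (@le_trans _ _ ((1 * lweight lambda j * (8 * gside j))%:E * (gmass + (2 ^+ d)%:E * oscsum j))%E).
    by apply: lee_wpmul2l; [rewrite lee_fin mul1r !mulr_ge0// lweight_ge0|exact: int_base].
  rewrite ge0_muleDr ?gmass_ge0//; last by rewrite mule_ge0// lee_fin exprn_ge0.
  apply: leeD.
    rewrite -muleA [(gmass * _)%E]muleC muleA -EFinM; apply: lee_wpmul2r; first exact: gmass_ge0.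
    by rewrite lee_fin /lweight le_eqVlt; apply/orP; left; apply/eqP; ring.
  rewrite !muleA -!EFinM; apply: lee_wpmul2r => //; rewrite lee_fin /lweight.
  have D0 : 0 <= 2 ^+ d :> R by rewrite exprn_ge0.
  have -> : 1 * (2 `^ lambda * (2 ^+ j + 2) `^ lambda) * (8 * gside j) * 2 ^+ d =
    (8 * 2 `^ lambda * 2 ^+ d * (2 ^+ j + 2) `^ lambda) * gside j by ring.
  by rewrite ler_piMr ?mulr_ge0//; apply: le_trans (gside_le j) _; lra.
rewrite nneseriesD; last 2 first.
- by move=> j _; rewrite !mule_ge0 ?gmass_ge0// lee_fin mulr_ge0.
- by move=> j _; rewrite !mule_ge0 ?lee_fin// ?mulr_ge0// exprn_ge0.
have gf : gmass \is a fin_num by rewrite ge0_fin_numE ?gmass_ge0// gmass_fin.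
apply: lte_add_pinfty.
  rewrite -(fineK gf) -EFinM nneseriesZl; last by move=> j _; rewrite lee_fin mulr_ge0.
  apply: lte_mul_pinfty; rewrite ?lee_fin//; last exact: weighted_sides_fin.
  by rewrite !mulr_ge0// fine_ge0// gmass_ge0.
rewrite nneseriesZl; last by move=> j _; rewrite mule_ge0// lee_fin.
by apply: lte_mul_pinfty; rewrite ?lee_fin ?mulr_ge0 ?exprn_ge0//; exact: besov_oscsum_fin.
Qed.

(** The variation involves the Besov terms of generations [j] and [j - 1], and the
    weights of two consecutive generations are comparable. *)
Lemma int_variation_fin :
  (\sum_(0 <= j <oo) (((2 ^+ j + 2) `^ lambda)%:E * \int[@leb R d]_x (variation g j x)%:E) < +oo)%E.
Proof.
have c0 j : 0 <= (2 ^+ j + 2) `^ lambda :> R by exact: powR_ge0.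
have p0 : 0 <= 2 `^ lambda :> R by exact: powR_ge0.
have os0 j : (0 <= oscsum j)%E by exact: oscsum_ge0.
have D0 : 0 <= 2 ^+ d :> R by rewrite exprn_ge0.
pose u j := (((2 ^+ j + 2) `^ lambda)%:E * oscsum j)%E.
have u0 j : (0 <= u j)%E by rewrite mule_ge0// lee_fin.
have U0 := nneseries_ge0 (fun j _ _ => u0 j) : (0 <= \sum_(0 <= j <oo) u j)%E.
apply: (@nneseries_lt_pinfty _ _ ((2 ^+ d + 1)%:E * \sum_(0 <= j <oo) u j +
   (((2 ^+ 0 + 2) `^ lambda)%:E * gmass + (2 ^+ d * 2 `^ lambda)%:E * \sum_(0 <= j <oo) u j))%E).
- apply: lte_add_pinfty.
    by apply: lte_mul_pinfty; rewrite ?lee_fin ?addr_ge0//; exact: besov_oscsum_fin.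
  apply: lte_add_pinfty.
    by apply: lte_mul_pinfty; rewrite ?lee_fin//; exact: gmass_fin.
  by apply: lte_mul_pinfty; rewrite ?lee_fin ?mulr_ge0//; exact: besov_oscsum_fin.
- by move=> j; rewrite mule_ge0 ?lee_fin//; apply: integral_ge0 => x _; rewrite lee_fin variation_ge0.
pose s j : \bar R := (if j is n.+1 then (2 ^+ d * 2 `^ lambda)%:E * u n else ((2 ^+ 0 + 2) `^ lambda)%:E * gmass)%E.
have term j : (((2 ^+ j + 2) `^ lambda)%:E * \int[@leb R d]_x (variation g j x)%:E <=
    (2 ^+ d + 1)%:E * u j + s j)%E.
  case: j => [|n].
    apply: (@le_trans _ _ (((2 ^+ 0 + 2) `^ lambda)%:E * ((2 ^+ d)%:E * oscsum 0 + gmass))%E).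
      by apply: lee_wpmul2l; [rewrite lee_fin|exact: int_variation0].
    rewrite ge0_muleDr ?gmass_ge0//; last by rewrite mule_ge0// lee_fin.
    apply: leeD => //; rewrite /u muleCA; apply: lee_wpmul2r; first exact: u0.
    by rewrite lee_fin lerDl.
  apply: (@le_trans _ _ (((2 ^+ n.+1 + 2) `^ lambda)%:E *
     ((2 ^+ d)%:E * oscsum n.+1 + ((2 ^+ d)%:E * oscsum n + oscsum n.+1)))%E).
    by apply: lee_wpmul2l; [rewrite lee_fin|exact: int_variationS].
  have -> : ((2 ^+ d)%:E * oscsum n.+1 + ((2 ^+ d)%:E * oscsum n + oscsum n.+1) =
     (2 ^+ d + 1)%:E * oscsum n.+1 + (2 ^+ d)%:E * oscsum n)%E.
    rewrite EFinD ge0_muleDl ?lee_fin// mul1e.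
    by rewrite -!addeA; congr (_ + _)%E; rewrite addeC.
  rewrite ge0_muleDr; [|by rewrite mule_ge0// lee_fin addr_ge0|by rewrite mule_ge0// lee_fin].
  apply: leeD; first by rewrite muleCA.
  rewrite /s /u muleA muleA -!EFinM; apply: lee_wpmul2r => //; rewrite lee_fin.
  rewrite [leLHS]mulrC -mulrA ler_wpM2l// -powRM ?addr_ge0 ?exprn_ge0//.
  apply: ge0_ler_powR; rewrite ?nnegrE ?mulr_ge0 ?addr_ge0 ?exprn_ge0//; first exact: ltW.
  by rewrite exprS; lra.
move=> n; apply: (@le_trans _ _ (\sum_(0 <= j < n) ((2 ^+ d + 1)%:E * u j + s j))%E).
  by apply: lee_sum => j _; exact: term.
rewrite big_split/=; apply: leeD.
  rewrite -ge0_sume_distrr; last by move=> j _; exact: u0.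
  apply: lee_wpmul2l; first by rewrite lee_fin addr_ge0.
  by apply: nneseries_lim_ge => j _ _; exact: u0.
case: n => [|n].
  by rewrite big_geq//; apply: adde_ge0; apply: mule_ge0; rewrite ?lee_fin ?gmass_ge0// mulr_ge0.
rewrite big_nat_recl//=; apply: leeD => //.
rewrite -ge0_sume_distrr; last by move=> j _; exact: u0.
apply: lee_wpmul2l; first by rewrite lee_fin mulr_ge0.
by apply: nneseries_lim_ge => j _ _; exact: u0.
Qed.

(** The factor [1 / gside j] of the gradient cancels the thickness of the layer. *)
Lemma int_egrad_fin i :
  (\int[@leb R d.+1]_(y in H) (`|egrad y ord0 i| * weight lambda y)%:E < +oo)%E.
Proof.
have c0 j : 0 <= (2 ^+ j + 2) `^ lambda :> R by exact: powR_ge0.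
have M0 := rampM_ge0 (R := R).
have V j x : variation g j x = variation g j (corner (2 ^ j) (idx (2 ^ j) x)).
  by rewrite variation_corner.
apply: le_lt_trans (int_layers l0 (egrad_weak i).1.1 dscale_ge0 (variation_ge0 g) V (egrad_le i)) _.
rewrite (eq_eseriesr (g := fun j => ((8 * @rampM R * 2 `^ lambda)%:E *
   (((2 ^+ j + 2) `^ lambda)%:E * \int[@leb R d]_x (variation g j x)%:E))%E)); last first.
  move=> j _; rewrite muleA -EFinM; congr (_%:E * _)%E; rewrite /dscale /lweight.
  have hj : gside j != 0 by rewrite gt_eqF// gside_gt0.
  by field.
rewrite nneseriesZl; last first.
  by move=> j _; rewrite mule_ge0 ?lee_fin//; apply: integral_ge0 => x _; rewrite lee_fin variation_ge0.
apply: lte_mul_pinfty; rewrite ?lee_fin//; last exact: int_variation_fin.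
by rewrite !mulr_ge0// powR_ge0.
Qed.

Lemma wmeasure_fin (F : 'rV[R]_d.+1 -> R) :
  measurable_fun (H : set (lebesgueType R d.+1)) F -> (forall y, 0 <= F y) ->
  (\int[@leb R d.+1]_(y in H) (F y * weight lambda y)%:E < +oo)%E ->
  (\int[wmeasure lambda]_(y in H) (F y)%:E < +oo)%E.
Proof.
move=> mF F0 fin; rewrite wmeasure_integral//.
have mFw : measurable_fun (H : set (lebesgueType R d.+1)) (fun y => F y * weight lambda y).
  by apply: measurable_funM; [exact: mF|exact: measurable_weight].
rewrite (eq_integral (fun y : lebesgueType R d.+1 => ((ln 4 `^ lambda)^-1 * (F y * weight lambda y))%:E)); last first.
  by move=> y _; rewrite mulrCA.
rewrite (nn_int_scale _ (@measurable_halfspace R d) mFw).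
- by apply: lte_mul_pinfty; rewrite ?lee_fin ?invr_ge0 ?powR_ge0.
- by move=> y _; rewrite mulr_ge0// weight_ge0.
- by rewrite invr_ge0 powR_ge0.
Qed.

Lemma ext_energy_fin : (\int[wmeasure lambda]_(y in H) `|ext y|%:E +
   \int[wmeasure lambda]_(y in H) (enorm (egrad y))%:E < +oo)%E.
Proof.
have mH := @measurable_halfspace R d.
have mw := @measurable_weight R d lambda.
have me : measurable_fun (H : set (lebesgueType R d.+1)) ext := L1loc_ext.1.
have mg : measurable_fun (H : set (lebesgueType R d.+1)) (fun y => enorm (egrad y)).
  exact: (measurable_gnorm egrad_weak).
apply: lte_add_pinfty.
  apply: wmeasure_fin; last exact: int_ext_fin; last by [].
  by apply: measurableT_comp => //; exact: me.
apply: wmeasure_fin; [exact: mg|by move=> y; exact: enorm_ge0|].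
have mi i : measurable_fun (H : set (lebesgueType R d.+1)) (fun y => `|egrad y ord0 i| * weight lambda y).
  apply: measurable_funM; last exact: mw.
  by apply: (measurableT_comp (@normr_measurable R setT)); exact: (egrad_weak i).1.1.
apply: (@le_lt_trans _ _ (\int[@leb R d.+1]_(y in H) \sum_(i < d.+1) (`|egrad y ord0 i| * weight lambda y)%:E)%E).
  apply: ge0_le_integral.
  - exact: mH.
  - by move=> y _; rewrite lee_fin mulr_ge0 ?weight_ge0 ?enorm_ge0.
  - by apply/measurable_EFinP; apply: measurable_funM; [exact: mg|exact: mw].
  - by apply: emeasurable_sum => i; apply/measurable_EFinP; exact: mi.
  - move=> y _; rewrite sumEFin lee_fin -mulr_suml; apply: ler_wpM2r; first exact: weight_ge0.
    exact: enorm_le_sum.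
rewrite ge0_integral_sum; first last.
- by move=> i y _; rewrite lee_fin mulr_ge0// weight_ge0.
- by move=> i; apply/measurable_EFinP; exact: mi.
- exact: mH.
by apply/lte_sum_pinfty => i _; exact: int_egrad_fin.
Qed.

Lemma sobolev_ext : sobolev11 d lambda ext.
Proof.
split; first exact: L1loc_ext.
by exists egrad; split; [exact: egrad_weak|exact: ext_energy_fin].
Qed.

End extension.

(** * Functions are determined by their dyadic integrals *)

Section dyadic_determination.
Context {R : realType} {n : nat}.
Local Notation leb := (@leb R n).
Local Open Scope ereal_scope.

Section density_measure.
Variable v : 'rV[R]_n -> \bar R.
Hypothesis v0 : forall x, 0 <= v x.
Hypothesis mv : measurable_fun setT (v : lebesgueType R n -> \bar R).

(** The measure with density [v], restricted to Borel sets so that it can be compared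
    on dyadic cubes. *)
Definition dens (A : set 'rV[R]_n) : \bar R := \int[leb]_(x in A) v x.

Let dens0 : dens set0 = 0. Proof. by rewrite /dens integral_set0. Qed.

Let dens_ge0 A : 0 <= dens A. Proof. by apply: integral_ge0. Qed.

Let dens_sigma_additive : semi_sigma_additive dens.
Proof.
move=> F mF tF mUF; rewrite /dens ge0_integral_bigcup.
- by apply: is_cvg_nneseries => i _ _; apply: integral_ge0.
- by move=> i; exact: borel_measurable_lebesgue.
- by apply: measurable_funTS; exact: mv.
- by move=> x _; exact: v0.
- exact: tF.
Qed.

Definition dens_measure : {measure set 'rV[R]_n -> \bar R} :=
  HB.pack dens (@isMeasure.Build _ _ _ dens dens0 dens_ge0 dens_sigma_additive).

End density_measure.

(** Lebesgue measure is an outer measure restricted to its measurable sets: cover [A] by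
    Borel sets of measure tending to that of [A] and intersect them. *)
Lemma borel_hull (A : set 'rV[R]_n) : measurable (A : set (lebesgueType R n)) -> leb A < +oo ->
  exists B : set 'rV[R]_n, [/\ measurable B, A `<=` B & leb (B `\` A) = 0].
Proof.
move=> mA Afin.
have A_fin : leb A \is a fin_num by rewrite ge0_fin_numE.
have cover k : exists C : set 'rV[R]_n, [/\ measurable C, A `<=` C & leb C <= leb A + (k.+1%:R^-1)%:E].
  have k0 : (0 < k.+1%:R^-1 :> R)%R by rewrite invr_gt0.
  have [_ [F [mF AF] <-] lt] := lb_ereal_inf_adherent k0 A_fin.
  exists (\bigcup_i F i); split => //; first exact: bigcupT_measurable.
  apply: le_trans (ltW lt).
  apply: le_trans (measure_sigma_subadditive _ _ _ _) _ => //.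
  - by move=> i; exact: borel_measurable_lebesgue.
  - by apply: borel_measurable_lebesgue; exact: bigcupT_measurable.
  - by [].
  - apply: lee_nneseries => [i _ _|i _]; first exact: measure_ge0.
    by rewrite [X in X <= _](leb_borelE (mF i)).
pose C k := projT1 (cid (cover k)).
have mC k : measurable (C k) by rewrite /C; case: cid => ? [].
have AC k : A `<=` C k by rewrite /C; case: cid => ? [].
have Cle k : leb (C k) <= leb A + (k.+1%:R^-1)%:E by rewrite /C; case: cid => ? [].
exists (\bigcap_k C k).
have mB : measurable (\bigcap_k C k) by exact: bigcapT_measurable.
have AB : A `<=` \bigcap_k C k by move=> x Ax k _; exact: AC.
have mB' := borel_measurable_lebesgue mB.
split => //; rewrite measureD//; last first.
  apply: le_lt_trans (_ : _ <= leb (C 0%N)) _; last by apply: le_lt_trans (Cle 0%N) _; rewrite lte_add_pinfty// ltry.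
  by apply: le_measure; rewrite ?inE//; [exact: borel_measurable_lebesgue|exact: bigcap_inf].
rewrite (_ : _ `&` A = A); last exact/setIidPr.
suff E : leb (\bigcap_k C k) = leb A by rewrite [X in X - _]E subee.
apply/eqP; rewrite eq_le; apply/andP; split; last by apply: le_measure; rewrite ?inE.
apply/lee_addgt0Pr => e e0.
near \oo => k; apply: (@le_trans _ _ (leb (C k))).
  by apply: le_measure; rewrite ?inE//; [exact: borel_measurable_lebesgue|exact: bigcap_inf].
apply: le_trans (Cle k) _; rewrite leeD2l// lee_fin ltW//.
by near: k; exact: (near_infty_natSinv_lt (PosNum e0)).
Unshelve. all: by end_near. Qed.

Variable u : 'rV[R]_n -> R.
Hypothesis iu : leb.-integrable setT (EFin \o u).
Hypothesis u0 : forall k m, \int[leb]_(x in dcube k m) (u x)%:E = 0.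

Let up := (EFin \o u)^\+.
Let un := (EFin \o u)^\-.
Let mup : measurable_fun setT (up : lebesgueType R n -> \bar R).
Proof. by apply: measurable_funepos; exact: measurable_int iu. Qed.
Let mun : measurable_fun setT (un : lebesgueType R n -> \bar R).
Proof. by apply: measurable_funeneg; exact: measurable_int iu. Qed.

(** The positive and the negative part of [u] have the same integrals over dyadic cubes,
    hence over all Borel sets. *)
Lemma dens_posneg (A : set 'rV[R]_n) : measurable A ->
  \int[leb]_(x in A) up x = \int[leb]_(x in A) un x.
Proof.
move=> mA.
have mQ k m : measurable (dcube k m : set (lebesgueType R n)).
  exact: borel_measurable_lebesgue (measurable_dcube k m).
have iQ k m : leb.-integrable (dcube k m) (EFin \o u).
  exact: integrableS measurableT (mQ k m) _ iu.
have fp k m : \int[leb]_(x in dcube k m) up x \is a fin_num.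
  by apply: integrable_fin_num => //; apply: integrable_funepos => //; exact: iQ.
have fn k m : \int[leb]_(x in dcube k m) un x \is a fin_num.
  by apply: integrable_fin_num => //; apply: integrable_funeneg => //; exact: iQ.
apply: (@measure_dyadic_unique R n (dens_measure (fun x => funepos_ge0 _ x) mup)
  (dens_measure (fun x => funeneg_ge0 _ x) mun)) => // k m.
- rewrite /dens_measure/= /dens; have := u0 k m; rewrite integralE => /eqP.
  by rewrite sube_eq// ?add0e ?fin_num_adde_defl// => /eqP.
- by rewrite /dens_measure/= /dens ltey_eq fp.
Qed.

Let measurable_pos k m : measurable (dcube k m `&` [set x | (0 < u x)%R] : set (lebesgueType R n)).
Proof.
have mu : measurable_fun setT (u : lebesgueType R n -> R).
  by apply/measurable_EFinP; exact: measurable_int iu.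
apply: measurableI; first exact: borel_measurable_lebesgue (measurable_dcube k m).
have := mu measurableT _ (measurable_itv `]0%R, +oo[).
by rewrite setTI; congr measurable; apply/seteqP; split => x /=; rewrite in_itv /= andbT.
Qed.

(** On a Borel hull of the set where [u] is positive the negative part integrates to 0,
    and so does the positive part. *)
Lemma pos_null k m : leb (dcube k m `&` [set x | (0 < u x)%R]) = 0.
Proof.
have mQ : measurable (dcube k m : set (lebesgueType R n)).
  exact: borel_measurable_lebesgue (measurable_dcube k m).
set A := _ `&` _.
have mA : measurable (A : set (lebesgueType R n)) by exact: measurable_pos.
have Afin : leb A < +oo.
  apply: le_lt_trans (_ : leb (dcube k m) < +oo); last by rewrite [X in X < _](leb_dcube k m) ltry.
  by apply: le_measure; rewrite ?inE//; exact: subIsetl.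
have [B [mB AB BA0]] := borel_hull mA Afin.
have mB' := borel_measurable_lebesgue mB.
have mBA : measurable (B `\` A : set (lebesgueType R n)) by exact: measurableD.
have Bn : \int[leb]_(x in B) un x = 0.
  rewrite -(setDUK AB) ge0_integral_setU//=; last 3 first.
  - by apply: measurable_funTS.
  - by move=> x _; exact: funeneg_ge0.
  - by rewrite disj_set2E setDIK.
  rewrite (null_set_integral mBA _ BA0); last exact: measurable_funTS.
  rewrite adde0; apply: integral0_eq => x [_ /= ux].
  by rewrite /un funenegE/=; apply/max_idPr; rewrite lee_fin oppr_le0 ltW.
have Bp : \int[leb]_(x in B) up x = 0 by rewrite dens_posneg.
have Ap : \int[leb]_(x in A) `|up x| = 0.
  apply/eqP; rewrite eq_le integral_ge0// andbT -Bp.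
  rewrite (eq_integral (up : lebesgueType R n -> _)); last by move=> x _; rewrite gee0_abs// funepos_ge0.
  by apply: ge0_subset_integral => //; [exact: measurable_funTS|move=> x _; exact: funepos_ge0].
have := (ae_eq_integral_abs leb mA (measurable_funTS mup)).1 Ap.
move=> [N [mN N0 sub]]; apply/eqP; rewrite eq_le measure_ge0 andbT -N0.
apply: le_measure; rewrite ?inE// => x Ax; apply: sub => /= /(_ Ax).
have [_ ux] := Ax.
rewrite /up funeposE/= max_l ?lee_fin ?ltW// => -[E]; by rewrite /= E ltxx in ux.
Qed.

Lemma pos_negligible : leb.-negligible [set x | (0 < u x)%R].
Proof.
have -> : [set x | (0 < u x)%R] = \bigcup_i
   (if @pickle_inv 'rV[int]_n i is Some m then dcube 0 m `&` [set x | (0 < u x)%R] else set0).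
  apply/seteqP; split => [x ux|x [i _]]; last by case: (pickle_inv i) => // m [].
  by exists (pickle (idx 0 x)) => //; rewrite pickleK_inv; split => //; exact: dcube_idx.
apply: negligible_bigcup => i; case: (pickle_inv i) => [m|]; last exact: negligible_set0.
exists (dcube 0 m `&` [set x | (0 < u x)%R]); split => //; exact: pos_null.
Qed.

End dyadic_determination.

Section dyadic_ae.
Context {R : realType} {n : nat}.
Local Notation leb := (@leb R n).

Lemma dyadic_integrals_ae_eq0 (u : 'rV[R]_n -> R) : leb.-integrable setT (EFin \o u) ->
  (forall k m, (\int[leb]_(x in dcube k m) (u x)%:E = 0)%E) -> {ae leb, forall x, u x = 0}.
Proof.
move=> iu u0.
have P1 := pos_negligible iu u0.
have iN : leb.-integrable setT (EFin \o (fun x => - u x)).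
  by have := integrableN iu; apply: eq_integrable.
have P2 : leb.-negligible [set x | 0 < - u x].
  apply: pos_negligible iN _ => k m; under eq_integral do rewrite EFinN.
  rewrite integralN ?u0 ?oppe0//.
  have mQ : measurable (dcube k m : set (lebesgueType R n)).
    exact: borel_measurable_lebesgue (measurable_dcube k m).
  have iQ : leb.-integrable (dcube k m) (EFin \o u).
    exact: integrableS measurableT mQ _ iu.
  exact: (integrable_add_def mQ iQ).
apply: (negligibleS _ (negligibleU P1 P2)) => x /= /eqP; rewrite neq_lt => /orP[ux|ux].
  by right; rewrite /= oppr_gt0.
by left.
Qed.

End dyadic_ae.

(** * The trace of the extension *)

Section trace_of_extension.
Context {R : realType} {d : nat}.
Local Notation side := (@side R).
Local Notation gside := (@gside R).
Variables (g : 'rV[R]_d -> R) (lambda : R).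
Hypothesis l0 : 0 < lambda.
Hypothesis bg : besov d lambda g.

Local Notation coef := (coef g).
Local Notation oscsum := (oscsum g).
Local Notation ext := (ext g).
Local Notation S := (stripint (egrad g)).

Let ig := besov_integrable bg.
Let ext_L1loc := L1loc_ext g.
Let ext_weak := egrad_weak g.
Let ext_energy := ext_energy_fin l0 bg.

(** The neighbourhoods of level [2 ^ j] lie at heights between [3/4] and [9/4] times
    [gside j], where [vprof j] is 1 and the other profiles vanish; from [j = 2] on the
    edges are small enough for this. *)
Lemma ext_nbd j (m : 'rV[int]_d) y : (2 <= j)%N -> nbd (2 ^ j) m y ->
  ext y = interp coef hats j (rV_init y) /\
  exists a : {ffun 'I_d -> 'I_3}, idx (2 ^ j) (rV_init y) = m + nshift a.
Proof.
move=> j2 /nbd_near[z [zQ zh _ yz yh]]; have hj := gside_gt0 (R := R) j.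
(* at this size 7 * gside j.+1 = 7 * (gside j) ^ 2 is below 3/4 * gside j *)
have h16 : gside j <= 1 / 16.
  apply: le_trans (_ : side 4 <= _); last by rewrite /side; lra.
  by apply: side_le; rewrite -[4%N]/(2 ^ 2)%N leq_exp2l.
rewrite -/(gside j) in zh yz yh.
have [t1 t2] : 3 / 4 * gside j < height y /\ height y < 9 / 4 * gside j.
  by move: yh zh; rewrite ltr_norml => /andP[? ?] /andP[? ?]; split; lra.
split.
  have y0 : 0 < height y by nra.
  have [N0 HN0] := layer_bound y0; pose N := maxn N0 j.+1.
  have HN i : (N <= i)%N -> 8 * gside i < height y by rewrite geq_max => /andP[/HN0].
  rewrite (ext_sum g HN).
  have jN : (j < N)%N by rewrite leq_max leqnn orbT.
  rewrite (bigD1 (Ordinal jN))//= big1 ?addr0.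
    rewrite vprof1 ?mul1r//; rewrite gsideS; apply/andP; split; nra.
  move=> i ij; rewrite vprof_out ?mul0r// /layer/= => /andP[u1 u2].
  have : (nat_of_ord i != j) by apply: contra ij => /eqP E; apply/eqP/val_inj.
  rewrite neq_ltn => /orP[lt|lt].
    have : gside j <= gside i.+1 by apply: side_le; rewrite leq_exp2l.
    lra.
  have : gside i <= gside j.+1 by apply: side_le; rewrite leq_exp2l.
  rewrite gsideS; nra.
have K i : (0 <= idx (2 ^ j) (rV_init y) ord0 i - m ord0 i + 1 < 3)%R.
  have := dcube_idx (2 ^ j) (rV_init y); rewrite dcubeE => /(_ i).
  rewrite [X in X < _ <= _]mxE [X in _ < _ <= X]mxE -/(gside j) => /andP[a1 a2].
  have := zQ; rewrite dcubeE => /(_ i).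
  rewrite [X in X < _ <= _]mxE [X in _ < _ <= X]mxE -/(gside j) => /andP[b1 b2].
  have := yz i; rewrite ltr_norml => /andP[c1 c2].
  rewrite !intrD !mulrDr mulr1 in a2 b2.
  have e1 : gside j * (idx (2 ^ j) (rV_init y) ord0 i)%:~R < gside j * ((m ord0 i)%:~R + 2).
    by rewrite mulrDr; lra.
  have e2 : gside j * (m ord0 i)%:~R < gside j * ((idx (2 ^ j) (rV_init y) ord0 i)%:~R + 2).
    by rewrite mulrDr; lra.
  rewrite ltr_pM2l// -[2]/(2%:~R) -intrD ltr_int in e1.
  rewrite ltr_pM2l// -[2]/(2%:~R) -intrD ltr_int in e2.
  by move: (idx _ _ _ _) (m _ _) e1 e2 => b c e1 e2; clear -e1 e2; lia.
have Kn i : (absz (idx (2 ^ j) (rV_init y) ord0 i - m ord0 i + 1)%R < 3)%N.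
  by have := K i; move: (idx _ _ _ _) (m _ _) => b c; clear; lia.
exists [ffun i => Ordinal (Kn i)]; apply/rowP => i; have := K i.
rewrite [RHS]mxE [nshift _ _ _]mxE ffunE -[idx _ _ 0 i]/(idx (2 ^ j) (rV_init y) ord0 i)/=.
by move: (idx _ _ _ _) (m _ _) => b c; clear; lia.
Qed.

(** All differences of averages that the values of the extension on one neighbourhood
    can involve. *)
Definition deviation j (m : 'rV[int]_d) : R := \sum_(e : {ffun 'I_d -> 'I_3})
  (`|coef j (m + nshift e) - coef j m| +
   \sum_(a : {ffun 'I_d -> bool}) `|coef j (m + nshift e - bshift a) - coef j (m + nshift e)|).

Lemma ext_deviation j m y : (2 <= j)%N -> nbd (2 ^ j) m y -> `|ext y - coef j m| <= deviation j m.
Proof.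
move=> j2 ym; have [-> [e E]] := ext_nbd j2 ym.
rewrite /deviation (bigD1 e)//= -[leLHS]addr0; apply: lerD; last first.
  by apply: sumr_ge0 => e' _; rewrite addr_ge0// sumr_ge0.
have I := interp_rhat coef j (rV_init y); rewrite -/hats /osc E in I.
set A := interp _ _ _ _ in I *.
have -> : A - coef j m = (coef j (m + nshift e) - coef j m) + (A - coef j (m + nshift e)) by ring.
by apply: le_trans (ler_normD _ _) _; rewrite lerD2l.
Qed.

Lemma nbd_average_deviation j m : (2 <= j)%N -> `|nbd_average ext (2 ^ j) m - coef j m| <= deviation j m.
Proof.
move=> j2; set k := (2 ^ j)%N; pose N : set 'rV[R]_d.+1 := nbd k m.
have mN : measurable (N : set (lebesgueType R d.+1)) := measurable_nbd k m.
have s0 := side_gt0 (R := R) k.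
have Nfin : (@leb R d.+1 N < +oo)%E.
  apply: le_lt_trans (ltry (6 ^+ d * 3 * side k ^+ d.+1)).
  apply: le_trans (leb_refbox k m); apply: le_measure; rewrite ?inE//.
    exact: measurable_refbox.
  have := @nbd_sub_same R d k m 0; rewrite addr0 => /(_ _)/subset_trans; apply.
    by move=> i; rewrite mxE.
  by move=> y yb i; have /andP[/ltW -> /ltW ->] := yb i.
have NB : N `<=` @refbox R d k m.
  have := @nbd_sub_same R d k m 0; rewrite addr0 => /(_ _)/subset_trans; apply.
    by move=> i; rewrite mxE.
  by move=> y yb i; have /andP[/ltW -> /ltW ->] := yb i.
have iB : (@leb R d.+1).-integrable (refbox k m) (EFin \o ext).
  by apply: ext_L1loc.2; [exact: compact_cbox|exact: refbox_halfspace].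
have iN := integrableS (measurable_refbox k m) mN NB iB.
have N0 : 0 < fine (@leb R d.+1 N).
  apply: lt_le_trans (_ : side k ^+ d.+1 <= _); first by rewrite exprn_gt0.
  by rewrite -lee_fin fineK ?ge0_fin_numE ?measure_ge0//; exact: leb_nbd_ge.
have ic (c : R) : (@leb R d.+1).-integrable N (EFin \o cst c).
  apply: measurable_bounded_integrable; [exact: mN|exact: Nfin|exact: measurable_cst|].
  by exists `|c|; split; [exact: num_real|move=> M cM x _ /=; exact: ltW].
have E : fine (@leb R d.+1 N) * (nbd_average ext k m - coef j m) = \int[@leb R d.+1]_(y in N) (ext y - coef j m).
  rewrite RintegralB//; last exact: ic.
  rewrite Rintegral_cst// /nbd_average /average mulrBr mulVKf ?gt_eqF//; congr (_ - _); exact: mulrC.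
rewrite -(ler_pM2l N0) -{1}(ger0_norm (ltW N0)) -normrM E.
apply: le_trans (Rint_le_norm mN _ (ic (deviation j m)) _) _.
- by have := integrableB mN iN (ic (coef j m)); apply: eq_integrable.
- by move=> y; exact: ext_deviation.
- by rewrite Rintegral_cst// mulrC.
Qed.

Definition deviation_const : R := 3 ^+ d * (1 + 2 ^+ d).

Lemma int_deviation j : (\int[@leb R d]_x (deviation j (idx (2 ^ j) x))%:E <= deviation_const%:E * oscsum j)%E.
Proof.
have os0 := oscsum_ge0 g j.
pose T (e : {ffun 'I_d -> 'I_3}) m := `|coef j (m + nshift e) - coef j m|.
pose U (e : {ffun 'I_d -> 'I_3}) (a : {ffun 'I_d -> bool}) m :=
  `|coef j (m + nshift e - bshift a) - coef j (m + nshift e)|.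
have mT e : measurable_fun setT (fun x : lebesgueType R d => T e (idx (2 ^ j) x)).
  exact: (@measurable_step R d (2 ^ j) _ R (T e)).
have mU e : measurable_fun setT (fun x : lebesgueType R d => \sum_a U e a (idx (2 ^ j) x)).
  exact: (@measurable_step R d (2 ^ j) _ R (fun m => \sum_a U e a m)).
have iT e : (\int[@leb R d]_x (T e (idx (2 ^ j) x))%:E <= oscsum j)%E.
  rewrite (eq_integral (fun x : lebesgueType R d =>
    `|coef j (idx (2 ^ j) x) - coef j (idx (2 ^ j) x + nshift e)|%:E)).
    exact: int_same_level (nshift_unit e).
  by move=> x _; rewrite /T distrC.
have iU e a : (\int[@leb R d]_x (U e a (idx (2 ^ j) x))%:E <= oscsum j)%E.
  rewrite (@int_step R d (2 ^ j) (fun m => (U e a m)%:E)); last by move=> m; rewrite lee_fin; exact: normr_ge0.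
  rewrite (esum_shift (fun m => (side (2 ^ j) ^+ d)%:E * `|coef j (m - bshift a) - coef j m|%:E)%E).
  rewrite -(@int_step R d (2 ^ j) (fun m => `|coef j (m - bshift a) - coef j m|%:E)); last first.
    by move=> m; rewrite lee_fin.
  rewrite (eq_integral (fun x : lebesgueType R d =>
    `|coef j (idx (2 ^ j) x) - coef j (idx (2 ^ j) x + - bshift a)|%:E)).
    exact: int_same_level (bshift_unit a).
  by move=> x _; rewrite distrC.
have iUs e : (\int[@leb R d]_x (\sum_a U e a (idx (2 ^ j) x))%:E <= (2 ^+ d)%:E * oscsum j)%E.
  under eq_integral do rewrite -sumEFin.
  rewrite ge0_integral_sum; first last.
  - by move=> a x _; rewrite lee_fin; exact: normr_ge0.
  - by move=> a; apply/measurable_EFinP; exact: (@measurable_step R d (2 ^ j) _ R (U e a)).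
  - exact: measurableT.
  have -> : ((2 ^+ d)%:E * oscsum j = \sum_(a : {ffun 'I_d -> bool}) oscsum j)%E.
    under [RHS]eq_bigr do rewrite -(mul1e (oscsum j)).
    rewrite -ge0_sume_distrl; last by move=> a _; rewrite lee_fin.
    by rewrite sumEFin sumr_const card_ffun card_bool card_ord natrX.
  by apply: lee_sum => a _; exact: iU.
rewrite /deviation; under eq_integral do rewrite -sumEFin.
rewrite ge0_integral_sum; first last.
- by move=> e x _; rewrite lee_fin addr_ge0// sumr_ge0.
- by move=> e; apply/measurable_EFinP; exact: measurable_funD (mT e) (mU e).
- exact: measurableT.
have -> : (deviation_const%:E * oscsum j = \sum_(e : {ffun 'I_d -> 'I_3}) ((1 + 2 ^+ d)%:E * oscsum j))%E.
  rewrite -ge0_sume_distrl; last by move=> e _; rewrite lee_fin addr_ge0// exprn_ge0.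
  rewrite sumEFin sumr_const card_ffun !card_ord; congr (_%:E * _)%E.
  by rewrite -[RHS]mulr_natl natrX.
apply: lee_sum => e _.
rewrite (nn_int_add _ measurableT (mT e) (mU e)); last 2 first.
- by move=> x _; exact: normr_ge0.
- by move=> x _; apply: sumr_ge0 => a _; exact: normr_ge0.
rewrite EFinD ge0_muleDl ?lee_fin ?exprn_ge0// mul1e.
by apply: leeD; [exact: iT|exact: iUs].
Qed.

Lemma int_Tk_coef j : (2 <= j)%N ->
  (\int[@leb R d]_x `|coef j (idx (2 ^ j) x) - Tk ext (2 ^ j) x|%:E <= deviation_const%:E * oscsum j)%E.
Proof.
move=> j2; apply: le_trans (int_deviation j); apply: nn_int_le.
- exact: measurableT.
- apply: measurable_dist; last exact: measurable_Tk.
  exact: (@measurable_step R d (2 ^ j) _ R (coef j)).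
- exact: (@measurable_step R d (2 ^ j) _ R (deviation j)).
- by [].
- by move=> x _; rewrite distrC; exact: nbd_average_deviation.
Qed.

Lemma int_coef_btrace j : (2 <= j)%N ->
  (\int[@leb R d]_x `|coef j (idx (2 ^ j) x) - btrace ext x|%:E <=
   deviation_const%:E * oscsum j + (@strip_const R d)%:E * tail (2 ^ j) S)%E.
Proof.
move=> j2.
have mc : measurable_fun setT (fun x : lebesgueType R d => coef j (idx (2 ^ j) x)).
  exact: (@measurable_step R d (2 ^ j) _ R (coef j)).
apply: le_trans (int_triangle (@leb R d) measurableT mc (measurable_Tk ext (2 ^ j)) (@measurable_btrace _ _ ext)) _.
apply: leeD; first exact: int_Tk_coef.
by rewrite int_dist_sym; exact: int_btrace_Tk ext_L1loc ext_weak _.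
Qed.

Lemma nneseries_term_small (u : nat -> \bar R) (e : R) : (forall l, 0 <= u l)%E ->
  (\sum_(0 <= l <oo) u l < +oo)%E -> 0 < e -> exists N, forall k, (N <= k)%N -> (tail k u < e%:E)%E.
Proof.
move=> u0 uf e0.
have tE k : tail k u = (\sum_(k <= l <oo) u l)%E by rewrite eseries_cond [RHS]eseries_mkcond.
have e0' : (0 < e%:E)%E by rewrite lte_fin.
have nA : nbhs (0%E : \bar R) [set t | (t < e%:E)%E] := lt_nbhsl e0'.
have [N _ HN] := nneseries_tail_cvg uf (fun k _ => u0 k) nA.
by exists N => k Nk; rewrite tE; exact: HN.
Qed.

Lemma oscsum_sum_fin : (\sum_(0 <= j <oo) oscsum j < +oo)%E.
Proof.
apply: le_lt_trans (besov_oscsum_fin bg); apply: lee_nneseries => [j _ _|j _].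
  exact: oscsum_ge0.
apply: lee_pemull; first exact: oscsum_ge0.
rewrite lee_fin -[leLHS](_ : 1 `^ lambda = 1); last by rewrite powR1.
have : 1 <= 2 ^+ j :> R by rewrite exprn_ege1// ler1n.
by move=> p1; apply: ge0_ler_powR; rewrite ?nnegrE ?addr_ge0//; [exact: ltW|lra].
Qed.

(** Terms and tails of the two convergent series in [int_coef_btrace] tend to 0. *)
Lemma coef_cvg_btrace (e : R) : 0 < e -> exists N, forall j, (N <= j)%N ->
  (\int[@leb R d]_x `|coef j (idx (2 ^ j) x) - btrace ext x|%:E < e%:E)%E.
Proof.
move=> e0; have D0 : 0 <= deviation_const by rewrite mulr_ge0 ?addr_ge0 ?exprn_ge0.
have W0 := @strip_const_ge0 R d.
have p1 : 0 < e / 2 / (deviation_const + 1) by rewrite !divr_gt0//; lra.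
have p2 : 0 < e / 2 / (@strip_const R d + 1) by rewrite !divr_gt0//; lra.
have [N1 H1] := nneseries_term_small (oscsum_ge0 g) oscsum_sum_fin p1.
have Sf := stripint_sum_fin l0 ext_weak ext_energy.
have [N2 H2] := nneseries_term_small (stripint_ge0 (egrad g)) Sf p2.
exists (maxn 2 (maxn N1 N2)) => j; rewrite !geq_max => /andP[j2 /andP[jN1 jN2]].
apply: le_lt_trans (int_coef_btrace j2) _.
have o1 : (oscsum j <= (e / 2 / (deviation_const + 1))%:E)%E.
  by apply: le_trans (tail_term _ (oscsum_ge0 g)) (ltW (H1 j jN1)).
have jj : (N2 <= 2 ^ j)%N by apply: leq_trans jN2 _; exact/ltnW/ltn_expl.
have o2 := H2 _ jj.
have -> : e%:E = ((e / 2)%:E + (e / 2)%:E)%E by rewrite -EFinD; congr EFin; lra.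
apply: lee_ltD.
- by rewrite ge0_fin_numE ?mule_ge0 ?lee_fin// ?oscsum_ge0//; apply: lte_mul_pinfty; rewrite ?lee_fin//; apply: le_lt_trans o1 (ltry _).
- apply: le_trans (lee_wpmul2l _ o1) _; first by rewrite lee_fin.
  by rewrite -EFinM lee_fin mulrCA ler_piMr ?divr_ge0 ?(ltW e0)// ler_pdivrMr ?mul1r; lra.
- have W1 : 0 < @strip_const R d + 1 by lra.
  apply: (@le_lt_trans _ _ ((@strip_const R d + 1)%:E * tail (2 ^ j) S)%E).
    apply: lee_wpmul2r; last by rewrite lee_fin lerDl.
    by apply: tail_ge0 => l; exact: stripint_ge0.
  by rewrite muleC -lte_pdivlMr.
Qed.

End trace_of_extension.

Section martingale.
Context {R : realType} {d : nat}.
Local Notation leb := (@leb R d).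

Let mcube k m : measurable (dcube k m : set (lebesgueType R d)).
Proof. exact: borel_measurable_lebesgue (measurable_dcube k m). Qed.

Let mfib k m : measurable ((@idx R d k : lebesgueType R d -> 'rV[int]_d) @^-1` [set m]).
Proof. by rewrite preimage_idx; exact: mcube. Qed.

Lemma average_ge0 (A : set 'rV[R]_d) (v : 'rV[R]_d -> R) : (forall x, 0 <= v x) -> 0 <= average A v.
Proof.
move=> v0; apply: mulr_ge0; last by apply: Rintegral_ge0 => x _; exact: v0.
by rewrite invr_ge0; apply: fine_ge0; exact: measure_ge0.
Qed.

Lemma int_average_ge0 (v : 'rV[R]_d -> R) j k (m : 'rV[int]_d) : (j <= k)%N ->
  leb.-integrable setT (EFin \o v) -> (forall x, 0 <= v x) ->
  (\int[leb]_(x in dcube j m) (average (dcube k (idx k x)) v)%:E = \int[leb]_(x in dcube j m) (v x)%:E)%E.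
Proof.
move=> jk iv v0.
have mv : measurable_fun setT (EFin \o v : lebesgueType R d -> \bar R) := measurable_int leb iv.
have ma : measurable_fun setT (fun x : lebesgueType R d => (average (dcube k (idx k x)) v)%:E).
  exact: (@measurable_step R d k _ _ (fun m => (average (dcube k m) v)%:E)).
have a0 m' : 0 <= average (dcube k m') v by exact: average_ge0.
rewrite (fiber_integral leb (mcube j m) (mfib k) (measurable_funTS ma)); last first.
  by move=> x _; rewrite lee_fin.
rewrite (fiber_integral leb (mcube j m) (mfib k) (measurable_funTS mv)); last first.
  by move=> x _; rewrite lee_fin.
apply: eq_esum => m' _; rewrite preimage_idx.
have [/set0P[x [xm xm']]|/negbNE/eqP E] := boolP ((dcube j m `&` dcube k m' : set 'rV[R]_d) != set0); last first.
  by rewrite [X in integral _ X _]E [X in _ = integral _ X _]E !integral_set0.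
rewrite (_ : _ `&` _ = dcube k m'); last by apply/setIidPr; exact: (dcube_nest jk xm xm').
rewrite (eq_integral (fun=> (average (dcube k m') v)%:E)); last first.
  by move=> y /set_mem /dcubeP ->.
have iQ : leb.-integrable (dcube k m') (EFin \o v) by exact: integrableS measurableT (mcube k m') _ iv.
rewrite integral_cst; last exact: mcube.
rewrite [X in (_ * X)%E](leb_dcube k m') /average [leb (dcube k m')](leb_dcube k m') /= -EFinM mulrAC.
rewrite mulVf ?mul1r; last by rewrite expf_neq0// gt_eqF// side_gt0.
rewrite /Rintegral fineK//; have := integrable_fin_num (mcube k m') iQ; by [].
Qed.

(** Averaging over the cubes of a fine level preserves integrals over the cubes of a
    coarser one. *)
Lemma Rint_average (v : 'rV[R]_d -> R) j k (m : 'rV[int]_d) : (j <= k)%N ->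
  leb.-integrable setT (EFin \o v) ->
  leb.-integrable (dcube j m) (EFin \o (fun x => average (dcube k (idx k x)) v)) /\
  \int[leb]_(x in dcube j m) (average (dcube k (idx k x)) v) = \int[leb]_(x in dcube j m) (v x).
Proof.
move=> jk iv.
have P w : leb.-integrable setT (EFin \o w) -> (forall x, 0 <= w x) ->
   leb.-integrable (dcube j m) (EFin \o (fun x => average (dcube k (idx k x)) w)) /\
   \int[leb]_(x in dcube j m) (average (dcube k (idx k x)) w) = \int[leb]_(x in dcube j m) (w x).
  move=> iw w0; have E := int_average_ge0 m jk iw w0; split; last by rewrite /Rintegral E.
  have iQ : leb.-integrable (dcube j m) (EFin \o w) by exact: integrableS measurableT (mcube j m) _ iw.
  apply/integrableP; split.
    apply: measurable_funTS; exact: (@measurable_step R d k _ _ (fun m => (average (dcube k m) w)%:E)).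
  have /integrableP[_] := iQ.
  rewrite (eq_integral (fun x : lebesgueType R d => (w x)%:E)); last first.
    by move=> x _; rewrite gee0_abs// lee_fin.
  rewrite -E [X in _ -> (X < _)%E](eq_integral (fun x : lebesgueType R d => (average (dcube k (idx k x)) w)%:E))//.
  by move=> x _; rewrite gee0_abs// lee_fin; exact: average_ge0.
have mv : measurable_fun setT (v : lebesgueType R d -> R).
  by apply/measurable_EFinP; exact: measurable_int iv.
pose vp x := Num.max (v x) 0; pose vn x := Num.max (- v x) 0.
have vE x : v x = vp x - vn x.
  rewrite /vp /vn; have [h|h] := leP (v x) 0.
    by rewrite max_l ?oppr_ge0// sub0r opprK.
  by rewrite max_r ?subr0// oppr_le0 ltW.
have ip : leb.-integrable setT (EFin \o vp).
  apply: (le_integrable measurableT _ _ iv).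
    by apply/measurable_EFinP; apply: measurable_maxr => //; exact: measurable_cst.
  move=> x _; rewrite lee_fin /vp /=; have [h|h] := leP (v x) 0; by rewrite ?normr0.
have iN : leb.-integrable setT (EFin \o vn).
  apply: (le_integrable measurableT _ _ iv).
    apply/measurable_EFinP; apply: measurable_maxr; last exact: measurable_cst.
    by apply: measurable_funN.
  move=> x _; rewrite lee_fin /vn /=; have [h|h] := leP (- v x) 0; by rewrite ?normr0 ?normrN.
have vp0 x : 0 <= vp x by rewrite /vp le_max lexx orbT.
have vn0 x : 0 <= vn x by rewrite /vn le_max lexx orbT.
have [i1 E1] := P _ ip vp0.
have [i2 E2] := P _ iN vn0.
have AE (x : 'rV[R]_d) : average (dcube k (idx k x)) v = average (dcube k (idx k x)) vp - average (dcube k (idx k x)) vn.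
  rewrite /average -mulrBr; congr (_ * _); rewrite -RintegralB.
  - by apply: eq_Rintegral => y _; exact: vE.
  - exact: mcube.
  - exact: integrableS measurableT (mcube _ _) _ ip.
  - exact: integrableS measurableT (mcube _ _) _ iN.
split.
  have := integrableB (mcube j m) i1 i2; apply: eq_integrable; first exact: mcube.
  by move=> x _; rewrite /= AE.
transitivity (\int[leb]_(x in dcube j m) (average (dcube k (idx k x)) vp - average (dcube k (idx k x)) vn)).
  by apply: eq_Rintegral => x _; exact: AE.
rewrite RintegralB//.
rewrite E1 E2 -RintegralB; [|exact: mcube|exact: integrableS measurableT (mcube _ _) _ ip|exact: integrableS measurableT (mcube _ _) _ iN].
by apply: eq_Rintegral => y _; rewrite vE.
Qed.

End martingale.

Section conclusion.
Context {R : realType} {d : nat}.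
Local Notation leb := (@leb R d).
Variables (g : 'rV[R]_d -> R) (lambda : R).
Hypothesis l0 : 0 < lambda.
Hypothesis bg : besov d lambda g.

(** The averages of [g] over finer and finer cubes tend in [L^1] to the trace of its
    extension and have the same integrals as [g] over a fixed dyadic cube. *)
Lemma btrace_ext_ae : {ae leb, forall x, btrace (ext g) x = g x}.
Proof.
have ig := besov_integrable bg.
have ib : leb.-integrable setT (EFin \o btrace (ext g)).
  exact: integrable_btrace l0 (L1loc_ext g) (egrad_weak g) (ext_energy_fin l0 bg).
pose u x := btrace (ext g) x - g x.
have iu : leb.-integrable setT (EFin \o u).
  by have := integrableB measurableT ib ig; apply: eq_integrable.
have : {ae leb, forall x, u x = 0}; last first.
  move=> H; apply: (negligibleS _ H) => x; apply: contra_not => /eqP.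
  by rewrite /u subr_eq0 => /eqP.
apply: (dyadic_integrals_ae_eq0 iu) => k m.
have mQ : measurable (dcube k m : set (lebesgueType R d)).
  exact: borel_measurable_lebesgue (measurable_dcube k m).
have iQ (v : 'rV[R]_d -> R) : leb.-integrable setT (EFin \o v) -> leb.-integrable (dcube k m) (EFin \o v).
  by move=> iv; exact: integrableS measurableT mQ _ iv.
rewrite -(fineK (integrable_fin_num mQ (iQ _ iu))); congr EFin.
rewrite -[LHS]/(\int[leb]_(x in dcube k m) u x).
apply/eqP; rewrite -normr_le0; apply/ler_addgt0Pr => e e0; rewrite add0r.
have [N HN] := coef_cvg_btrace l0 bg e0.
pose j := maxn N k; have Nj : (N <= j)%N by rewrite leq_maxl.
have kj : (k <= 2 ^ j)%N by apply: leq_trans (leq_maxr N k) _; exact/ltnW/ltn_expl.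
have [ia Ea] := Rint_average m kj ig.
have -> : \int[leb]_(x in dcube k m) u x =
    \int[leb]_(x in dcube k m) (btrace (ext g) x - coef g j (idx (2 ^ j) x)).
  by rewrite !RintegralB//; [congr (_ - _); rewrite -Ea|exact: iQ|exact: iQ|exact: iQ].
have id' : leb.-integrable (dcube k m) (EFin \o (fun x => btrace (ext g) x - coef g j (idx (2 ^ j) x))).
  by have := integrableB mQ (iQ _ ib) ia; apply: eq_integrable.
apply: le_trans (le_normr_Rintegral mQ id') _; rewrite -lee_fin /Rintegral fineK; last first.
  by apply: integrable_fin_num => //; have := integrable_norm id'; apply: eq_integrable.
apply: le_trans (ltW (HN j Nj)).
under eq_integral do rewrite distrC.
apply: ge0_subset_integral; [exact: mQ|exact: measurableT| |by move=> x _; rewrite lee_fin|by []].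
apply/measurable_EFinP; apply: measurable_dist; last exact: measurable_btrace.
exact: (@measurable_step R d (2 ^ j) _ R (coef g j)).
Qed.

Lemma ext_trace : is_trace (ext g) g.
Proof.
have tr := btrace_is_trace l0 (L1loc_ext g) (egrad_weak g) (ext_energy_fin l0 bg).
apply: (negligibleS _ (negligibleU tr btrace_ext_ae)) => x H.
have [E|] := pselect (btrace (ext g) x = g x); last by right.
by left; rewrite /= E.
Qed.

End conclusion.

Theorem corollary1p5 (R : realType) (d : nat) (lambda : R)
    (hd : (1 <= d)%N) (hlambda : 0 < lambda) :
  is_trace_space (besov d lambda) (sobolev11 d lambda).
Proof.
split=> [f [lf [g [lg fin]]]|g bg].
  exists (btrace f).
    exact: (besov_btrace hlambda lf lg fin).
  exact: (btrace_is_trace hlambda lf lg fin).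
exists (ext g).
  exact: (sobolev_ext hlambda bg).
exact: (ext_trace hlambda bg).
Qed.
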